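(* Let $\phi$ be an admissible action density and $\gamma\in\mathcal M^+_{\rm loc}(\mathbb R^d)$ with $\tilde m_{-\kappa}(\gamma)<\infty$, and let $\sigma\in\mathcal P(\mathbb R^d)$ be a Borel probability measure. Then $\mathcal M_{\phi,\gamma}[\sigma]\subset\mathcal P(\mathbb R^d)$; convergence with respect to $\mathcal W_{\phi,\gamma}$ implies narrow convergence of probability measures; and $\mathcal P(\mathbb R^d)$ endowed with the (possibly infinite-valued) distance $\mathcal W_{\phi,\gamma}$ is complete.
   Context: Notation: $\mathcal M^+_{\rm loc}(\mathbb R^d)$ is the set of nonnegative Radon measures on $\mathbb R^d$ and $\mathcal M_{\rm loc}(\mathbb R^d;\mathbb R^d)$ the set of $\mathbb R^d$-valued Radon measures, both endowed with the weak$^*$ topology induced by duality with compactly supported continuous functions; $|\boldsymbol\nu|$ is the total variation measure of $\boldsymbol\nu$; $B_R$ is the open ball of radius $R$ centered at $0$; $p\in(1,\infty)$ and $q=p/(p-1)$. An admissible action density is a function $\phi:(0,\infty)\times\mathbb R^d\to[0,\infty)$ which is convex, satisfies $\phi(\rho,\lambda w)=|\lambda|^p\phi(\rho,w)$ for all $\rho>0,\lambda\in\mathbb R,w\in\mathbb R^d$, and for which there is $\rho_0>0$ with $\phi(\rho_0,w)>0$ for all $w\ne0$. It is extended to $\rho=0$ by $\phi(0,w):=\lim_{\rho\downarrow0}\phi(\rho,w)\in[0,\infty]$ (the map $\rho\mapsto\phi(\rho,w)$ is nonincreasing), and its recession function is $\phi^\infty(\rho,w):=\lim_{\lambda\to+\infty}\lambda^{-1}\phi(\lambda\rho,\lambda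 w)\in[0,\infty]$ for $\rho\ge0$. Action functional: given $\gamma\in\mathcal M^+_{\rm loc}(\mathbb R^d)$, $\mu\in\mathcal M^+_{\rm loc}(\mathbb R^d)$, $\boldsymbol\nu\in\mathcal M_{\rm loc}(\mathbb R^d;\mathbb R^d)$ with $\mathrm{supp}\,\mu,\mathrm{supp}\,\boldsymbol\nu\subset\mathrm{supp}\,\gamma$, write the Lebesgue decompositions $\mu=\rho\gamma+\mu^\perp$, $\boldsymbol\nu=w\gamma+\boldsymbol\nu^\perp$, pick any $\sigma\in\mathcal M^+_{\rm loc}(\mathbb R^d)$ with $\mu^\perp=\rho^\perp\sigma$, $\boldsymbol\nu^\perp=w^\perp\sigma$, and set $\Phi(\mu,\boldsymbol\nu|\gamma):=\int\phi(\rho,w)\,d\gamma+\int\phi^\infty(\rho^\perp,w^\perp)\,d\sigma$ (independent of $\sigma$); set $\Phi(\mu,\boldsymbol\nu|\gamma)=+\infty$ if the support condition fails. Continuity equation: for $T>0$, $\mathrm{CE}(0,T)$ is the set of pairs $(\mu,\boldsymbol\nu)$ where $(\mu_t)_{t\in[0,T]}$ is a weakly$^*$ continuous curve in $\mathcal M^+_{\rm loc}(\mathbb R^d)$, $(\boldsymbol\nu_t)_{t\in(0,T)}$ is a Borel family in $\mathcal M_{\rm loc}(\mathbb R^d;\mathbb R^d)$ with $\int_0^T|\boldsymbol\nu_t|(B_R)\,dt<\infty$ for all $R>0$, and $\int_0^T\!\int\partial_t\zeta\,d\mu_t\,dt+\int_0^T\!\int\nabla_x\zeta\cdot d\boldsymbol\nu_t\,dt=0$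 for all $\zeta\in C^1_c(\mathbb R^d\times(0,T))$; $\mathrm{CE}(0,T;\sigma\to\eta)$ is the subset with $\mu_0=\sigma$, $\mu_T=\eta$. Weighted Wasserstein distance: $\mathcal W_{\phi,\gamma}(\mu_0,\mu_1):=\big(\inf\{\int_0^1\Phi(\mu_t,\boldsymbol\nu_t|\gamma)\,dt:(\mu,\boldsymbol\nu)\in\mathrm{CE}(0,1;\mu_0\to\mu_1)\}\big)^{1/p}\in[0,\infty]$, and $\mathcal M_{\phi,\gamma}[\sigma]:=\{\mu\in\mathcal M^+_{\rm loc}(\mathbb R^d):\mathcal W_{\phi,\gamma}(\mu,\sigma)<\infty\}$. $\phi$ is called $\theta$-homogeneous if $\phi(\lambda\rho,\lambda w)=\lambda^\theta\phi(\rho,w)$ for all $\lambda,\rho>0$, $w\in\mathbb R^d$. For $\mu\in\mathcal M^+_{\rm loc}(\mathbb R^d)$ and $r\in\mathbb R$, $\tilde m_r(\mu):=\int(1\vee|x|)^r\,d\mu(x)$. The exponent $\kappa$ is defined as $\kappa:=p/(\theta-1)$ if $\phi$ is $\theta$-homogeneous for some $\theta\in(1,p]$, and $\kappa:=q$ otherwise. *)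

(* Defs.v *)
From HB Require Import structures.
From mathcomp Require Import all_boot all_order all_algebra.
From mathcomp Require Import all_classical all_reals all_analysis measurable_realfun.
Set Implicit Arguments.
Unset Strict Implicit.
Unset Printing Implicit Defensive.
Import Order.TTheory GRing.Theory Num.Theory.
Import numFieldNormedType.Exports.
Local Open Scope classical_set_scope.
Local Open Scope ring_scope.

Section WeightedWasserstein.
Context {R : realType} {d : nat}.

Notation Rd := 'rV[R]_d.

Definition BRd := g_sigma_algebraType (@open Rd).

Definition enorm (x : Rd) : R := Num.sqrt (\sum_i x ord0 i ^+ 2).
Definition eball (x : Rd) (r : R) : set BRd := [set y | enorm (y - x) < r].
Definition B0 (r : R) : set BRd := [set y | enorm y < r].

Notation Meas := ({measure set BRd -> \bar R}).

Definition radon (mu : Meas) : Prop := forall r : R, (mu (B0 r) < +oo)%E.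

Definition probm (mu : Meas) : Prop := mu setT = 1%E.

Definition Cc (f : Rd -> R) : Prop :=
  continuous f /\ exists r : R, forall x, r <= enorm x -> f x = 0.
Definition Cb (f : Rd -> R) : Prop :=
  continuous f /\ exists M : R, forall x, `|f x| <= M.

Definition msupp (mu : Meas) : set Rd :=
  [set x | forall r : R, 0 < r -> (0 < mu (eball x r))%E].

(** R^d-valued Radon measures, represented as  nu = v lambda  with
    lambda in M^+_loc and v a Borel, locally lambda-integrable density. *)
Record vmeas := VMeas { vbase : Meas ; vdens : Rd -> Rd }.

Definition is_vmeas (nu : vmeas) : Prop :=
  radon (vbase nu) /\
  (forall i, measurable_fun setT (fun x : BRd => vdens nu x ord0 i)) /\
  (forall r : R, (\int[vbase nu]_(x in B0 r) (enorm (vdens nu x))%:E < +oo)%E).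

Definition vcomp (nu : vmeas) (i : 'I_d) (A : set BRd) : \bar R :=
  (\int[vbase nu]_(x in A) (vdens nu x ord0 i)%:E)%E.

Definition vtv (nu : vmeas) (A : set BRd) : \bar R :=
  (\int[vbase nu]_(x in A) (enorm (vdens nu x))%:E)%E.

Definition bounded_set (A : set BRd) : Prop := exists r : R, A `<=` B0 r.

Definition vsupp (nu : vmeas) : set Rd :=
  [set x | forall r : R, 0 < r -> (0 < vtv nu (eball x r))%E].

Definition admissible (p : R) (phi : R -> Rd -> R) : Prop :=
  (forall rho w, 0 < rho -> 0 <= phi rho w) /\
  (forall r1 r2 (w1 w2 : Rd) (l : R), 0 < r1 -> 0 < r2 -> 0 <= l <= 1 ->
     phi (l * r1 + (1 - l) * r2) (l *: w1 + (1 - l) *: w2)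
       <= l * phi r1 w1 + (1 - l) * phi r2 w2) /\
  (forall rho (l : R) w, 0 < rho -> phi rho (l *: w) = `|l| `^ p * phi rho w) /\
  (exists rho0, 0 < rho0 /\ forall w : Rd, w != 0 -> 0 < phi rho0 w).

Definition phibar (phi : R -> Rd -> R) (rho : R) (w : Rd) : \bar R :=
  if 0 < rho then (phi rho w)%:E
  else lim ((fun r => (phi r w)%:E) @ 0^'+).

Definition phiinf (phi : R -> Rd -> R) (rho : R) (w : Rd) : \bar R :=
  lim (((l^-1)%:E * phibar phi (l * rho) (l *: w))%E @[l --> +oo]).

(** Lebesgue-decomposition data for (mu, nu) with respect to gamma:
    mu = rho gamma + rhop sigma, nu = w gamma + wp sigma, sigma _|_ gamma. *)
Definition decomp_data (gamma mu : Meas) (nu : vmeas)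
    (rho : Rd -> R) (w : Rd -> Rd) (sigma : Meas) (rhop : Rd -> R) (wp : Rd -> Rd)
    : Prop :=
  radon sigma /\
  (exists N : set BRd, measurable N /\ gamma N = 0%E /\ sigma (~` N) = 0%E) /\
  (forall x, 0 <= rho x) /\ (forall x, 0 <= rhop x) /\
  measurable_fun setT (rho : BRd -> R) /\ measurable_fun setT (rhop : BRd -> R) /\
  (forall i, measurable_fun setT (fun x : BRd => w x ord0 i)) /\
  (forall i, measurable_fun setT (fun x : BRd => wp x ord0 i)) /\
  (forall r : R, (\int[gamma]_(x in B0 r) (enorm (w x))%:E < +oo)%E) /\
  (forall r : R, (\int[sigma]_(x in B0 r) (enorm (wp x))%:E < +oo)%E) /\
  (forall A, measurable A ->
     mu A = (\int[gamma]_(x in A) (rho x)%:E + \int[sigma]_(x in A) (rhop x)%:E)%E) /\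
  (forall A i, measurable A -> bounded_set A ->
     vcomp nu i A = (\int[gamma]_(x in A) (w x ord0 i)%:E
                    + \int[sigma]_(x in A) (wp x ord0 i)%:E)%E).

(** The action functional Phi(mu, nu | gamma).  The value does not depend on
    the decomposition data, so we take the infimum over all admissible data
    (which always exist). *)
Definition Phi (phi : R -> Rd -> R) (gamma mu : Meas) (nu : vmeas) : \bar R :=
  if `[< msupp mu `<=` msupp gamma /\ vsupp nu `<=` msupp gamma >] then
    ereal_inf [set v | exists rho w sigma rhop wp,
       decomp_data gamma mu nu rho w sigma rhop wp /\
       v = (\int[gamma]_x phibar phi (rho x) (w x)
            + \int[sigma]_x phiinf phi (rhop x) (wp x))%E]
  else +oo%E.

Definition partial_t (zeta : Rd -> R -> R) (x : Rd) (t : R) : R := derive1 (zeta x) t.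
Definition partial_x (zeta : Rd -> R -> R) (i : 'I_d) (x : Rd) (t : R) : R :=
  'D_(delta_mx ord0 i) (fun y => zeta y t) x.

Definition C1c (T : R) (zeta : Rd -> R -> R) : Prop :=
  (forall x t, derivable (zeta x) t 1) /\
  (forall i x t, derivable (fun y => zeta y t) x (delta_mx ord0 i)) /\
  continuous (fun pt : Rd * R => zeta pt.1 pt.2) /\
  continuous (fun pt : Rd * R => partial_t zeta pt.1 pt.2) /\
  (forall i, continuous (fun pt : Rd * R => partial_x zeta i pt.1 pt.2)) /\
  (exists r a b : R, 0 < a /\ b < T /\
     forall x t, r <= enorm x \/ t < a \/ b < t -> zeta x t = 0).

Notation leb := (@lebesgue_measure R).

Definition oitv (T : R) : set R := `]0, T[.

Definition CE (T : R) (mu : R -> Meas) (nu : R -> vmeas) : Prop :=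
  (forall t, 0 <= t <= T -> radon (mu t)) /\
  (forall f, Cc f ->
     {within `[0, T], continuous (fun t => \int[mu t]_x (f x)%:E)%E}) /\
  (forall t, 0 < t < T -> is_vmeas (nu t)) /\
  (forall f i, Cc f ->
     measurable_fun (oitv T) (fun t : R => (\int[vbase (nu t)]_x (f x * vdens (nu t) x ord0 i)%:E)%E : \bar R)) /\
  (forall r : R, (\int[leb]_(t in oitv T) vtv (nu t) (B0 r) < +oo)%E) /\
  (forall zeta, C1c T zeta ->
     (\int[leb]_(t in oitv T) \int[mu t]_x (partial_t zeta x t)%:E
      + \int[leb]_(t in oitv T) \int[vbase (nu t)]_x
           (\sum_i partial_x zeta i x t * vdens (nu t) x ord0 i)%:E)%E = 0%E).

Definition CE_from_to (T : R) (s e : Meas) (mu : R -> Meas) (nu : R -> vmeas) : Prop :=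
  CE T mu nu /\ (forall A, measurable A -> mu 0 A = s A /\ mu T A = e A).

Definition Wdist (p : R) (phi : R -> Rd -> R) (gamma mu0 mu1 : Meas) : \bar R :=
  (ereal_inf [set a | exists mu nu, CE_from_to 1 mu0 mu1 mu nu /\
      a = \int[leb]_(t in oitv 1) Phi phi gamma (mu t) (nu t)] `^ p^-1)%E.

Definition homog (theta : R) (phi : R -> Rd -> R) : Prop :=
  forall (l rho : R) w, 0 < l -> 0 < rho -> phi (l * rho) (l *: w) = l `^ theta * phi rho w.

Definition is_kappa (p : R) (phi : R -> Rd -> R) (kappa : R) : Prop :=
  (exists theta, 1 < theta <= p /\ homog theta phi /\ kappa = p / (theta - 1)) \/
  ((~ exists theta, 1 < theta <= p /\ homog theta phi) /\ kappa = p / (p - 1)).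

Definition mtilde (r : R) (mu : Meas) : \bar R :=
  (\int[mu]_x (Num.max 1 (enorm x) `^ r)%:E)%E.

Definition narrow_cvg (mun : nat -> Meas) (mu : Meas) : Prop :=
  forall f, Cb f ->
    (fun n => \int[mun n]_x (f x)%:E)%E @ \oo --> (\int[mu]_x (f x)%:E)%E.

End WeightedWasserstein.

(* Main.v *)
Require Import Defs.
From HB Require Import structures.
From mathcomp Require Import all_boot all_order all_algebra.
From mathcomp Require Import all_classical all_reals all_analysis measurable_realfun.
From mathcomp Require Import ring lra.
Import Order.TTheory GRing.Theory Num.Theory.
Import numFieldNormedType.Exports.
Set Implicit Arguments.
Unset Strict Implicit.
Unset Printing Implicit Defensive.
Local Open Scope classical_set_scope.
Local Open Scope ring_scope.

(** Convexity and p-homogeneity of phi give, for M large and 0 <= y <= 1,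
      y^(p-1) |w| / M <= delta (phi(r, w) + y^p r) + C M^(-kappa).
    Let y^p be a cutoff at radius M whose gradient is at most C y^(p-1) / M.  Tested
    with it, the continuity equation shows that the mass near B_M varies along a
    curve of finite action by at most delta times (action + mass) plus the
    gamma-integral of |x|^(-kappa) outside B_M.  Hence a curve of finite action that
    contains a probability measure consists of probability measures, and the mass at
    infinity is controlled uniformly on bounded sets of actions.  With a fixed test
    function f in place of the cutoff, the same estimate bounds the oscillation of
    t -> int f dmu_t by a modulus of the action, so that convergence in W is vague,
    and narrow because no mass is lost.

    For completeness, the vague limit of a Cauchy sequence is a positive functional on
    C_c, represented by a probability measure (Daniell).  A subsequence with
    W(mu_k, mu_(k+1)) < e 2^(-k-1) is joined by curves rescaled to the intervals
    [1 - 2^(-k), 1 - 2^(-k-1)]; by p-homogeneity their concatenation has action at most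
    e^p, and it reaches the limit at time 1 by the modulus of continuity.

    Neither the measurability in time of the action nor its lower semicontinuity is
    needed: the integral of a nonnegative function is a lower integral, and only the
    inequalities that hold for lower integrals are used. *)

(** * Lower integrals *)

(** The estimate behind all others is [phi_base]. Convexity and homogeneity give |w|^p <= C (1 +
    r)^(p-1) phi(r, w), and splitting this product with a weight s, as in Young's inequality, gives
    |w| <= c (s^(p-1) phi(r, w) + (1 + r) / s). The decay M^(-kappa) is what remains of the term 1 /
    s once the coefficients of phi and of y^p r have been brought below delta. For a
    theta-homogeneous phi a dilation (l r, l w) is a second free parameter, and the exponent becomes
    larger.

    The cutoff estimate is circular: its right side contains the mass seen by the cutoff at all
    times. A first use with delta = 1/2, up to the time where this mass is maximal, absorbs the
    circularity and bounds the mass by the action; only a second use has a small delta.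

    For a glued pair the local integrability of the flux comes from the action bound and the unit
    mass. It is proved before the weak equation, because the equation is verified through integrals
    over the separate pieces. *)

Section lower_integral.
Context d (T : measurableType d) (R : realType) (mu : {measure set T -> \bar R}).
Local Open Scope ereal_scope.
Import HBNNSimple.

Lemma lint_le (D : set T) (f g : T -> \bar R) :
  (forall x, D x -> 0 <= f x) -> (forall x, D x -> f x <= g x) ->
  \int[mu]_(x in D) f x <= \int[mu]_(x in D) g x.
Proof.
move=> f0 fg; rewrite !ge0_integralE//; last first.
  by move=> x Dx; exact: le_trans (f0 _ Dx) (fg _ Dx).
apply: ge_ereal_sup => _ [h hf <-]; apply: ereal_sup_ubound; exists h => // x.
apply: le_trans (hf x) _; rewrite /patch; case: ifPn => // xD.
by apply: fg; rewrite inE in xD.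
Qed.

(** A lower integral is a supremum over simple minorants, hence over measurable ones. The next
    lemmas use this to trade an arbitrary integrand for a measurable minorant, to which the usual
    calculus applies. *)
Lemma lint_sup (D : set T) (g : T -> \bar R) (c : \bar R) : measurable D ->
  (forall x, D x -> 0 <= g x) ->
  (forall h : T -> R, measurable_fun setT h -> (forall x, (0 <= h x)%R) ->
     (forall x, D x -> (h x)%:E <= g x) -> \int[mu]_(x in D) (h x)%:E <= c) ->
  \int[mu]_(x in D) g x <= c.
Proof.
move=> mD g0 H; rewrite ge0_integralE//; apply: ge_ereal_sup => _ [h hg <-].
(* A simple function below the restriction of [g] to [D] is nonnegative and at most 0 off [D], so it
   equals its own restriction. *)
have hD x : h x = (h \_ D) x.
  rewrite /patch; case: ifPn => // xD.
  have := hg x; rewrite /patch (negbTE xD) lee_fin => hx0.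
  by apply/eqP; rewrite eq_le hx0 /=; exact: fun_ge0.
rewrite (eq_sintegral (h \_ D))//.
rewrite -integral_nnsfun//; apply: H => //.
by move=> x Dx; have := hg x; rewrite /patch mem_set.
Qed.

Lemma lint_scale (D : set T) (g : T -> \bar R) (k : R) : measurable D ->
  (0 <= k)%R -> (forall x, D x -> 0 <= g x) ->
  \int[mu]_(x in D) (k%:E * g x) <= k%:E * \int[mu]_(x in D) g x.
Proof.
move=> mD k0 g0; move: (k0); rewrite le_eqVlt => /predU1P[<-|kp].
  by rewrite mul0e integral0_eq// => x _; rewrite mul0e.
apply: lint_sup => //.
  by move=> x Dx; rewrite mule_ge0// ?lee_fin// g0.
move=> h mh h0 hg; rewrite -lee_pdivrMl//.
rewrite -ge0_integralZl_EFin ?invr_ge0//; first last.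
- by apply/measurable_EFinP; exact: measurable_funTS.
- by move=> x _; rewrite lee_fin.
apply: lint_le => x Dx; first by rewrite mule_ge0 ?lee_fin ?invr_ge0.
by rewrite lee_pdivrMl// hg.
Qed.

(** For lower integrals only the opposite inequality is automatic. Measurability of [h] gives this
    one: for a measurable u <= g + h, the function max(u - h, 0) is a measurable minorant of [g],
    and its sum with [h] is at least u. *)
Lemma lint_add (D : set T) (g h : T -> \bar R) : measurable D ->
  (forall x, D x -> 0 <= g x) -> (forall x, D x -> 0 <= h x) ->
  measurable_fun D h ->
  \int[mu]_(x in D) (g x + h x) <= \int[mu]_(x in D) g x + \int[mu]_(x in D) h x.
Proof.
move=> mD g0 h0 mh; apply: lint_sup => //.
  by move=> x Dx; rewrite adde_ge0// ?g0 ?h0.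
move=> u mu_ u0 ugh.
have muD : measurable_fun D (EFin \o u) by apply/measurable_EFinP; exact: measurable_funTS.
pose w x := maxe ((u x)%:E - h x) 0.
have mw : measurable_fun D w.
  apply: measurable_maxe; last exact: measurable_cst.
  exact: emeasurable_funB.
have w0 x : 0 <= w x by rewrite le_max lexx orbT.
apply: (@le_trans _ _ (\int[mu]_(x in D) (w x + h x))).
  apply: lint_le => x Dx; first by rewrite lee_fin.
  have := h0 _ Dx; rewrite /w; case: (h x) => [r| |]//= _.
    by rewrite -leeBlDr//= le_max lexx.
  by rewrite /= maxNye add0e leey.
rewrite ge0_integralD//; first last.
apply: leeD => //; apply: lint_le => // x Dx.
rewrite /w ge_max g0// andbT; have := ugh _ Dx; have := h0 _ Dx.
case: (h x) => [r| |]// _; first by rewrite leeBlDr.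
by move=> _; rewrite (le_trans _ (g0 _ Dx))// leNye.
Qed.

(** Splits the action of a concatenated curve along its time intervals; the endpoints of these
    intervals form the null remainder. *)
Lemma lint_bigcup (D : set T) (F : (set T)^nat) (g : T -> \bar R) : measurable D ->
  (forall k, measurable (F k)) -> trivIset setT F -> (forall k, F k `<=` D) ->
  mu (D `\` \bigcup_k F k) = 0 -> (forall x, D x -> 0 <= g x) ->
  \int[mu]_(x in D) g x <= \sum_(k <oo) \int[mu]_(x in F k) g x.
Proof.
move=> mD mF tF FD D0 g0; apply: lint_sup => // h mh h0 hg.
have mU : measurable (\bigcup_k F k) by exact: bigcup_measurable.
have mhE A : measurable_fun A (EFin \o h) by apply/measurable_EFinP; exact: measurable_funTS.
have UD : \bigcup_k F k `<=` D by move=> x [k _ /FD].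
have -> : D = \bigcup_k F k `|` (D `\` \bigcup_k F k) by rewrite setDUK.
rewrite ge0_integral_setU//; try exact: mhE; try exact: measurableD; last first.
  by rewrite disj_set2E setDE setICA setICr setI0.
  by move=> x _; rewrite lee_fin.
rewrite [X in _ + X](_ : _ = 0) ?adde0; last first.
  by apply: null_set_integral => //; exact: measurableD.
rewrite ge0_integral_bigcup//; last by move=> x _; rewrite lee_fin.
apply: lee_nneseries => [k _ _|k _]; first by apply: integral_ge0 => x _; rewrite lee_fin.
by apply: lint_le => x Fx; [rewrite lee_fin|apply/hg/(FD k)].
Qed.

End lower_integral.

(** * Affine change of variable on the line, for ordinary and for lower integrals *)

Section affine_change.
Context (R : realType).
Local Notation leb := (@lebesgue_measure R).
Local Open Scope ereal_scope.

Definition affine (a tau : R) (t : R) : measurableTypeR R := (a + tau * t)%R.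

Lemma measurable_affine (a tau : R) (D : set R) : measurable_fun D (affine a tau).
Proof.
by apply: measurable_funD => //; exact: measurable_funM.
Qed.

(** Both sides are measures that agree on half-open intervals, so uniqueness of Lebesgue measure
    applies. *)
Lemma leb_affine (a tau : R) (A : set R) : (0 < tau)%R -> measurable A ->
  tau%:E * leb (affine a tau @^-1` A) = leb A.
Proof.
move=> t0 mA.
have maff := measurable_affine a tau (D := setT).
pose m : {measure set (measurableTypeR R) -> \bar R} :=
  mscale (NngNum (ltW t0)) (pushforward leb (affine a tau)).
have H : forall X, ocitv X -> leb X = m maff X.
  move=> _ [[x y]] _ <-.
  change (leb [set` `]x, y]%R] = tau%:E * leb (affine a tau @^-1` [set` `]x, y]%R])).
  rewrite [X in _ * leb X](_ : _ = [set` `](x - a) / tau, (y - a) / tau]%R]); last first.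
    apply/seteqP; split => t; rewrite /affine /=!in_itv/= => /andP[].
      by rewrite ltr_pdivrMr// ler_pdivlMr// ltrBlDl lerBrDl (mulrC t) => -> ->.
    by rewrite ltr_pdivrMr// ler_pdivlMr// ltrBlDl lerBrDl (mulrC t) => -> ->.
  rewrite !lebesgue_measure_itv/= !lte_fin ltr_pM2r ?invr_gt0// ltrD2r.
  case: ifPn => _; last by rewrite mule0.
  rewrite -!EFinD -EFinM -mulrBl mulrC divfK ?gt_eqF//.
  by congr EFin; ring.
by have := lebesgue_measure_unique H mA.
Qed.

Lemma ge0_integral_affine (a tau : R) (D : set R) (f : R -> \bar R) :
  (0 < tau)%R -> measurable D -> measurable_fun D f -> (forall x, D x -> 0 <= f x) ->
  tau%:E * \int[leb]_(x in affine a tau @^-1` D) f (affine a tau x)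
    = \int[leb]_(x in D) f x.
Proof.
move=> t0 mD mf f0; have maff := measurable_affine a tau (D := setT).
pose m : {measure set (measurableTypeR R) -> \bar R} :=
  mscale (NngNum (ltW t0)) (pushforward leb (affine a tau)).
transitivity (\int[m maff]_(x in D) f x).
  rewrite /m ge0_integral_mscale// ge0_integral_pushforward//.
  by move=> y /set_mem; exact: f0.
by apply: eq_measure_integral => A mA _; have := leb_affine a t0 mA.
Qed.

(** A measurable minorant is carried from one side to the other by the affine map or by its inverse
    [b]; each direction gives one inequality. *)
Lemma lint_affine (a tau : R) (D : set R) (g : R -> \bar R) :
  (0 < tau)%R -> measurable D -> (forall x, D x -> 0 <= g x) ->
  \int[leb]_(x in affine a tau @^-1` D) g (affine a tau x)
    = tau^-1%:E * \int[leb]_(x in D) g x.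
Proof.
move=> t0 mD g0; have mA := measurable_affine a tau.
have mP : measurable (affine a tau @^-1` D).
  by rewrite -[X in measurable X]setTI; exact: mA.
apply/eqP; rewrite eq_le; apply/andP; split; last first.
  rewrite lee_pdivrMl//; apply: lint_sup => // h mh h0 hg.
  rewrite -(ge0_integral_affine (f := EFin \o h) a t0 mD)//; first last.
  - by move=> x Dx; rewrite lee_fin.
  - by apply/measurable_EFinP; exact: measurable_funTS.
  rewrite lee_pmul2l//; apply: lint_le => x Dx; first by rewrite lee_fin.
  exact: hg.
apply: lint_sup => // [x Dx|h mh h0 hg]; first exact: g0.
rewrite lee_pdivlMl//.
pose b := affine (- a / tau) tau^-1.
have bK t : affine a tau (b t) = t by rewrite /b /affine; field; rewrite gt_eqF.
have aK t : b (affine a tau t) = t by rewrite /b /affine; field; rewrite gt_eqF.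
have -> : \int[leb]_(x in affine a tau @^-1` D) (h x)%:E =
    \int[leb]_(x in affine a tau @^-1` D) ((h \o b) (affine a tau x))%:E.
  by apply: eq_integral => x _ /=; rewrite aK.
have mhb : measurable_fun D (EFin \o (h \o b)).
  by apply/measurable_EFinP; apply: measurableT_comp => //; exact: measurable_affine.
rewrite (@ge0_integral_affine a tau D (EFin \o (h \o b)) t0 mD mhb); last first.
  by move=> x _ /=; rewrite lee_fin h0.
apply: lint_le => x Dx; first by rewrite lee_fin h0.
by have := hg (b x); rewrite /= bK; apply.
Qed.

Lemma integral_affine (a tau : R) (D : set R) (f : R -> \bar R) :
  (0 < tau)%R -> measurable D -> measurable_fun D f ->
  \int[leb]_(x in affine a tau @^-1` D) f (affine a tau x)
    = tau^-1%:E * \int[leb]_(x in D) f x.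
Proof.
move=> t0 mD mf; rewrite integralE [in RHS]integralE.
transitivity (\int[leb]_(x in affine a tau @^-1` D) f^\+ (affine a tau x) -
  \int[leb]_(x in affine a tau @^-1` D) f^\- (affine a tau x)).
  by congr (_ - _); apply: eq_integral => x _; rewrite ?funeposE ?funenegE.
rewrite !lint_affine//; have k0 : (0 < tau^-1)%R by rewrite invr_gt0.
case: (\int[leb]_(x in D) _) => [r| |]; case: (\int[leb]_(x in D) _) => [s| |];
  rewrite ?gt0_muley ?gt0_muleNy ?lte_fin//= ?gt0_muley ?gt0_muleNy ?lte_fin//=.
by rewrite -EFinM -EFinM mulrBr.
Qed.

End affine_change.

(** * The Euclidean norm and compactly supported functions *)

Lemma cvg_sumr {R : realType} (T : Type) (F : set_system T) {FF : Filter F}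
  (I : Type) (s : seq I) (f : I -> T -> R) (l : I -> R) :
  (forall i, f i x @[x --> F] --> l i) ->
  \sum_(i <- s) f i x @[x --> F] --> \sum_(i <- s) l i.
Proof.
move=> H; elim: s => [|i s IH].
  by under eq_fun do rewrite big_nil; rewrite big_nil; exact: cvg_cst.
by under eq_fun do rewrite big_cons; rewrite big_cons; apply: cvgD; [exact: H|exact: IH].
Qed.

Section euclidean.
Context {R : realType} {d : nat}.
Notation Rd := 'rV[R]_d.
Implicit Types x y : Rd.

Lemma coord_le_norm x i : `|x ord0 i| <= `|x|.
Proof.
rewrite [leRHS]/Num.norm/= mx_normrE; apply/bigmax_geP; right => /=.
by exists (ord0, i).
Qed.

Lemma norm_le_coord x (r : R) : 0 <= r -> (forall i, `|x ord0 i| <= r) -> `|x| <= r.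
Proof.
move=> r0 H; rewrite [leLHS]/Num.norm/= mx_normrE; apply/bigmax_leP; split => //=.
by move=> [a i] _ /=; rewrite (ord1 a).
Qed.

Lemma enorm_ge0 x : 0 <= enorm x. Proof. exact: sqrtr_ge0. Qed.

Lemma sumsq_ge0 x : 0 <= \sum_i x ord0 i ^+ 2.
Proof. by apply: sumr_ge0 => i _; exact: sqr_ge0. Qed.

Lemma enorm_sqr x : enorm x ^+ 2 = \sum_i x ord0 i ^+ 2.
Proof. by rewrite sqr_sqrtr ?sumsq_ge0. Qed.

Lemma coord_le_enorm x i : `|x ord0 i| <= enorm x.
Proof.
rewrite -(@ler_pXn2r _ 2)// ?nnegrE ?enorm_ge0// enorm_sqr real_normK ?num_real//.
by rewrite (bigD1 i)//= lerDl sumr_ge0// => j _; exact: sqr_ge0.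
Qed.

Lemma norm_le_enorm x : `|x| <= enorm x.
Proof. by apply: norm_le_coord; [exact: enorm_ge0|exact: coord_le_enorm]. Qed.

Lemma enorm_le_sum x : enorm x <= \sum_i `|x ord0 i|.
Proof.
have S0 : 0 <= \sum_i `|x ord0 i| by exact: sumr_ge0.
rewrite -(@ler_pXn2r _ 2)// ?nnegrE ?enorm_ge0// enorm_sqr expr2 mulr_suml.
apply: ler_sum => i _; rewrite -real_normK ?num_real//.
by rewrite expr2 ler_wpM2l// (bigD1 i)//= lerDl sumr_ge0.
Qed.

(** [|x|] is the sup norm, which carries the topology and the compactness results, while balls and
    supports in the definitions are Euclidean. This bound and [norm_le_enorm] pass between the
    two. *)
Lemma enorm_le_norm x : enorm x <= d%:R * `|x|.
Proof.
apply: le_trans (enorm_le_sum x) _.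
apply: (@le_trans _ _ (\sum_(i < d) `|x|)).
  by apply: ler_sum => i _; exact: coord_le_norm.
by rewrite sumr_const card_ord mulr_natl.
Qed.

Lemma enormZ (k : R) x : enorm (k *: x) = `|k| * enorm x.
Proof.
rewrite /enorm -sqrtr_sqr -sqrtrM ?sqr_ge0//; congr Num.sqrt.
by rewrite mulr_sumr; apply: eq_bigr => i _; rewrite mxE exprMn.
Qed.

Lemma sumsq_continuous : continuous (fun x : Rd => \sum_i x ord0 i ^+ 2).
Proof.
move=> x.
apply: (@cvg_sumr R Rd (nbhs x) (nbhs_filter x)) => i.
by rewrite expr2; apply: cvgM; exact: coord_continuous.
Qed.

Lemma enorm_continuous : continuous (@enorm R d).
Proof.
move=> x; apply: (@continuous_comp _ _ _ (fun x : Rd => \sum_i x ord0 i ^+ 2) (@Num.sqrt R)).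
  exact: sumsq_continuous.
exact: sqrt_continuous.
Qed.

Lemma compact_enorm_le (r : R) : compact [set x : Rd | enorm x <= r].
Proof.
apply: bounded_closed_compact.
  exists r; split; first exact: num_real.
  move=> M rM x /= xr; apply: le_trans (norm_le_enorm x) _.
  exact: le_trans xr (ltW rM).
rewrite (_ : [set _ | _] = (@enorm R d) @^-1` [set t | t <= r])//.
by apply: closed_comp; [move=> x _; exact: enorm_continuous|exact: closed_le].
Qed.

Lemma open_measurable_BRd (U : set Rd) : open U -> measurable (U : set (@BRd R d)).
Proof. by move=> oU; apply: sub_sigma_algebra. Qed.

Lemma continuous_measurable (f : Rd -> R) :
  continuous f -> measurable_fun setT (f : @BRd R d -> R).
Proof.
move=> cf; apply: (measurability _ (RGenOInfty.measurableE R)) => _ [_ [a ->] <-].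
rewrite setTI; apply: open_measurable_BRd; rewrite preimage_itvoy.
rewrite (_ : [set _ | _] = f @^-1` [set t | a < t])//.
by apply: open_comp; [move=> x _; exact: cf|exact: open_gt].
Qed.

Lemma measurable_enorm : measurable_fun setT (@enorm R d : @BRd R d -> R).
Proof. by apply: continuous_measurable; exact: enorm_continuous. Qed.

Lemma measurable_B0 (r : R) : measurable (B0 r : set (@BRd R d)).
Proof.
apply: open_measurable_BRd; rewrite (_ : B0 r = (@enorm R d) @^-1` [set t | t < r])//.
by apply: open_comp; [move=> x _; exact: enorm_continuous|exact: open_lt].
Qed.

(** Compactness is used in its near-covering form: what holds near each point of [K] for all large n
    holds on the whole of [K] for all large n. The sphere argument for phi, uniform continuity and
    Dini's argument have the same shape. *)
Lemma compact_bounded_fun (T : topologicalType) (K : set T) (f : T -> R) :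
  compact K -> {in K, continuous f} -> exists2 M : R, 0 < M & forall x : T, K x -> `|f x| <= M.
Proof.
move=> cK cf.
have [n _] : \forall n \near \oo, K `<=` (fun z : T => `|f z| <= n%:R).
  apply: ((compact_near_coveringP K).1 cK nat \oo (fun n (z : T) => `|f z| <= n%:R)) => x Kx.
  exists ([set y | `|f x - f y| < 1], [set n | `|f x| + 1 <= n%:R]).
    split => /=; last exact: nbhs_infty_ger.
    by have /cvgr_dist_lt := cf x (mem_set Kx); apply.
  move=> [y n] /= [xy fn]; apply: le_trans fn.
  by rewrite -lerBlDl (le_trans _ (ltW xy))// (le_trans (lerB_dist _ _))// distrC.
move=> H; exists (n.+1%:R) => // x Kx; apply: le_trans (H n.+1 _ x Kx) _ => //=.
Qed.

Lemma Cc_bounded (f : Rd -> R) : Cc f -> exists2 M : R, 0 < M & forall x, `|f x| <= M.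
Proof.
move=> [cf [r fr]].
have [M M0 HM] := compact_bounded_fun (@compact_enorm_le r) (fun x _ => cf x).
exists M => // x; have [/HM//|xr] := leP (enorm x) r.
by rewrite fr ?normr0 ?ltW.
Qed.

End euclidean.

(** * Action densities and the action functional *)

(** [lim] chooses an element of the set of limits, and this set is the same for both functions
    whether or not they converge. *)
Lemma lim_near_eqe {R : realType} (T : Type) (F : set_system T) {FF : Filter F}
  (f g : T -> \bar R) : (\forall x \near F, f x = g x) -> lim (f @ F) = lim (g @ F).
Proof.
move=> fg; have gf : \forall x \near F, g x = f x by apply: filterS fg => x ->.
congr (get _); apply/funext => l; apply/propext; split => h.
  by apply: cvg_trans h; apply: near_eq_cvg.
by apply: cvg_trans h; apply: near_eq_cvg.
Qed.

Lemma powRV {R : realType} (x k : R) : 0 <= x -> x^-1 `^ k = x `^ (- k).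
Proof. by move=> x0; rewrite -[x^-1]powR_inv1// -powRrM mulN1r. Qed.

Section action_density.
Context {R : realType} {d : nat}.
Notation Rd := 'rV[R]_d.
Variables (p : R) (phi : R -> Rd -> R).
Hypotheses (p1 : 1 < p) (adm : admissible p phi).

Implicit Types (r s k l m n : R) (w v : Rd).

Let p0 : 0 < p. Proof. by rewrite (lt_trans _ p1). Qed.
Let pm1 : 0 < p - 1. Proof. by rewrite subr_gt0. Qed.

Lemma phi_ge0 r w : 0 < r -> 0 <= phi r w.
Proof. by move=> r0; apply adm.1. Qed.

Lemma phiZ r l w : 0 < r -> phi r (l *: w) = `|l| `^ p * phi r w.
Proof. by have [_ [_ [h _]]] := adm; exact: h. Qed.

Lemma phi_0 r : 0 < r -> phi r 0 = 0.
Proof. by move=> r0; rewrite -(scale0r 0) phiZ// normr0 powR0 ?gt_eqF// mul0r. Qed.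

Let powR_split (x : R) : 0 < x -> x `^ p * x `^ (1 - p) = x.
Proof.
move=> x0; have h : (p + (1 - p) == 0) ==> (x != 0) by apply/implyP => _; rewrite gt_eqF.
by rewrite -(powRD h) subrKC powRr1// ltW.
Qed.

(* Convexity between (r, w) and (eps, 0), with eps > 0 chosen to reach r'. *)
Lemma phi_shift r r' l w : 0 < r -> 0 < l < 1 -> l * r < r' ->
  phi r' w <= l `^ (1 - p) * phi r w.
Proof.
move=> r0 /andP[l0 l1] lr.
have l1' : 0 < 1 - l by rewrite subr_gt0.
have r'0 : 0 < r' by rewrite (lt_trans _ lr)// mulr_gt0.
pose eps := (r' - l * r) / (1 - l).
have e0 : 0 < eps by rewrite divr_gt0// subr_gt0.
have [_ [cvx _]] := adm.
have l01 : 0 <= l <= 1 by rewrite (ltW l0) (ltW l1).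
have := cvx r eps w 0 l r0 e0 l01.
rewrite scaler0 addr0 phi_0// mulr0 addr0 /eps mulrCA divff ?gt_eqF// mulr1.
rewrite addrC subrK phiZ// gtr0_norm// => H.
have lp : 0 < l `^ p by rewrite powR_gt0.
rewrite -(ler_pM2l lp); apply: le_trans H _.
by rewrite mulrA powR_split.
Qed.

Lemma le_of_scale (a b : R) : 0 <= b -> (forall c, 1 < c -> a <= c * b) -> a <= b.
Proof.
move=> b0 H; rewrite leNgt; apply/negP => ba.
move: b0; rewrite le_eqVlt => /predU1P[b0|b0].
  by have := H 2; rewrite -b0 mulr0 ltr1n => /(_ isT); rewrite leNgt b0 ba.
have c1 : 1 < (1 + a / b) / 2.
  by rewrite ltr_pdivlMr// mul1r -[2]/(1 + 1) ltrD2l ltr_pdivlMr// mul1r.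
have := H _ c1; rewrite leNgt => /negP; apply.
rewrite mulrAC ltr_pdivrMr// mulrDl mul1r divfK ?gt_eqF// mulr_natr mulr2n.
by rewrite ltrD2r.
Qed.

(** The closed case of [phi_shift], where [L * r] may equal [r']: [L] is shrunk to [t * L] with t <
    1, at the price of a factor c > 1 that [le_of_scale] removes. *)
Lemma phi_le_ratio r r' L w : 0 < r -> 0 < L <= 1 -> L * r <= r' ->
  phi r' w <= L `^ (1 - p) * phi r w.
Proof.
move=> r0 /andP[L0 L1] Lr.
apply: le_of_scale; first by rewrite mulr_ge0 ?powR_ge0 ?phi_ge0.
move=> c c1; have c0 : 0 < c by rewrite (lt_trans _ c1).
pose t := c `^ (- (p - 1)^-1).
have t0 : 0 < t by rewrite powR_gt0.
have t1 : t < 1.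
  rewrite /t powRN invf_lt1 ?powR_gt0//.
  have ip : 0 < (p - 1)^-1 by rewrite invr_gt0.
  have := gt0_ltr_powR ip _ _ c1; rewrite powR1; apply; rewrite nnegrE// ltW//.
have tE : t `^ (1 - p) = c.
  by rewrite /t -powRrM -(opprB p 1) mulrNN mulVf ?gt_eqF// powRr1// ltW.
rewrite mulrA -tE -powRM ?(ltW t0) ?(ltW L0)//; apply: phi_shift => //.
  by rewrite mulr_gt0//= (lt_le_trans _ L1)// gtr_pMl.
apply: lt_le_trans Lr; rewrite -mulrA gtr_pMl//; exact: mulr_gt0.
Qed.

Lemma phi_nonincr r r' w : 0 < r -> r <= r' -> phi r' w <= phi r w.
Proof.
move=> r0 rr'; have := @phi_le_ratio r r' 1 w r0.
by rewrite ltr01 lexx mul1r powR1 mul1r; exact.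
Qed.

(** With ratio m / n, [phi_le_ratio] costs (m / n)^(1-p) and homogeneity in w gains (m / n)^p, so
    one factor m / n is left. Hence l^(-1) phi(l r, l w) is nondecreasing in l, and the recession
    function is a monotone limit. *)
Lemma phi_ray m n r w : 0 < m <= n -> 0 < r ->
  phi (m * r) (m *: w) <= m / n * phi (n * r) (n *: w).
Proof.
move=> /andP[m0 mn] r0; have n0 := lt_le_trans m0 mn.
have mn0 : 0 < m / n by rewrite divr_gt0.
have := @phi_le_ratio (n * r) (m * r) (m / n) (n *: w).
rewrite mulr_gt0// mn0 ler_pdivrMr// mul1r mn mulrA divfK ?gt_eqF// lexx.
move=> /(_ isT isT isT) H.
have -> : m *: w = (m / n) *: (n *: w) by rewrite scalerA divfK ?gt_eqF.
rewrite phiZ ?mulr_gt0// gtr0_norm//.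
have mp : 0 < (m / n) `^ p by rewrite powR_gt0.
apply: le_trans (ler_wpM2l (ltW mp) H) _.
by rewrite mulrA powR_split.
Qed.

Lemma phi_half r w v : 0 < r ->
  phi r (w + v) <= 2 `^ (p - 1) * (phi r w + phi r v).
Proof.
move=> r0; have [_ [cvx _]] := adm.
have h : 0 <= (2^-1 : R) <= 1 by lra.
have := cvx r r (2 *: w) (2 *: v) 2^-1 r0 r0 h.
have -> : 1 - 2^-1 = 2^-1 :> R by field.
rewrite !scalerA mulVf// !scale1r.
have -> : 2^-1 * r + 2^-1 * r = r by field.
move=> /le_trans; apply.
rewrite !phiZ// gtr0_norm// -!mulrDr mulrA.
by rewrite ler_wpM2r ?addr_ge0 ?phi_ge0// -(@mulr_powRB1 R 2 p)// mulKf.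
Qed.

(** Coordinates are peeled off one at a time by [phi_half], with homogeneity on the basis vectors.
    This gives smallness of phi(r, .) near 0 with a rate. *)
Lemma phi_sum_le r : 0 < r -> exists2 C : R, 0 <= C & forall w, phi r w <= C * `|w| `^ p.
Proof.
move=> r0.
suff H (s : seq 'I_d) : exists2 C : R, 0 <= C & forall w : Rd,
    phi r (\sum_(i <- s) w ord0 i *: delta_mx ord0 i) <= C * `|w| `^ p.
  have [C C0 HC] := H (index_enum 'I_d); exists C => // w.
  by have := HC w; rewrite -row_sum_delta.
elim: s => [|i s [C C0 IH]].
  by exists 0 => // w; rewrite big_nil phi_0// mul0r.
pose e : Rd := delta_mx ord0 i.
exists (2 `^ (p - 1) * (phi r e + C)).
  by rewrite mulr_ge0 ?powR_ge0// addr_ge0// phi_ge0.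
move=> w; rewrite big_cons; apply: le_trans (phi_half _ _ r0) _.
rewrite -mulrA ler_wpM2l ?powR_ge0// mulrDl lerD// phiZ// mulrC.
rewrite ler_wpM2l ?phi_ge0// ge0_ler_powR ?nnegrE// ?(ltW p0)//.
exact: coord_le_norm.
Qed.

(** Compactness of the unit sphere. The local lower bound near a unit vector w comes from phi(r, w)
    <= 2^(p-1) (phi(r, v) + phi(r, w - v)), whose last term is small by [phi_sum_le] when v is close
    to w. *)
Lemma phi_lower_at r : 0 < r -> (forall w : Rd, w != 0 -> 0 < phi r w) ->
  exists2 c : R, 0 < c & forall w, c * `|w| `^ p <= phi r w.
Proof.
move=> r0 pos; have [C C0 HC] := phi_sum_le r0.
pose K : set Rd := [set w | `|w| = 1].
have cK : compact K.
  apply: bounded_closed_compact.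
    by exists 1; split; [exact: num_real|move=> M M1 x /= ->; exact: ltW].
  rewrite (_ : K = (fun w : Rd => `|w|) @^-1` [set 1])//.
  by apply: closed_comp; [move=> x _; exact: norm_continuous|exact: closed_eq].
have two0 : 0 < 2 `^ (p - 1) :> R by rewrite powR_gt0.
have : \forall e \near 0^'+, K `<=` (fun w : Rd => e <= phi r w).
  apply: ((compact_near_coveringP K).1 cK R 0^'+ (fun e (w : Rd) => e <= phi r w)) => w Kw.
  have w0 : w != 0 by rewrite -normr_gt0 Kw.
  pose b := phi r w / 2 `^ (p - 1).
  have b0 : 0 < b by rewrite divr_gt0 ?pos.
  (* Solves (C + 1) eta^p = b / 2, so that phi(r, w - v) takes away at most half of [b]. *)
  pose eta := (b / 2 / (C + 1)) `^ (p^-1).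
  have C1 : 0 < C + 1 by rewrite ltr_wpDl.
  have q0 : 0 < b / 2 / (C + 1) by apply: divr_gt0 => //; exact: divr_gt0.
  have eta0 : 0 < eta by rewrite powR_gt0.
  exists ([set v | `|w - v| < eta], [set e | e < b / 2]).
    split => /=; first by have /cvgr_dist_lt/(_ _ eta0) := @cvg_id _ (nbhs w).
    by apply: nbhs_right_lt; rewrite divr_gt0.
  move=> [v e] /= [wv eb].
  have := phi_half v (w - v) r0; rewrite addrC subrK.
  rewrite mulrC -ler_pdivrMr// -/b => Hb.
  have : phi r (w - v) <= b / 2.
    apply: le_trans (HC _) _.
    have : `|w - v| `^ p <= b / 2 / (C + 1).
      have <- : eta `^ p = b / 2 / (C + 1).
        by rewrite /eta -powRrM mulVf ?gt_eqF// powRr1// ltW.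
      by rewrite ge0_ler_powR ?nnegrE ?(ltW p0) ?(ltW eta0) ?(ltW wv).
    move=> /(ler_wpM2l C0)/le_trans; apply.
    by rewrite mulrA ler_pdivrMr// [leRHS]mulrDr mulr1 [leRHS]addrC mulrC lerDr ltW// divr_gt0.
  move=> H2; apply: le_trans (ltW eb) _.
  rewrite -(lerD2r (b / 2)) -splitr; apply: le_trans Hb _.
  by rewrite lerD2l.
move=> /(filterI (nbhs_right_gt (0 : R)))/filter_ex [c /= [c0 Hc]].
exists c => // w; have [->|w0] := eqVneq w 0.
  by rewrite normr0 powR0 ?gt_eqF// mulr0 phi_0.
have nw : 0 < `|w| by rewrite normr_gt0.
pose u := `|w|^-1 *: w.
have wu : w = `|w| *: u by rewrite scalerA divff ?gt_eqF// scale1r.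
have u1 : `|u| = 1 by rewrite normrZ gtr0_norm ?invr_gt0// mulVf ?gt_eqF.
by rewrite [in leRHS]wu phiZ// normr_id mulrC ler_wpM2l ?powR_ge0// Hc.
Qed.

(** [phi_le_ratio] passes from [r] to the nondegenerate density [r0]. The ratio 1 / (K (1 + r)) with
    K = 1 + 1 / r0 is at most 1 and brings any [r] below [r0]. *)
Lemma phi_lower : exists2 C : R, 0 < C & forall r w, 0 < r ->
  enorm w `^ p <= C * (1 + r) `^ (p - 1) * phi r w.
Proof.
have [_ [_ [_ [r0 [r00 pos]]]]] := adm.
have [c c0 Hc] := phi_lower_at r00 pos.
pose D : R := d%:R + 1.
have D0 : 0 < D by rewrite ltr_wpDl.
pose K := 1 + r0^-1.
have K0 : 0 < K by rewrite addr_gt0// invr_gt0.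
exists (D `^ p * c^-1 * K `^ (p - 1)).
  by rewrite !mulr_gt0 ?powR_gt0 ?invr_gt0.
move=> r w rp.
have r1 : 0 < 1 + r by rewrite addr_gt0.
have Kr : 0 < K * (1 + r) by rewrite mulr_gt0.
have L1 : 0 < (K * (1 + r))^-1 <= 1.
  rewrite invr_gt0 Kr/= invf_le1//.
  rewrite /K mulrDl mul1r -addrA lerDl addr_ge0 ?(ltW rp)//.
  by rewrite mulr_ge0 ?invr_ge0 ?ltW.
have L2 : (K * (1 + r))^-1 * r <= r0.
  rewrite mulrC ler_pdivrMr// /K mulrDl mul1r mulrDr mulrA divff ?gt_eqF// mul1r.
  by rewrite addrA lerDr addr_ge0 ?mulr_ge0 ?ltW.
have := phi_le_ratio w rp L1 L2.
have -> : (K * (1 + r))^-1 `^ (1 - p) = (K * (1 + r)) `^ (p - 1).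
  by rewrite -powR_inv1 ?(ltW Kr)// -powRrM mulN1r opprB.
move=> H.
have : enorm w `^ p <= D `^ p * `|w| `^ p.
  rewrite -powRM ?ler0n ?(ltW D0)// ge0_ler_powR ?nnegrE ?(ltW p0) ?enorm_ge0//.
    by rewrite mulr_ge0 ?(ltW D0).
  by apply: le_trans (enorm_le_norm w) _; rewrite ler_wpM2r// lerDl.
move=> /le_trans; apply; rewrite -!mulrA ler_wpM2l ?powR_ge0//.
rewrite -ler_pdivrMl ?invr_gt0// invrK; apply: le_trans (Hc w) _.
by apply: le_trans H _; rewrite powRM ?(ltW K0) ?(ltW r1)// mulrA.
Qed.

(** Young's inequality with weight [s], by cases: either |w| <= (1 + r) / s, or |w| ((1 + r) /
    s)^(p-1) <= |w|^p, which [phi_lower] bounds, and the powers of 1 + r cancel. *)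
Lemma phi_base : exists2 c : R, 0 < c & forall s r w, 0 < s -> 0 < r ->
  enorm w <= c * (s `^ (p - 1) * phi r w + (1 + r) / s).
Proof.
have [C C0 HC] := phi_lower; exists (C + 1); first by rewrite addr_gt0.
move=> s r w s0 r0; have r1 : 0 < 1 + r by rewrite addr_gt0.
have C1 : 1 <= C + 1 by rewrite lerDr ltW.
have A0 : 0 <= s `^ (p - 1) * phi r w by rewrite mulr_ge0 ?powR_ge0 ?phi_ge0.
have B0 : 0 <= (1 + r) / s by rewrite divr_ge0 ?ltW.
have CC : 0 <= C + 1 by rewrite addr_ge0 ?ltW.
have [le1|gt1] := leP (enorm w) ((1 + r) / s).
  apply: le_trans le1 _; rewrite mulrDr; apply: (@le_trans _ _ (1 * ((1 + r) / s))).
    by rewrite mul1r.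
  by rewrite -[leLHS]add0r; apply: lerD; [rewrite mulr_ge0|rewrite ler_wpM2r].
have w0 : 0 < enorm w by apply: le_lt_trans gt1; exact: B0.
rewrite mulrDr -[leLHS]addr0 lerD ?(mulr_ge0 CC B0)//.
apply: (@le_trans _ _ (C * (s `^ (p - 1) * phi r w))); last first.
  by rewrite ler_wpM2r// lerDl.
have q0 : 0 < ((1 + r) / s) `^ (p - 1) by apply: powR_gt0; exact: divr_gt0.
rewrite -(ler_pM2r q0); apply: (@le_trans _ _ (enorm w `^ p)).
  rewrite -(@mulr_powRB1 R (enorm w) p) ?(ltW w0)//.
  by rewrite ler_wpM2l ?(ltW w0)// ge0_ler_powR ?nnegrE ?(ltW pm1) ?B0 ?(ltW w0) ?(ltW gt1).
apply: le_trans (HC r w r0) _.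
have -> : ((1 + r) / s) `^ (p - 1) = (1 + r) `^ (p - 1) / s `^ (p - 1).
  rewrite powRM; last by rewrite invr_ge0 ltW.
    by rewrite powRV ?(ltW s0)// powRN.
  exact: ltW.
have sp : s `^ (p - 1) != 0 by rewrite gt_eqF ?powR_gt0.
by rewrite le_eqVlt; apply/orP; left; apply/eqP; field.
Qed.

(* The exponent kappa is the one for which the last term does not see phi;
   in the homogeneous case it comes from evaluating phi_base at (l r, l w). *)
Lemma phi_tail kappa delta : is_kappa p phi kappa -> 0 < delta ->
  exists C R0 : R, [/\ 0 <= C, 0 < R0 & forall M y r w, R0 <= M -> 0 <= y <= 1 -> 0 < r ->
    y `^ (p - 1) * enorm w / M <=
      delta * phi r w + delta * y `^ p * r + C * M `^ (- kappa)].
Proof.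
move=> Hk d0; have [c c0 Hc] := phi_base.
(* [S] will be the weight in [phi_base] and [l] a dilation of (r, w). The three conditions bound the
   coefficient of phi, the coefficient of y^p r, and the remainder. *)
suff [C [R0 [C0 R00 H]]] : exists C R0 : R, [/\ 0 <= C, 0 < R0 &
    forall M, R0 <= M -> exists S l : R, [/\ 0 < S, 0 < l,
    forall r w, 0 < r -> phi (l * r) (l *: w) * (c * S `^ (p - 1) / (l * M)) <= delta * phi r w,
    c / (M * S) <= delta & c / (M * S * l) <= C * M `^ (- kappa)]].
  exists C, R0; split => // M y r w RM /andP[y0 y1] r0.
  have M0 : 0 < M by rewrite (lt_le_trans R00).
  have K0 : 0 <= C * M `^ (- kappa) by rewrite mulr_ge0 ?powR_ge0.
  move: y0; rewrite le_eqVlt => /predU1P[<-|y0].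
    rewrite powR0 ?gt_eqF// !mul0r addr_ge0//.
    by rewrite powR0 ?gt_eqF// mulr0 mul0r addr0 mulr_ge0 ?phi_ge0 ?ltW.
  have [S [l [S0 l0 H1 H2 H3]]] := H _ RM.
  have lr0 : 0 < l * r by rewrite mulr_gt0.
  (* With the weight S / y, the prefactor y^(p-1) cancels in front of phi and becomes y^p in front
     of the other term. *)
  have := Hc (S / y) (l * r) (l *: w) (divr_gt0 S0 y0) lr0.
  rewrite enormZ gtr0_norm// => Hb.
  have yp : 0 < y `^ (p - 1) by rewrite powR_gt0.
  have F0 : 0 < y `^ (p - 1) / (l * M) by rewrite divr_gt0// mulr_gt0.
  have -> : y `^ (p - 1) * enorm w / M = y `^ (p - 1) / (l * M) * (l * enorm w).
    by field; rewrite !gt_eqF.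
  apply: le_trans (ler_wpM2l (ltW F0) Hb) _.
  have ypE : y `^ p = y `^ (p - 1) * y by rewrite mulrC mulr_powRB1// ltW.
  have -> : (S / y) `^ (p - 1) = S `^ (p - 1) / y `^ (p - 1).
    rewrite powRM ?(ltW S0) ?invr_ge0 ?(ltW y0)// -[y^-1]powR_inv1 ?(ltW y0)//.
    by rewrite (powRAC y) powR_inv1 ?powR_ge0.
  have -> : y `^ (p - 1) / (l * M) * (c * (S `^ (p - 1) / y `^ (p - 1) *
      phi (l * r) (l *: w) + (1 + l * r) / (S / y))) =
      phi (l * r) (l *: w) * (c * S `^ (p - 1) / (l * M)) +
      (c / (M * S)) * y `^ p * r + y `^ p * (c / (M * S * l)).
    by rewrite ypE; field; rewrite !gt_eqF.
  have yp1 : y `^ p <= 1.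
    have := @ge0_ler_powR R p (ltW p0) y 1; rewrite powR1; apply => //.
    by rewrite nnegrE ltW.
    by rewrite nnegrE.
  have q0 : 0 <= c / (M * S * l) by rewrite divr_ge0 ?(ltW c0)// !mulr_ge0// ltW.
  apply: lerD; last by apply: le_trans H3; rewrite -[leRHS]mul1r ler_wpM2r.
  apply: lerD; first exact: H1.
  by rewrite ler_wpM2r ?(ltW r0)// ler_wpM2r ?powR_ge0.
pose a := c / delta; have a0 : 0 < a by rewrite divr_gt0.
have cE : c = delta * a by rewrite /a mulrC divfK ?gt_eqF.
case: Hk => [[theta [/andP[t1 tp] [hom ->]]]|[_ ->]].
  have th0 : 0 < theta - 1 by rewrite subr_gt0.
  exists (delta * a `^ (p / (theta - 1))), 1; split => //.
    by rewrite mulr_ge0 ?powR_ge0 ?ltW.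
  move=> M M1; have M0 : 0 < M by rewrite (lt_le_trans ltr01).
  (* This [S] makes the coefficient of y^p r equal to delta. Since phi(l r, l w) / l = l^(theta-1)
     phi(r, w), the choice l^(theta-1) = S^(-p) makes the coefficient of phi equal to delta as well.
     The remainder delta / l is then delta (a / M)^kappa. *)
  pose S := a / M; have S0 : 0 < S by rewrite divr_gt0.
  pose l := S `^ (- (p / (theta - 1))); have l0 : 0 < l by rewrite powR_gt0.
  have MS : c / (M * S) = delta by rewrite cE /S; field; rewrite !gt_eqF.
  exists S, l; split => //.
  - move=> r w rp; rewrite hom//.
    have lt : l `^ theta = l * (S `^ p)^-1.
      rewrite -(@mulr_powRB1 R l theta) ?(ltW l0) ?(lt_trans ltr01)//.
      congr (_ * _); rewrite /l -powRrM mulNr divfK ?gt_eqF// powRN//.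
    have Sp : S `^ p = S * S `^ (p - 1) by rewrite mulr_powRB1// ltW.
    rewrite lt Sp -[X in X / (l * M)]/(c * _) cE.
    have Sq : 0 < S `^ (p - 1) by rewrite powR_gt0.
    rewrite le_eqVlt; apply/orP; left; apply/eqP.
    have ME : M = a / S by rewrite /S; field; rewrite !gt_eqF.
    by rewrite ME; field; rewrite !gt_eqF.
  - by rewrite MS.
  rewrite invfM mulrA MS -mulrA ler_wpM2l ?(ltW d0)//.
  by rewrite /l powRN invrK /S powRM ?invr_ge0 ?(ltW a0) ?(ltW M0)// powRV ?(ltW M0).
pose e := (p - 1)^-1; have e0 : 0 < e by rewrite invr_gt0.
have kE : p / (p - 1) = 1 + e by rewrite /e; field; rewrite gt_eqF.
exists (c * a `^ e), a; split => //.
  by rewrite mulr_ge0 ?powR_ge0 ?ltW.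
move=> M aM; have M0 : 0 < M by rewrite (lt_le_trans a0).
(* Without homogeneity [l] is 1 and [S] is fixed by the coefficient of phi. The remainder has order
   M^(-1-1/(p-1)) = M^(-q). The condition M >= a gives S >= 1, which keeps the coefficient of y^p r
   below delta. *)
pose S := (M / a) `^ e.
have S1 : 1 <= S.
  have := @ge0_ler_powR R e (ltW e0) 1 (M / a); rewrite powR1; apply.
  - by rewrite nnegrE.
  - by rewrite nnegrE divr_ge0// ltW.
  - by rewrite ler_pdivlMr// mul1r.
have S0 : 0 < S by rewrite (lt_le_trans ltr01).
exists S, 1; split => //.
- move=> r w rp; rewrite mul1r scale1r mul1r.
  have -> : S `^ (p - 1) = M / a.
    by rewrite /S -powRrM /e mulVf ?gt_eqF// powRr1// divr_ge0 ?ltW.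
  rewrite mulrC ler_wpM2r ?phi_ge0// cE le_eqVlt; apply/orP; left; apply/eqP.
  by field; rewrite !gt_eqF.
- rewrite ler_pdivrMr ?mulr_gt0// cE ler_wpM2l ?(ltW d0)//.
  by apply: le_trans aM _; rewrite ler_peMr// ltW.
rewrite mulr1 kE -mulrA ler_wpM2l ?(ltW c0)// opprD powRD; last first.
  by apply/implyP => _; rewrite gt_eqF.
rewrite powR_inv1 ?(ltW M0)// invfM mulrCA ler_wpM2l ?invr_ge0 ?(ltW M0)//.
by rewrite /S -powRN powRM ?invr_ge0 ?(ltW a0) ?(ltW M0)// powRV ?(ltW a0)// opprK mulrC.
Qed.

Lemma phi_nonincreasing_fun w : {in `]0, +oo[ &, nonincreasing_fun (fun r => (phi r w)%:E)}.
Proof.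
move=> r s; rewrite !in_itv/= !andbT => r0 s0 rs.
by rewrite lee_fin phi_nonincr.
Qed.

Lemma phibar0_cvg w : cvg ((phi r w)%:E @[r --> 0^'+]).
Proof.
apply/cvg_ex; eexists.
by apply: (@nonincreasing_at_right_cvge _ _ _ +oo%O) => //; exact: phi_nonincreasing_fun.
Qed.

Lemma phibar_pos r w : 0 < r -> phibar phi r w = (phi r w)%:E.
Proof. by rewrite /phibar => ->. Qed.

Lemma phi_le_phibar0 r w : 0 < r -> ((phi r w)%:E <= phibar phi 0 w)%E.
Proof.
move=> r0; rewrite /phibar ltxx; apply: lime_ge; first exact: phibar0_cvg.
near=> s; rewrite lee_fin phi_nonincr//.
by near: s; apply: nbhs_right_le.
Unshelve. all: by end_near. Qed.

Lemma phibar_ge0 r w : 0 <= r -> (0 <= phibar phi r w)%E.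
Proof.
rewrite le_eqVlt => /predU1P[<-|r0]; last by rewrite phibar_pos// lee_fin phi_ge0.
by apply: le_trans (phi_le_phibar0 w ltr01); rewrite lee_fin phi_ge0.
Qed.

Lemma phibarZ r k w : 0 <= r -> 0 < k ->
  phibar phi r (k *: w) = ((k `^ p)%:E * phibar phi r w)%E.
Proof.
rewrite le_eqVlt => /predU1P[<-|r0] k0; last first.
  by rewrite !phibar_pos// phiZ// gtr0_norm// EFinM.
rewrite /phibar ltxx -limeMl//; last exact: phibar0_cvg.
apply: lim_near_eqe.
near=> t; rewrite phiZ ?gtr0_norm ?EFinM//.
Unshelve. all: by end_near. Qed.

Lemma phibar_ray m n r w : 0 < m <= n -> 0 <= r ->
  ((m^-1)%:E * phibar phi (m * r) (m *: w) <= (n^-1)%:E * phibar phi (n * r) (n *: w))%E.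
Proof.
move=> /andP[m0 mn]; have n0 := lt_le_trans m0 mn.
rewrite le_eqVlt => /predU1P[<-|r0].
  rewrite !mulr0 !phibarZ// !muleA -!EFinM lee_wpmul2r ?phibar_ge0// lee_fin.
  have h (x : R) : 0 < x -> x^-1 * x `^ p = x `^ (p - 1).
    by move=> x0; rewrite -(mulr_powRB1 (ltW x0))// mulKf ?gt_eqF.
  by rewrite (h m)// (h n)// ge0_ler_powR ?nnegrE ?(ltW pm1) ?(ltW m0) ?(ltW n0).
rewrite !phibar_pos ?mulr_gt0// -!EFinM lee_fin ler_pdivrMl//.
by rewrite mulrA phi_ray// m0.
Qed.

Let F r w (l : R) := ((l^-1)%:E * phibar phi (l * r) (l *: w))%E.

(** Monotonicity along rays is known for positive [l] only; replacing [l] by [Num.max l l0] makes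
    the function monotone on the whole line and does not change it near +oo. *)
Lemma phiinf_cvg r w l0 : 0 <= r -> 0 < l0 ->
  F r w l @[l --> +oo] --> ereal_sup (range (fun l => F r w (Num.max l l0))).
Proof.
move=> r0 l00.
have : F r w (Num.max l l0) @[l --> +oo] --> ereal_sup (range (fun l => F r w (Num.max l l0))).
  apply: nondecreasing_cvge => x y xy; apply: phibar_ray => //.
  by rewrite lt_max l00 orbT/= ge_max !le_max xy lexx !orbT.
apply: cvg_trans; apply: near_eq_cvg; near=> l.
by rewrite max_l//; near: l; exact: nbhs_pinfty_ge.
Unshelve. all: by end_near. Qed.

Lemma phibar_le_phiinf r w l : 0 <= r -> 0 < l ->
  ((l^-1)%:E * phibar phi (l * r) (l *: w) <= phiinf phi r w)%E.
Proof.
move=> r0 l0; rewrite /phiinf (cvg_lim _ (@phiinf_cvg r w l r0 l0))//.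
by apply: ereal_sup_ubound; exists l => //=; rewrite maxxx.
Qed.

Lemma phiinf_ge0 r w : 0 <= r -> (0 <= phiinf phi r w)%E.
Proof.
move=> r0; apply: le_trans (phibar_le_phiinf w r0 ltr01).
by rewrite mule_ge0 ?lee_fin ?invr_ge0// phibar_ge0 ?mulr_ge0.
Qed.

Lemma phiinfZ r k w : 0 <= r -> 0 < k ->
  phiinf phi r (k *: w) = ((k `^ p)%:E * phiinf phi r w)%E.
Proof.
move=> r0 k0; rewrite /phiinf -limeMl//; last first.
  by apply/cvg_ex; eexists; exact: (@phiinf_cvg r w 1 r0 ltr01).
apply: lim_near_eqe.
near=> l.
have l0 : 0 < l by near: l; exact: nbhs_pinfty_gt.
by rewrite scalerA [l * k]mulrC -scalerA phibarZ ?mulr_ge0 ?(ltW l0)// muleCA.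
Unshelve. all: by end_near. Qed.

(** At r = 0 the hypothesis is used at small positive densities, where c r is negligible and phi(r,
    w) lies below its limit. *)
Lemma phibar_bound (a b c e r : R) w : 0 <= b -> 0 <= c -> 0 <= r ->
  (forall r, 0 < r -> a <= b * phi r w + c * r + e) ->
  (a%:E <= b%:E * phibar phi r w + (c * r + e)%:E)%E.
Proof.
move=> b0 c0; rewrite le_eqVlt => /predU1P[<- H|r0 H]; last first.
  by rewrite phibar_pos// -EFinM -EFinD lee_fin addrA H.
rewrite mulr0 add0r.
have : (0 <= b%:E * phibar phi 0 w)%E by rewrite mule_ge0 ?lee_fin ?phibar_ge0.
case E : (b%:E * phibar phi 0 w)%E => [v| |]// _; last by rewrite addye ?leey.
rewrite -EFinD lee_fin; apply/ler_addgt0Pr => eps e0.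
have s0 : 0 < eps / (c + 1) by rewrite divr_gt0// ltr_wpDl.
have := H _ s0; rewrite -addrA => /le_trans; apply.
rewrite -addrA lerD//.
  by rewrite -lee_fin -E EFinM lee_wpmul2l ?lee_fin// phi_le_phibar0.
rewrite addrC lerD2l mulrCA ger_pMr// ler_pdivrMr ?ltr_wpDl// mul1r lerDl//.
Qed.

(** The hypothesis at (l r, l w), divided by l, leaves e / l, which vanishes as l grows. So the
    singular part of a decomposition sees no constant term. *)
Lemma phiinf_bound (a b c e r : R) w : 0 <= b -> 0 <= c -> 0 <= r ->
  (forall r w, 0 < r -> a * enorm w <= b * phi r w + c * r + e) ->
  ((a * enorm w)%:E <= b%:E * phiinf phi r w + (c * r)%:E)%E.
Proof.
move=> b0 c0 r0 H.
have : (0 <= b%:E * phiinf phi r w)%E by rewrite mule_ge0 ?lee_fin ?phiinf_ge0.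
case E : (b%:E * phiinf phi r w)%E => [v| |]// _; last by rewrite addye ?leey.
rewrite -EFinD lee_fin; apply/ler_addgt0Pr => eps e0.
pose l := (`|e| + 1) / eps.
have l0 : 0 < l by rewrite divr_gt0// ltr_wpDl.
have lr0 : 0 <= l * r by rewrite mulr_ge0// ltW.
have := @phibar_bound (a * enorm (l *: w)) b c e (l * r) (l *: w) b0 c0 lr0.
move=> /(_ (fun t ht => H t (l *: w) ht)).
rewrite enormZ gtr0_norm// => H1.
have H2 : ((l^-1)%:E * (b%:E * phibar phi (l * r) (l *: w)) <= v%:E)%E.
  by rewrite -E muleCA lee_wpmul2l ?lee_fin// phibar_le_phiinf.
have : (0 <= b%:E * phibar phi (l * r) (l *: w))%E.
  by rewrite mule_ge0 ?lee_fin ?phibar_ge0.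
move: H1 H2; case: (b%:E * phibar phi (l * r) (l *: w))%E => [u| |]//; last first.
  by move=> _; rewrite gt0_muley ?lte_fin ?invr_gt0.
rewrite -EFinD -EFinM !lee_fin => H1 H2 u0.
have : a * enorm w <= l^-1 * u + c * r + l^-1 * e.
  rewrite -(ler_pM2l l0); apply: le_trans (le_trans _ H1) _.
    by rewrite mulrCA.
  by rewrite le_eqVlt; apply/orP; left; apply/eqP; field; rewrite gt_eqF.
move=> /le_trans; apply; rewrite lerD// ?lerD//.
rewrite ler_pdivrMl// /l mulrC; apply: le_trans (ler_norm e) _.
by rewrite mulrCA divff ?gt_eqF// mulr1 lerDl.
Qed.

End action_density.

(** * Integration against a setwise inequality between measures with densities *)

Section density_comparison.
Context d (T : measurableType d) (R : realType).
Local Open Scope ereal_scope.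
Import HBNNSimple.
Implicit Types (m : {measure set T -> \bar R}) (g : T -> \bar R).

Lemma integral_nnsfunM m (h : {nnsfun T >-> R}) g :
  measurable_fun setT g -> (forall x, 0 <= g x) ->
  \int[m]_x ((h x)%:E * g x) =
    \sum_(k \in range h) k%:E * \int[m]_(x in h @^-1` [set k]) g x.
Proof.
move=> mg g0.
transitivity (\int[m]_x \sum_(k \in range h) (k * \1_(h @^-1` [set k]) x)%:E * g x).
  apply: eq_integral => x _; rewrite fimfunE -fsumEFin// ge0_mule_fsuml//.
  by move=> k; exact: nnfun_muleindic_ge0.
have mh k : measurable (h @^-1` [set k]) by exact: measurable_sfunP.
rewrite ge0_integral_fsum//; first last.
- by move=> k x _; rewrite mule_ge0// nnfun_muleindic_ge0.
- move=> k; apply: emeasurable_funM => //; apply/measurable_EFinP.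
  exact: measurable_funM.
apply: eq_fsbigr => k /set_mem[x _ <-].
under eq_integral do rewrite EFinM -muleA.
rewrite ge0_integralZl//; first last.
- by rewrite lee_fin.
- by move=> y _; rewrite mule_ge0// lee_fin.
- by apply: emeasurable_funM => //; exact/measurable_EFinP.
by rewrite [in RHS]integral_mkcond epatch_indic; under [in RHS]eq_integral do rewrite muleC.
Qed.

(** The setwise inequality gives the claim for simple [a], level by level, and monotone convergence
    does the rest. Two terms on each side cover both applications: the components of [nu] below
    their decomposition, and the decomposition of [mu] below [mu]. *)
Lemma density_comparison m1 m2 m3 m4 g1 g2 g3 g4 (a : T -> \bar R) :
  (forall x, 0 <= g1 x) -> measurable_fun setT g1 ->
  (forall x, 0 <= g2 x) -> measurable_fun setT g2 ->
  (forall x, 0 <= g3 x) -> measurable_fun setT g3 ->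
  (forall x, 0 <= g4 x) -> measurable_fun setT g4 ->
  (forall A, measurable A -> \int[m1]_(x in A) g1 x + \int[m2]_(x in A) g2 x <=
     \int[m3]_(x in A) g3 x + \int[m4]_(x in A) g4 x) ->
  (forall x, 0 <= a x) -> measurable_fun setT a ->
  \int[m1]_x (a x * g1 x) + \int[m2]_x (a x * g2 x) <=
     \int[m3]_x (a x * g3 x) + \int[m4]_x (a x * g4 x).
Proof.
move=> g10 mg1 g20 mg2 g30 mg3 g40 mg4 H a0 ma.
pose h := nnsfun_approx measurableT ma.
have ha n x : (h n x)%:E <= a x.
  have c : (h n x)%:E @[n --> \oo] --> a x by apply: cvg_nnsfun_approx.
  apply: cvge_ge c; exists n => // i /= ij.
  by rewrite lee_fin; exact/lefP/nd_nnsfun_approx.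
have cvgI m g : (forall x, 0 <= g x) -> measurable_fun setT g ->
    \int[m]_x ((h n x)%:E * g x) @[n --> \oo] --> \int[m]_x (a x * g x).
  move=> g0 mg.
  rewrite (_ : \int[m]_x (a x * g x) = \int[m]_x limn (fun n => (h n x)%:E * g x)).
    apply: cvg_monotone_convergence => //.
    - by move=> n; apply: emeasurable_funM => //; exact/measurable_EFinP.
    - by move=> n x _; rewrite mule_ge0// lee_fin.
    - by move=> x _ i j ij; rewrite lee_wpmul2r// lee_fin; exact/lefP/nd_nnsfun_approx.
  apply: eq_integral => x _; apply/esym/cvg_lim => //.
  have hc : (h n x)%:E @[n --> \oo] --> a x by apply: cvg_nnsfun_approx.
  (* Limits of products fail for the form 0 times +oo, so vanishing factors are treated apart. *)
  have [gx0|gxpos] := eqVneq (g x) 0.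
    by rewrite gx0 mule0; under eq_fun do rewrite mule0; exact: cvg_cst.
  have [ax0|axpos] := eqVneq (a x) 0.
    rewrite ax0 mul0e; apply: cvg_near_cst; apply: nearW => n.
    have := ha n x.
    rewrite ax0 lee_fin => hle.
    have -> : h n x = 0%R by apply/eqP; rewrite eq_le hle/=.
    by rewrite mul0e.
  apply: cvgeM => //; last exact: cvg_cst.
  by rewrite neq0_mule_def// mule_neq0.
rewrite -(cvg_lim _ (cvgI m1 g1 g10 mg1))// -(cvg_lim _ (cvgI m2 g2 g20 mg2))//.
have S n : \int[m1]_x ((h n x)%:E * g1 x) + \int[m2]_x ((h n x)%:E * g2 x) <=
  \int[m3]_x (a x * g3 x) + \int[m4]_x (a x * g4 x).
  apply: (@le_trans _ _ (\int[m3]_x ((h n x)%:E * g3 x) + \int[m4]_x ((h n x)%:E * g4 x))).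
    rewrite !integral_nnsfunM// -!fsbig_split//=.
    apply: lee_fsum => // k [x _ <-].
    have I0 m g (A : set T) : (forall x, 0 <= g x) -> 0 <= \int[m]_(x in A) g x.
      by move=> g0; apply: integral_ge0 => *; exact: g0.
    rewrite -!ge0_muleDr ?I0// lee_wpmul2l ?lee_fin//.
    by apply: H; exact: measurable_sfunP.
  apply: leeD; apply: lint_le => x _; rewrite ?lee_wpmul2r ?mule_ge0 ?lee_fin//.
have I0 m g : (forall x, 0 <= g x) -> 0 <= \int[m]_x (a x * g x).
  by move=> g0; apply: integral_ge0 => x _; rewrite mule_ge0.
rewrite -limeD//; first last.
- apply: ge0_adde_def; rewrite inE.
    by rewrite (cvg_lim _ (cvgI m1 g1 g10 mg1))// I0.
  by rewrite (cvg_lim _ (cvgI m2 g2 g20 mg2))// I0.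
- exact: cvgP (cvgI m2 g2 g20 mg2).
- exact: cvgP (cvgI m1 g1 g10 mg1).
apply: lime_le; last exact: nearW.
apply: is_cvgeD.
- apply: ge0_adde_def; rewrite inE.
    by rewrite (cvg_lim _ (cvgI m1 g1 g10 mg1))// I0.
  by rewrite (cvg_lim _ (cvgI m2 g2 g20 mg2))// I0.
- exact: cvgP (cvgI m1 g1 g10 mg1).
- exact: cvgP (cvgI m2 g2 g20 mg2).
Qed.

End density_comparison.

(** * Control of the flux by the action functional *)

Section action_bound.
Context {R : realType} {d : nat}.
Notation Rd := 'rV[R]_d.
Notation X := (@BRd R d).
Notation Meas := ({measure set X -> \bar R}).
Variables (p : R) (phi : R -> Rd -> R).
Hypotheses (p1 : 1 < p) (adm : admissible p phi).
Local Open Scope ereal_scope.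

Lemma bigcup_B0 : \bigcup_n (B0 n%:R : set X) = setT.
Proof.
apply/seteqP; split => // x _; exists (Num.truncn (enorm x)).+1 => //.
rewrite /B0/=; exact: truncnS_gt.
Qed.

Lemma measurable_eball (x : Rd) (r : R) : measurable (eball x r).
Proof.
apply: open_measurable_BRd.
rewrite (_ : eball x r = (fun y : Rd => enorm (y - x)%R) @^-1` [set t | (t < r)%R])//.
apply: open_comp; last exact: open_lt.
move=> y _; apply: (@continuous_comp _ _ _ (fun y : Rd => y - x)%R (@enorm R d)).
  by apply: (@cvgB _ _ _ (nbhs y) (nbhs_filter y) idfun (cst x)); [exact: cvg_id|exact: cvg_cst].
exact: enorm_continuous.
Qed.

Lemma measurable_enorm_coord (w : Rd -> Rd) :
  (forall i, measurable_fun setT (fun x : X => w x ord0 i)) ->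
  measurable_fun setT (fun x : X => enorm (w x)).
Proof.
move=> mw; apply: (@measurableT_comp _ _ _ _ _ _ (@Num.sqrt R)).
  by apply: continuous_measurable_fun; exact: sqrt_continuous.
by apply: measurable_sum => i; exact: measurable_funX.
Qed.

(** The decomposition is an identity of signed set functions on bounded sets. Cutting along the sign
    of the density (the Hahn set [P]) turns it into a bound for the total variation, and an
    exhaustion by balls removes boundedness. *)
Lemma vdens_bound (gamma mu : Meas) (nu : vmeas) rho w sigma rhop wp i (A : set X) :
  is_vmeas nu -> decomp_data gamma mu nu rho w sigma rhop wp -> measurable A ->
  \int[vbase nu]_(x in A) `|(vdens nu x ord0 i)%:E| <=
  \int[gamma]_(x in A) `|(w x ord0 i)%:E| + \int[sigma]_(x in A) `|(wp x ord0 i)%:E|.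
Proof.
move=> [_ [mv _]] [_ [_ [_ [_ [_ [_ [mw [mwp [_ [_ [_ dec]]]]]]]]]]] mA.
have mabs (f : X -> R) (B : set X) : measurable_fun setT f -> measurable_fun B (fun x => `|(f x)%:E|).
  by move=> mf; apply: measurable_funTS; apply: measurableT_comp => //; exact/measurable_EFinP.
have mE (f : X -> R) (B : set X) : measurable_fun setT f -> measurable_fun B (fun x => (f x)%:E).
  by move=> mf; apply: measurable_funTS; exact/measurable_EFinP.
have main (B : set X) : measurable B -> Defs.bounded_set B -> B `<=` A ->
    `|vcomp nu i B| <= \int[gamma]_(x in B) `|(w x ord0 i)%:E| + \int[sigma]_(x in B) `|(wp x ord0 i)%:E|.
  move=> mB bB BA; rewrite dec//; apply: le_trans (lee_abs_add _ _) _.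
  by apply: leeD; apply: le_abse_integral => //; exact: mE.
pose P : set X := [set x | (0 <= vdens nu x ord0 i)%R].
have mP : measurable P.
  rewrite -[P]setTI (_ : P = (fun x => vdens nu x ord0 i) @^-1` `[0%R, +oo[%classic).
    exact: mv.
  by apply/seteqP; split => x; rewrite /P/= in_itv/= andbT.
pose F n := A `&` (B0 n%:R : set X).
have mF n : measurable (F n) by apply: measurableI => //; exact: measurable_B0.
have ndF : nondecreasing_seq F.
  move=> m n mn; apply/subsetPset => x [Ax Bx]; split => //.
  by rewrite /B0/= (lt_le_trans Bx)// ler_nat.
have UF : \bigcup_n F n = A by rewrite -setI_bigcupr bigcup_B0 setIT.
have step n : \int[vbase nu]_(x in F n) `|(vdens nu x ord0 i)%:E| <=
  \int[gamma]_(x in A) `|(w x ord0 i)%:E| + \int[sigma]_(x in A) `|(wp x ord0 i)%:E|.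
  have bF (B : set X) : B `<=` F n -> Defs.bounded_set B by move=> BF; exists n%:R => x /BF[].
  have split_F (m : Meas) (f : X -> R) : measurable_fun setT f ->
    \int[m]_(x in F n) `|(f x)%:E| = \int[m]_(x in F n `&` P) `|(f x)%:E| + \int[m]_(x in F n `\` P) `|(f x)%:E|.
    move=> mf; rewrite -[in LHS](setUIDK (F n) P) ge0_integral_setU//.
    - exact: measurableI.
    - exact: measurableD.
    - exact: mabs.
    - by rewrite disj_set2E setDE setIACA setICr setI0.
  have sub (B : set X) : B `<=` F n -> B `<=` A by move=> BF x /BF[].
  apply: (@le_trans _ _ (\int[gamma]_(x in F n) `|(w x ord0 i)%:E| + \int[sigma]_(x in F n) `|(wp x ord0 i)%:E|)); last first.
    by apply: leeD; apply: ge0_subset_integral => //; try exact: mabs; move=> x [].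
  rewrite !split_F// addeACA; apply: leeD.
    apply: le_trans (main _ (measurableI _ _ (mF n) mP) (bF _ (@subIsetl _ _ _)) (sub _ (@subIsetl _ _ _))).
    rewrite /vcomp; apply: le_trans (lee_abs _); apply: lint_le => x [_ Px]; rewrite ?abse_ge0//.
    by rewrite abse_EFin ger0_norm.
  apply: le_trans (main _ (measurableD (mF n) mP) (bF _ (@subDsetl _ _ _)) (sub _ (@subDsetl _ _ _))).
  have -> : vcomp nu i (F n `\` P) = - \int[vbase nu]_(x in F n `\` P) `|(vdens nu x ord0 i)%:E|.
    rewrite -integral_ge0N//; apply: eq_integral => x /set_mem [_ /negP].
    by rewrite -ltNge => vx; rewrite abse_EFin ltr0_norm// EFinN oppeK.
  by rewrite abseN lee_abs.
rewrite -UF; apply: cvge_le (ge0_nondecreasing_set_cvg_integral ndF mF _ _).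
- by apply: nearW => n; rewrite UF.
- by move=> n; exact: mabs.
- by [].
Qed.

Lemma gt0_muleDr (k : R) (x y : \bar R) : (0 < k)%R ->
  k%:E * (x + y) = k%:E * x + k%:E * y.
Proof.
move=> k0; case: x => [x| |]; case: y => [y| |];
  rewrite ?gt0_muley ?gt0_muleNy ?lte_fin//= ?gt0_muley ?gt0_muleNy ?lte_fin//=.
by rewrite -!EFinM -EFinD mulrDr.
Qed.

Lemma Phi_ge0 (gamma mu : Meas) (nu : vmeas) : 0 <= Phi phi gamma mu nu.
Proof.
rewrite /Phi; case: ifPn => // _; apply: le_ereal_inf_tmp.
move=> v [rho [w [sg [rp [wp [[_ [_ [rho0 [rp0 _]]]] ->]]]]]].
have pb x : 0 <= phibar phi (rho x) (w x) by exact: (phibar_ge0 p1 adm).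
have pi x : 0 <= phiinf phi (rp x) (wp x) by exact: (phiinf_ge0 p1 adm).
by apply: adde_ge0; apply: integral_ge0 => x _.
Qed.

(** The pointwise inequality is integrated over both parts of a decomposition, by [phibar_bound] on
    the [gamma] part and by [phiinf_bound] on the singular part; this is why [e] is integrated
    against [gamma] only. Then the infimum over decompositions is taken. *)
Lemma Phi_bound (gamma mu : Meas) (nu : vmeas) (b : R) (a c e : X -> R) i :
  is_vmeas nu -> (0 < b)%R ->
  (forall x, 0 <= a x)%R -> measurable_fun setT a ->
  (forall x, 0 <= c x)%R -> measurable_fun setT c ->
  (forall x, 0 <= e x)%R -> measurable_fun setT e ->
  (forall x r w, 0 < r -> a x * enorm w <= b * phi r w + c x * r + e x)%R ->
  \int[vbase nu]_x ((a x)%:E * `|(vdens nu x ord0 i)%:E|) <=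
    b%:E * Phi phi gamma mu nu + (\int[mu]_x (c x)%:E + \int[gamma]_x (e x)%:E).
Proof.
move=> vnu b0 a0 ma c0 mc e0 me H.
set V := \int[vbase nu]_x _; set Y := \int[mu]_x _ + _.
have Y0 : 0 <= Y by apply: adde_ge0; apply: integral_ge0 => x _; rewrite lee_fin.
suff S v : [set v | exists rho w sigma rhop wp,
       decomp_data gamma mu nu rho w sigma rhop wp /\
       v = (\int[gamma]_x phibar phi (rho x) (w x)
            + \int[sigma]_x phiinf phi (rhop x) (wp x))] v -> V <= b%:E * v + Y.
  have := Phi_ge0 gamma mu nu; rewrite /Phi; case: ifPn => _ P0; last first.
    by rewrite gt0_muley ?lte_fin// addye ?leey// -ltNye (lt_le_trans _ Y0).
  move: Y0; case: Y S => [y| |]// S _; last first.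
    by rewrite addey ?leey// -ltNye (@lt_le_trans _ _ 0)// mule_ge0// lee_fin ltW.
  rewrite -leeBlDr// -lee_pdivrMl//; apply: le_ereal_inf_tmp => v Sv.
  by rewrite lee_pdivrMl// leeBlDr// S.
move=> [rho [w [sg [rp [wp [dec ->]]]]]].
have [_ [_ [rho0 [rp0 [mrho [mrp [mw [mwp [_ [_ [dmu _]]]]]]]]]]] := dec.
have mE (f : X -> R) : measurable_fun setT f -> measurable_fun setT (fun x => (f x)%:E).
  by move=> mf; exact/measurable_EFinP.
have mabs (f : X -> R) : measurable_fun setT f -> measurable_fun setT (fun x => `|(f x)%:E|).
  by move=> mf; apply: measurableT_comp => //; exact: mE.
have V1 : V <= \int[gamma]_x ((a x)%:E * `|(w x ord0 i)%:E|) + \int[sg]_x ((a x)%:E * `|(wp x ord0 i)%:E|).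
  have := @density_comparison _ _ _ (vbase nu) gamma gamma sg
     (fun x => `|(vdens nu x ord0 i)%:E|) (cst 0)
     (fun x => `|(w x ord0 i)%:E|) (fun x => `|(wp x ord0 i)%:E|) (EFin \o a).
  have z (m : Meas) (A : set X) : \int[m]_(x in A) (cst 0 x) = 0 :> \bar R by exact: integral0.
  have -> : \int[gamma]_x ((EFin \o a) x * cst 0 x) = 0.
    by rewrite integral0_eq// => x _; rewrite mule0.
  rewrite adde0; apply => //.
  - by apply: mabs; exact: vnu.2.1.
  - exact: mabs.
  - exact: mabs.
  - by move=> A mA; rewrite z adde0; exact: vdens_bound dec mA.
  - exact: mE.
have muc : \int[gamma]_x (c x * rho x)%:E + \int[sg]_x (c x * rp x)%:E <= \int[mu]_x (c x)%:E.
  have := @density_comparison _ _ _ gamma sg mu gamma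
     (fun x => (rho x)%:E) (fun x => (rp x)%:E) (cst 1) (cst 0) (EFin \o c).
  have -> : \int[gamma]_x ((EFin \o c) x * cst 0 x) = 0.
    by rewrite integral0_eq// => x _; rewrite mule0.
  rewrite adde0.
  have -> : \int[mu]_x ((EFin \o c) x * cst 1 x) = \int[mu]_x (c x)%:E.
    by apply: eq_integral => x _; rewrite mule1.
  apply => //; try exact: mE.
  by move=> A mA; rewrite integral0 adde0 integral_cst//= mul1e dmu.
have G1 : \int[gamma]_x ((a x)%:E * `|(w x ord0 i)%:E|) <=
    b%:E * \int[gamma]_x phibar phi (rho x) (w x) + (\int[gamma]_x (c x * rho x)%:E + \int[gamma]_x (e x)%:E).
  have pb0 x : 0 <= phibar phi (rho x) (w x) by exact: (phibar_ge0 p1 adm).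
  rewrite -ge0_integralD//; last 4 first.
  - by move=> x _; rewrite lee_fin mulr_ge0.
  - by apply: mE; exact: measurable_funM.
  - by move=> x _; rewrite lee_fin.
  - exact: mE.
  have L := @lint_scale _ X R gamma setT (fun x => phibar phi (rho x) (w x)) b measurableT (ltW b0) (fun x _ => pb0 x).
  apply: le_trans (leeD L (lexx _)).
  apply: le_trans (@lint_add _ X R gamma setT (fun x => b%:E * phibar phi (rho x) (w x)) (fun x => (c x * rho x)%:E + (e x)%:E) _ _ _ _).
  - apply: lint_le => x _; first by rewrite mule_ge0// lee_fin.
    apply: (@le_trans _ _ (a x * enorm (w x))%:E).
      by rewrite EFinM lee_wpmul2l ?lee_fin//; exact: coord_le_enorm.
    by rewrite -EFinD; apply: (phibar_bound p1 adm) => //; [exact: ltW|move=> r r0; exact: H].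
  - by [].
  - by move=> x _; rewrite mule_ge0// lee_fin ltW.
  - by move=> x _; rewrite -EFinD lee_fin addr_ge0// mulr_ge0.
  - by apply: emeasurable_funD; apply: mE => //; exact: measurable_funM.
have G2 : \int[sg]_x ((a x)%:E * `|(wp x ord0 i)%:E|) <=
    b%:E * \int[sg]_x phiinf phi (rp x) (wp x) + \int[sg]_x (c x * rp x)%:E.
  have pb0 x : 0 <= phiinf phi (rp x) (wp x) by exact: (phiinf_ge0 p1 adm).
  have L := @lint_scale _ X R sg setT (fun x => phiinf phi (rp x) (wp x)) b measurableT (ltW b0) (fun x _ => pb0 x).
  apply: le_trans (leeD L (lexx _)).
  apply: le_trans (@lint_add _ X R sg setT (fun x => b%:E * phiinf phi (rp x) (wp x)) (fun x => (c x * rp x)%:E) _ _ _ _).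
  - apply: lint_le => x _; first by rewrite mule_ge0// lee_fin.
    apply: (@le_trans _ _ (a x * enorm (wp x))%:E).
      by rewrite EFinM lee_wpmul2l ?lee_fin//; exact: coord_le_enorm.
    by apply: (phiinf_bound p1 adm (e := e x)) => //; [exact: ltW|move=> r u r0; exact: H].
  - by [].
  - by move=> x _; rewrite mule_ge0// lee_fin ltW.
  - by move=> x _; rewrite lee_fin mulr_ge0.
  - by apply: mE; exact: measurable_funM.
apply: le_trans V1 _; apply: le_trans (leeD G1 G2) _.
rewrite (@gt0_muleDr b (\int[gamma]_x phibar phi (rho x) (w x)) (\int[sg]_x phiinf phi (rp x) (wp x)) b0).
by rewrite /Y addeACA; apply: leeD => //; rewrite addeAC; apply: leeD; [exact: muc|exact: lexx].
Qed.

Definition vscale (k : R) (nu : vmeas) : @vmeas R d :=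
  VMeas (vbase nu) (fun x => (k *: vdens nu x)%R).

Lemma vcomp_scale (k : R) (nu : vmeas) i (A : set X) : is_vmeas nu -> measurable A ->
  Defs.bounded_set A -> vcomp (vscale k nu) i A = k%:E * vcomp nu i A.
Proof.
move=> [_ [mv iv]] mA [r Ar]; rewrite /vcomp/=.
under eq_integral do rewrite mxE EFinM.
rewrite integralZl//; apply/integrableP; split.
  by apply/measurable_EFinP; apply: measurable_funTS.
apply: le_lt_trans (iv r).
have men : measurable_fun setT (fun x : X => (enorm (vdens nu x))%:E).
  by apply/measurable_EFinP; exact: measurable_enorm_coord.
apply: (@le_trans _ _ (\int[vbase nu]_(x in A) (enorm (vdens nu x))%:E)).
  by apply: lint_le => x _; rewrite ?abse_ge0// abse_EFin lee_fin coord_le_enorm.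
apply: ge0_subset_integral => //; first exact: measurable_B0.
- by apply: measurable_funTS.
- by move=> x _; rewrite lee_fin enorm_ge0.
Qed.

Lemma vtv_scale (k : R) (nu : vmeas) (A : set X) : is_vmeas nu -> measurable A ->
  vtv (vscale k nu) A = `|k|%:E * vtv nu A.
Proof.
move=> [_ [mv iv]] mA; rewrite /vtv/=.
under eq_integral do rewrite enormZ EFinM.
rewrite ge0_integralZl ?lee_fin//.
  by apply/measurable_EFinP/measurable_funTS; exact: measurable_enorm_coord.
by move=> x _; rewrite lee_fin enorm_ge0.
Qed.

Lemma is_vmeas_scale (k : R) (nu : vmeas) : is_vmeas nu -> is_vmeas (vscale k nu).
Proof.
move=> vnu; have [rn [mv iv]] := vnu; split => //; split.
  by move=> i /=; under eq_fun do rewrite mxE; exact: measurable_funM.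
move=> r; have := vtv_scale k vnu (measurable_B0 r); rewrite /vtv /= => ->.
by rewrite lte_mul_pinfty// lee_fin.
Qed.

(** A decomposition of [nu] scales with [nu], [phibar] and [phiinf] are p-homogeneous, and k > 0
    leaves the support of [nu] unchanged. It gives the action of a curve that is run faster. *)
Lemma Phi_scale (gamma mu : Meas) (nu : vmeas) (k : R) : is_vmeas nu -> (0 < k)%R ->
  Phi phi gamma mu (vscale k nu) <= (k `^ p)%:E * Phi phi gamma mu nu.
Proof.
move=> vnu k0; have kp : (0 < k `^ p)%R by rewrite powR_gt0.
rewrite /Phi; case: ifPn => [_|]; last first.
  move=> /asboolP nS; case: ifPn => [/asboolP [S1 S2]|_]; last by rewrite gt0_muley.
  exfalso; apply: nS; split => // x xs; apply: S2 => r r0.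
  have := xs r r0; rewrite vtv_scale//; last first.
    exact: measurable_eball.
  by rewrite gtr0_norm// pmule_rgt0.
case: ifPn => [/asboolP _|]; last by rewrite gt0_muley// leey.
rewrite -lee_pdivrMl//; apply: le_ereal_inf_tmp => v [rho [w [sg [rp [wp [dec ->]]]]]].
rewrite lee_pdivrMl//.
have [d1 [d2 [rho0 [rp0 [mrho [mrp [mw [mwp [iw [iwp [dmu dnu]]]]]]]]]]] := dec.
apply: (@le_trans _ _ (\int[gamma]_x phibar phi (rho x) (k *: w x)%R + \int[sg]_x phiinf phi (rp x) (k *: wp x)%R)).
  apply: ereal_inf_lbound; exists rho, (fun x => k *: w x)%R, sg, rp, (fun x => k *: wp x)%R.
  split => //.
  have scm (u : Rd -> Rd) : (forall i, measurable_fun setT (fun x : X => u x ord0 i)) ->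
     forall i, measurable_fun setT (fun x : X => (k *: u x)%R ord0 i).
    by move=> mu_ i; under eq_fun do rewrite mxE; exact: measurable_funM.
  have sci (m : Meas) (u : Rd -> Rd) : (forall i, measurable_fun setT (fun x : X => u x ord0 i)) ->
     (forall r : R, \int[m]_(x in B0 r) (enorm (u x))%:E < +oo) ->
     forall r : R, \int[m]_(x in B0 r) (enorm (k *: u x)%R)%:E < +oo.
    move=> mu_ iu r; under eq_integral do rewrite enormZ EFinM.
    rewrite ge0_integralZl ?lee_fin//.
    - by rewrite lte_mul_pinfty// lee_fin.
    - exact: measurable_B0.
    - by apply/measurable_EFinP/measurable_funTS; exact: measurable_enorm_coord.
    - by move=> x _; rewrite lee_fin enorm_ge0.
  have scI (m : Meas) (u : Rd -> Rd) i (A : set X) : (forall i, measurable_fun setT (fun x : X => u x ord0 i)) ->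
     (forall r : R, \int[m]_(x in B0 r) (enorm (u x))%:E < +oo) -> measurable A ->
     Defs.bounded_set A -> \int[m]_(x in A) ((k *: u x)%R ord0 i)%:E = k%:E * \int[m]_(x in A) (u x ord0 i)%:E.
    move=> mu_ iu mA [r Ar]; under eq_integral do rewrite mxE EFinM.
    rewrite integralZl//; apply/integrableP; split.
      by apply/measurable_EFinP; apply: measurable_funTS.
    apply: le_lt_trans (iu r).
    apply: (@le_trans _ _ (\int[m]_(x in A) (enorm (u x))%:E)).
      by apply: lint_le => x _; rewrite ?abse_ge0// abse_EFin lee_fin coord_le_enorm.
    apply: ge0_subset_integral => //; first exact: measurable_B0.
    - by apply/measurable_EFinP/measurable_funTS; exact: measurable_enorm_coord.
    - by move=> x _; rewrite lee_fin enorm_ge0.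
  split; first by [].
  do 5 (split; first by []).
  split; first exact: scm.
  split; first exact: scm.
  split; first exact: sci.
  split; first exact: sci.
  split; first by [].
  move=> A i mA bA; rewrite vcomp_scale// dnu// !scI//.
  exact: (@gt0_muleDr k (\int[gamma]_(x in A) (w x ord0 i)%:E) (\int[sg]_(x in A) (wp x ord0 i)%:E) k0).
rewrite (@gt0_muleDr _ (\int[gamma]_x phibar phi (rho x) (w x)) (\int[sg]_x phiinf phi (rp x) (wp x)) kp).
have pb x : 0 <= phibar phi (rho x) (w x) by exact: (phibar_ge0 p1 adm).
have pi x : 0 <= phiinf phi (rp x) (wp x) by exact: (phiinf_ge0 p1 adm).
apply: leeD.
  have L := @lint_scale _ X R gamma setT (fun x => phibar phi (rho x) (w x)) _ measurableT (ltW kp) (fun x _ => pb x).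
  apply: le_trans L.
  apply: lint_le => x _; first by exact: (phibar_ge0 p1 adm).
  by rewrite (phibarZ p1 adm).
have L := @lint_scale _ X R sg setT (fun x => phiinf phi (rp x) (wp x)) _ measurableT (ltW kp) (fun x _ => pi x).
apply: le_trans L.
apply: lint_le => x _; first by exact: (phiinf_ge0 p1 adm).
by rewrite (phiinfZ p1 adm).
Qed.

End action_bound.

(** * Test functions and cutoffs *)

Section calculus.
Context {R : realType}.
Implicit Types (t h L C : R).

Lemma is_derive_of_cvg {V : normedModType R} (f : V -> R) (x v : V) L :
  h^-1 *: (f (h *: v + x) - f x) @[h --> 0^'] --> L -> is_derive x v f L.
Proof.
move=> c; apply: DeriveDef; first by apply/cvg_ex; exists L.
exact: cvg_lim c.
Qed.

(** Piecewise quadratic C^1 functions satisfy such a remainder bound at every point, break points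
    included. *)
Lemma is_derive_quad (f : R -> R) t L C :
  (forall h, `|f (t + h) - f t - L * h| <= C * h ^+ 2) -> is_derive t 1 f L.
Proof.
move=> H; apply: is_derive_of_cvg.
apply/cvgrPdist_lt => e e0.
have C0 : 0 <= C.
  by have := H 1; rewrite expr1n !mulr1; move=> H1; exact: le_trans (normr_ge0 _) H1.
near=> h.
have h0 : h != 0 by near: h; exact: nbhs_dnbhs_neq.
have he : `|h| < e / (C + 1).
  near: h; apply: dnbhs0_lt; by rewrite divr_gt0// ltr_wpDl.
rewrite -(ltr_pM2l (_ : 0 < `|h|)) ?normr_gt0// -normrM.
have -> : h * (L - h^-1 *: (f (h *: 1 + t) - f t)) = - (f (t + h) - f t - L * h).
  rewrite /GRing.scale/= mulr1 (addrC h).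
  by field.
rewrite normrN; apply: le_lt_trans (H h) _.
rewrite -real_normK ?num_real// expr2 mulrA mulrC ltr_pM2l ?normr_gt0//.
have C1 : 0 < C + 1 by rewrite ltr_wpDl.
apply: (@le_lt_trans _ _ ((C + 1) * `|h|)); first by rewrite ler_wpM2r// lerDl.
by rewrite mulrC -ltr_pdivlMr.
Unshelve. all: by end_near. Qed.

Lemma is_derive_cvg {V : normedModType R} (f : V -> R) (x v : V) L :
  is_derive x v f L -> h^-1 *: (f (h *: v + x) - f x) @[h --> 0^'] --> L.
Proof. by move=> [df <-]. Qed.

(** Brings directional derivatives to the line, where the chain rule is applied. *)
Lemma is_derive_dir {V : normedModType R} (f : V -> R) (x v : V) L :
  is_derive (0 : R) 1 (fun h => f (h *: v + x)) L <-> is_derive x v f L.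
Proof.
split=> /is_derive_cvg H; apply: is_derive_of_cvg; apply: cvg_trans H;
  apply: near_eq_cvg; apply: nearW => h /=;
  by rewrite scale0r add0r addr0 (_ : h *: 1 = h)//; exact: mulr1.
Qed.

Lemma is_derive_comp_dir {V : normedModType R} (f : R -> R) (g : V -> R) (x v : V) (df dg : R) :
  is_derive x v g dg -> is_derive (g x) 1 f df ->
  is_derive x v (fun y => f (g y)) (df * dg).
Proof.
move=> /is_derive_dir Hg Hf; apply/is_derive_dir.
have Hf' : is_derive ((fun h => g (h *: v + x)) 0) 1 f df by rewrite scale0r add0r.
exact: (@is_derive1_comp _ f (fun h => g (h *: v + x))).
Qed.

Definition relu t := Num.max t 0.
Definition relu2 t := relu t ^+ 2.

Lemma relu_id t : 0 <= t -> relu t = t.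
Proof. by move=> t0; rewrite /relu max_l. Qed.

Lemma relu_0 t : t <= 0 -> relu t = 0.
Proof. by move=> t0; rewrite /relu max_r. Qed.

Lemma relu_continuous : continuous relu.
Proof.
move=> t; apply: (@continuous_max _ _ id (cst 0)); [exact: cvg_id|exact: cvg_cst].
Qed.

Lemma is_derive_relu2 t : is_derive t 1 relu2 (2 * relu t).
Proof.
apply: (@is_derive_quad _ _ _ 1) => h; rewrite mul1r ler_norml /relu2.
have [t0|t0] := leP 0 t; have [th|th] := leP 0 (t + h);
  rewrite ?(relu_id t0) ?(relu_id th) ?(relu_0 (ltW t0)) ?(relu_0 (ltW th)); apply/andP; split; nra.
Qed.

(** A C^1 transition from 0 to 1 on [0, 1], written with squared positive parts so that its
    derivative follows from that of [relu2]. The derivative [dstep] is a tent of height 2 and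
    integral 1, and it also serves as a mollifier. *)
Definition step t := 2 * relu2 t - 4 * relu2 (t - 2^-1) + 2 * relu2 (t - 1).
Definition dstep t := 4 * relu t - 8 * relu (t - 2^-1) + 4 * relu (t - 1).

Lemma is_derive_affine (a b t : R) : is_derive t 1 (fun s => a + b * s) b.
Proof.
apply: (@is_derive_quad _ _ _ 0) => h.
by rewrite mul0r (_ : _ - _ - _ = 0) ?normr0//; ring.
Qed.

Lemma is_derive_affine_comp (f : R -> R) (a b t L : R) :
  is_derive (a + b * t) 1 f L -> is_derive t 1 (fun s => f (a + b * s)) (L * b).
Proof. by move=> H; apply: is_derive_comp_dir => //; exact: is_derive_affine. Qed.

Lemma is_derive_step t : is_derive t 1 step (dstep t).
Proof.
have shift c : is_derive t 1 (fun s => relu2 (s - c)) (2 * relu (t - c)).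
  have := @is_derive_affine_comp relu2 (- c) 1 t (2 * relu (t - c)).
  rewrite mul1r mulr1 addrC => /(_ (is_derive_relu2 _)).
  by under eq_fun do rewrite mul1r addrC.
have h0 := is_derive_relu2 t; have h1 := shift 2^-1; have h2 := shift 1.
rewrite (_ : step = (2 \*: relu2 - 4 \*: (fun s => relu2 (s - 2^-1))) + 2 \*: (fun s => relu2 (s - 1)))//.
apply: is_derive_eq; rewrite /GRing.scale/= /dstep; ring.
Qed.

Lemma dstep_continuous : continuous dstep.
Proof.
have rc c : continuous (fun t => relu (t - c)).
  move=> t; apply: (@continuous_comp _ _ _ (fun t => t - c) relu); last exact: relu_continuous.
  by apply: cvgB; [exact: cvg_id|exact: cvg_cst].
move=> t; apply: cvgD; last by apply: cvgM; [exact: cvg_cst|exact: rc].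
apply: cvgB; last by apply: cvgM; [exact: cvg_cst|exact: rc].
by apply: cvgM; [exact: cvg_cst|exact: relu_continuous].
Qed.

Lemma step_continuous : continuous step.
Proof.
by move=> t; apply/differentiable_continuous/derivable1_diffP; have [] := is_derive_step t.
Qed.

Lemma stepE t : step t = if t <= 0 then 0 else if t <= 2^-1 then 2 * t ^+ 2
  else if t <= 1 then 1 - 2 * (1 - t) ^+ 2 else 1.
Proof.
rewrite /step /relu2; case: ifPn => [t0|]; [|rewrite -ltNge => t0].
  by rewrite !relu_0 ?expr0n ?mulr0 ?subr0 ?addr0//; lra.
rewrite (relu_id (ltW t0)); case: ifPn => [t1|]; [|rewrite -ltNge => t1].
  rewrite (@relu_0 (t - 2^-1)) ?(@relu_0 (t - 1)); try lra.
rewrite (@relu_id (t - 2^-1)); last by lra.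
case: ifPn => [t2|]; [|rewrite -ltNge => t2].
  rewrite (@relu_0 (t - 1)); last by lra.
  by field.
rewrite (@relu_id (t - 1)); last by lra.
by field.
Qed.

Lemma step_le0 t : t <= 0 -> step t = 0.
Proof. by move=> t0; rewrite stepE t0. Qed.

Lemma step_ge1 t : 1 <= t -> step t = 1.
Proof.
move=> t1; rewrite stepE.
by case: (leP t 0) => a; case: (leP t 2^-1) => b; case: (leP t 1) => c; nra.
Qed.

Lemma step_ndecr s t : s <= t -> step s <= step t.
Proof.
move=> st; rewrite !stepE.
case: (leP s 0) => s0; case: (leP s 2^-1) => s1; case: (leP s 1) => s2;
case: (leP t 0) => t0; case: (leP t 2^-1) => t1; case: (leP t 1) => t2; nra.
Qed.

Lemma step_ge0 t : 0 <= step t.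
Proof.
have [t0|t0] := leP t 0; first by rewrite step_le0.
by rewrite -(@step_le0 0)// step_ndecr// ltW.
Qed.

Lemma step_le1 t : step t <= 1.
Proof.
have [t0|t0] := leP t 1; last by rewrite step_ge1// ltW.
by rewrite -(@step_ge1 1)// step_ndecr.
Qed.

Lemma dstep_ge0 t : 0 <= dstep t.
Proof.
rewrite /dstep; have [t0|t0] := leP t 0.
  by rewrite !relu_0; lra.
rewrite (relu_id (ltW t0)); have [t1|t1] := leP t 2^-1.
  by rewrite !relu_0; lra.
rewrite (@relu_id (t - 2^-1)); last by lra.
have [t2|t2] := leP t 1.
  by rewrite !relu_0; lra.
by rewrite relu_id; lra.
Qed.

Lemma dstep_le2 t : dstep t <= 2.
Proof.
rewrite /dstep; have [t0|t0] := leP t 0.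
  by rewrite !relu_0; lra.
rewrite (relu_id (ltW t0)); have [t1|t1] := leP t 2^-1.
  by rewrite !relu_0; lra.
rewrite (@relu_id (t - 2^-1)); last by lra.
have [t2|t2] := leP t 1.
  by rewrite !relu_0; lra.
by rewrite relu_id; lra.
Qed.

Lemma dstep_0 t : t <= 0 \/ 1 <= t -> dstep t = 0.
Proof.
rewrite /dstep => -[t0|t1]; first by rewrite !relu_0; lra.
by rewrite !relu_id; lra.
Qed.

End calculus.

Lemma cvg_prodr {R : realType} (T : Type) (F : set_system T) {FF : Filter F}
  (I : Type) (s : seq I) (P : pred I) (f : I -> T -> R) (l : I -> R) :
  (forall i, f i x @[x --> F] --> l i) ->
  \prod_(i <- s | P i) f i x @[x --> F] --> \prod_(i <- s | P i) l i.
Proof.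
move=> H; elim: s => [|i s IH].
  by under eq_fun do rewrite big_nil; rewrite big_nil; exact: cvg_cst.
under eq_fun do rewrite big_cons; rewrite big_cons; case: (P i) => //.
by apply: cvgM; [exact: H|exact: IH].
Qed.

Section continuity.
Context {R : realType} {T : topologicalType}.

Lemma cont_cst (U : topologicalType) (c : U) : continuous (fun _ : T => c).
Proof. by move=> x; exact: cvg_cst. Qed.

Lemma contM (f g : T -> R) : continuous f -> continuous g -> continuous (fun x => f x * g x).
Proof. by move=> cf cg x; apply: cvgM; [exact: cf|exact: cg]. Qed.

Lemma contD (f g : T -> R) : continuous f -> continuous g -> continuous (fun x => f x + g x).
Proof. by move=> cf cg x; apply: cvgD; [exact: cf|exact: cg]. Qed.

Lemma contB (f g : T -> R) : continuous f -> continuous g -> continuous (fun x => f x - g x).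
Proof. by move=> cf cg x; apply: cvgB; [exact: cf|exact: cg]. Qed.

Lemma cont_comp (U V : topologicalType) (f : T -> U) (g : U -> V) :
  continuous f -> continuous g -> continuous (fun x => g (f x)).
Proof. by move=> cf cg x; apply: (@continuous_comp _ _ _ f g); [exact: cf|exact: cg]. Qed.

Lemma cont_pair (U V : topologicalType) (f : T -> U) (g : T -> V) :
  continuous f -> continuous g -> continuous (fun x => (f x, g x)).
Proof. by move=> cf cg x; apply: cvg_pair; [exact: cf|exact: cg]. Qed.

End continuity.

Lemma cont_fst (U V : topologicalType) : continuous (@fst U V).
Proof. by move=> x; exact: cvg_fst. Qed.

Lemma cont_snd (U V : topologicalType) : continuous (@snd U V).
Proof. by move=> x; exact: cvg_snd. Qed.

Lemma is_derive_uniq {R : realType} {V : normedModType R} (f : V -> R) (x v : V) (a b : R) :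
  is_derive x v f a -> is_derive x v f b -> a = b.
Proof. by move=> [_ <-] [_ <-]. Qed.

Section test_functions.
Context {R : realType} {d : nat}.
Notation Rd := 'rV[R]_d.
Notation e_ i := (delta_mx ord0 i : Rd).

Definition C1s (f : Rd -> R) (D : 'I_d -> Rd -> R) : Prop :=
  continuous f /\ (forall i, continuous (D i)) /\
  (forall i x, is_derive x (e_ i) f (D i x)).

Definition cpt_supp (f : Rd -> R) : Prop := exists r : R, forall x, r <= enorm x -> f x = 0.

(** Compact support is asked in space only, and the derivatives are carried as data. So the class
    contains functions that are constant in time and is stable under affine changes of time. *)
Definition C1t (zeta : Rd -> R -> R) (Dt : Rd -> R -> R) (D : 'I_d -> Rd -> R -> R) : Prop :=
  (forall x (t : R), is_derive t 1 (zeta x) (Dt x t)) /\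
  (forall i x t, is_derive x (e_ i) (zeta^~ t) (D i x t)) /\
  continuous (fun pt : Rd * R => zeta pt.1 pt.2) /\
  continuous (fun pt : Rd * R => Dt pt.1 pt.2) /\
  (forall i, continuous (fun pt : Rd * R => D i pt.1 pt.2)) /\
  exists r : R, forall x t, r <= enorm x -> zeta x t = 0.

Lemma C1c_C1t T zeta : C1c T zeta -> C1t zeta (partial_t zeta) (partial_x zeta).
Proof.
move=> [dt [dx [c0 [ct [cx [r [a [b [_ [_ H]]]]]]]]]].
split; first by move=> x t; rewrite /partial_t derive1E; exact: derivableP.
split; first by move=> i x t; exact: derivableP.
do 3 (split=> //).
by exists r => x t rx; apply: H; left.
Qed.

Lemma C1t_supp zeta Dt D : C1t zeta Dt D -> exists2 r : R, 0 < r & forall x t, r <= enorm x ->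
  [/\ zeta x t = 0, Dt x t = 0 & forall i, D i x t = 0].
Proof.
move=> [dt [dx [_ [_ [_ [r H]]]]]].
exists (`|r| + 1); first by rewrite ltr_wpDl.
move=> x t rx; have r1 : r < enorm x.
  by rewrite (lt_le_trans _ rx)// (le_lt_trans (ler_norm r))// ltrDl.
split; first by rewrite H// ltW.
  apply: (is_derive_uniq (dt x t)).
  rewrite (_ : zeta x = cst 0); first exact: is_derive_cst.
  by apply/funext => s; rewrite H// ltW.
move=> i; apply: (is_derive_uniq (dx i x t)).
have h0 := @is_derive_cst R Rd R (0 : R) x (e_ i).
apply: near_eq_is_derive h0.
have /cvgr_gt/(_ _ r1) := @enorm_continuous R d x.
by apply: filterS => y ry; rewrite H// ltW.
Qed.

(** A time cutoff [chi] turns [zeta] into an admissible test function; with these derivatives the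
    weak equation becomes one for functions of time alone. *)
Lemma C1t_mul zeta Dt D (chi chi' : R -> R) (T a b : R) : C1t zeta Dt D ->
  (forall t : R, is_derive t 1 chi (chi' t)) -> continuous chi' ->
  0 < a -> b < T -> (forall t, t < a \/ b < t -> chi t = 0) ->
  [/\ C1c T (fun x t => zeta x t * chi t),
    partial_t (fun x t => zeta x t * chi t) = (fun x t => Dt x t * chi t + zeta x t * chi' t) &
    partial_x (fun x t => zeta x t * chi t) = (fun i x t => D i x t * chi t)].
Proof.
move=> [dt [dx [c0 [ct [cx [r H]]]]]] dchi cchi' a0 bT chi0.
have cchi : continuous chi.
  by move=> t; apply/differentiable_continuous/derivable1_diffP; have [] := dchi t.
have Et x (t : R) : is_derive t 1 (fun t => zeta x t * chi t) (Dt x t * chi t + zeta x t * chi' t).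
  rewrite (_ : (fun t => _) = zeta x * chi)//.
  have d1 := dt x t; have d2 := dchi t; apply: is_derive_eq.
  by rewrite /GRing.scale/= addrC [chi t * _]mulrC.
have Ex i x t : is_derive x (e_ i) (fun y => zeta y t * chi t) (D i x t * chi t).
  rewrite (_ : (fun y => _) = chi t \*: (zeta^~ t)); last first.
    by apply/funext => y /=; rewrite mulrC.
  have d1 := dx i x t; apply: is_derive_eq.
  by rewrite /GRing.scale/= mulrC.
have Pt : partial_t (fun x t => zeta x t * chi t) = (fun x t => Dt x t * chi t + zeta x t * chi' t).
  by apply/funext => x; apply/funext => t; rewrite /partial_t derive1E; have [_ <-] := Et x t.
have Px : partial_x (fun x t => zeta x t * chi t) = (fun i x t => D i x t * chi t).
  by apply/funext => i; apply/funext => x; apply/funext => t; rewrite /partial_x; have [_ <-] := Ex i x t.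
have c2 (u : R -> R) : continuous u -> continuous (fun pt : Rd * R => u pt.2).
  by move=> cu; apply: cont_comp cu; exact: cont_snd.
split => //; split; first by move=> x t; have [] := Et x t.
split; first by move=> i x t; have [] := Ex i x t.
split; first by apply: contM => //; exact: c2.
split.
  by rewrite Pt; apply: contD; apply: contM => //; exact: c2.
split.
  by move=> i; rewrite Px; apply: contM; [exact: cx|exact: c2].
exists r, a, b; split => //; split => // x t [rx|tab]; first by rewrite H// mul0r.
by rewrite chi0// mulr0.
Qed.

Lemma C1t_affine zeta Dt D (a tau : R) : C1t zeta Dt D ->
  C1t (fun x s => zeta x (a + tau * s)) (fun x s => Dt x (a + tau * s) * tau)
      (fun i x s => D i x (a + tau * s)).
Proof.
move=> [dt [dx [c0 [ct [cx [r H]]]]]].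
have ca (u : Rd -> R -> R) : continuous (fun pt : Rd * R => u pt.1 pt.2) ->
    continuous (fun pt : Rd * R => u pt.1 (a + tau * pt.2)).
  move=> cu; apply: (@cont_comp _ _ _ (fun pt : Rd * R => (pt.1, a + tau * pt.2)) (fun pt : Rd * R => u pt.1 pt.2)) => //.
  apply: cont_pair; first exact: cont_fst.
  by apply: contD; [exact: cont_cst|apply: contM; [exact: cont_cst|exact: cont_snd]].
split; first by move=> x s; apply: is_derive_affine_comp.
split; first by move=> i x s; exact: dx.
split; first exact: ca c0.
split; first by apply: contM; [exact: ca ct|exact: cont_cst].
split; first by move=> i; exact: ca (cx i).
by exists r => x s rx; rewrite H.
Qed.

Lemma C1t_of_C1s f D : C1s f D -> cpt_supp f ->
  C1t (fun x _ => f x) (fun _ _ => 0) (fun i x _ => D i x).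
Proof.
move=> [cf [cD df]] [r H].
have c1 (u : Rd -> R) : continuous u -> continuous (fun pt : Rd * R => u pt.1).
  by move=> cu; apply: cont_comp cu; exact: cont_fst.
split; first by move=> x t; exact: is_derive_cst.
split; first by move=> i x t; exact: df.
split; first exact: c1.
split; first exact: cont_cst.
split; first by move=> i; exact: c1.
by exists r => x t; exact: H.
Qed.

Lemma C1s_supp f D : C1s f D -> cpt_supp f -> exists2 r : R, 0 < r & forall x, r <= enorm x ->
  f x = 0 /\ forall i, D i x = 0.
Proof.
move=> h1 h2; have [r r0 H] := C1t_supp (C1t_of_C1s h1 h2).
by exists r => // x rx; have [-> _ ?] := H x 0 rx.
Qed.

Lemma C1s_sum (I : Type) (s : seq I) (c : I -> R) (f : I -> Rd -> R) (D : I -> 'I_d -> Rd -> R) :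
  (forall j, C1s (f j) (D j)) ->
  C1s (fun x => \sum_(j <- s) c j * f j x) (fun i x => \sum_(j <- s) c j * D j i x).
Proof.
move=> H; split; [|split].
- move=> x; apply: (@cvg_sumr R Rd (nbhs x) (nbhs_filter x)) => j.
  by apply: cvgM; [exact: cvg_cst|exact: (H j).1].
- move=> i x; apply: (@cvg_sumr R Rd (nbhs x) (nbhs_filter x)) => j.
  by apply: cvgM; [exact: cvg_cst|exact: (H j).2.1].
- move=> i x; elim: s => [|j s IH].
    rewrite big_nil (_ : (fun x => _) = cst 0); first exact: is_derive_cst.
    by apply/funext => y; rewrite big_nil.
  rewrite big_cons (_ : (fun x => _) = (c j \*: f j) + (fun x => \sum_(j <- s) c j * f j x)).
    have d1 := (H j).2.2 i x; apply: is_derive_eq.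
    by [].
  by apply/funext => y; rewrite big_cons.
Qed.

Lemma line_coord (h : R) (x : Rd) i k :
  (h *: e_ i + x) ord0 k = h * (k == i)%:R + x ord0 k.
Proof. by rewrite !mxE eqxx. Qed.

Lemma C1s_prod (F F' : 'I_d -> R -> R) :
  (forall i (t : R), is_derive t 1 (F i) (F' i t)) -> (forall i, continuous (F' i)) ->
  C1s (fun x => \prod_i F i (x ord0 i))
      (fun i x => F' i (x ord0 i) * \prod_(k | k != i) F k (x ord0 k)).
Proof.
move=> dF cF'.
have cF i : continuous (F i).
  by move=> t; apply/differentiable_continuous/derivable1_diffP; have [] := dF i t.
have cc (u : R -> R) i : continuous u -> continuous (fun x : Rd => u (x ord0 i)).
  by move=> cu; apply: (@cont_comp _ _ _ (fun x : Rd => x ord0 i) u) => // x; exact: coord_continuous.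
split; [|split].
- by move=> x; apply: (@cvg_prodr R Rd (nbhs x) (nbhs_filter x)) => j; exact: cc.
- move=> i; apply: contM; first exact: cc.
  by move=> x; apply: (@cvg_prodr R Rd (nbhs x) (nbhs_filter x)) => j; exact: cc.
- move=> i x; apply/is_derive_dir.
  set c := \prod_(k | k != i) _.
  rewrite (_ : (fun h => _) = c \*: (fun h => F i (x ord0 i + 1 * h))); last first.
    apply/funext => h /=; rewrite (bigD1 i)//= line_coord eqxx mulr1 mul1r addrC [RHS]mulrC; congr (_ * _).
    by apply: eq_bigr => k ki; rewrite line_coord (negbTE ki) mulr0 add0r.
  have d1 : is_derive (0:R) 1 (fun h => F i (x ord0 i + 1 * h)) (F' i (x ord0 i) * 1).
    by apply: is_derive_affine_comp; rewrite mulr0 addr0.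
  by apply: is_derive_eq; rewrite mulr1 mulrC.
Qed.

Lemma C1s_comp (u u' : R -> R) g (D : 'I_d -> Rd -> R) : C1s g D ->
  (forall t : R, is_derive t 1 u (u' t)) -> continuous u' ->
  C1s (fun x => u (g x)) (fun i x => u' (g x) * D i x).
Proof.
move=> [cg [cD dg]] du cu'.
have cu : continuous u.
  by move=> t; apply/differentiable_continuous/derivable1_diffP; have [] := du t.
split; [|split].
- exact: cont_comp.
- by move=> i; apply: contM; [exact: cont_comp|exact: cD].
- by move=> i x; apply: is_derive_comp_dir.
Qed.

Lemma C1s_sumsq : C1s (fun x => \sum_i x ord0 i ^+ 2) (fun i x => 2 * x ord0 i).
Proof.
split; first exact: sumsq_continuous.
split.
  by move=> i; apply: contM; [exact: cont_cst|move=> x; exact: coord_continuous].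
move=> i x; apply/is_derive_dir; apply: (@is_derive_quad _ _ _ _ 1) => h.
rewrite add0r scale0r add0r (bigD1 i)//= [X in _ - X - _](bigD1 i)//= line_coord eqxx mulr1.
rewrite (eq_bigr (fun k => x ord0 k ^+ 2)); last first.
  by move=> k ki; rewrite line_coord (negbTE ki) mulr0 add0r.
rewrite mul1r (_ : _ - _ = h ^+ 2) ?ger0_norm ?sqr_ge0//; ring.
Qed.

End test_functions.

(** * Radial cutoffs with controlled gradient *)

Section cutoff.
Context {R : realType} {d : nat}.
Notation Rd := 'rV[R]_d.
Implicit Types (x : Rd) (M : R).

(** A function of |x|^2, hence smooth at 0 too, that falls from 1 on |x| <= M to 0 before |x| = 2 M.
    Its powers have a gradient that is small where they are small. *)
Definition ramp M x : R := 1 - step ((\sum_i x ord0 i ^+ 2) * (M ^+ 2)^-1 - 1).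
Definition cutoff (k : nat) M x : R := ramp M x ^+ k.
Definition dcutoff (k : nat) M (i : 'I_d) x : R :=
  (k%:R * ramp M x ^+ k.-1 * (- dstep ((\sum_i x ord0 i ^+ 2) * (M ^+ 2)^-1 - 1) * (M ^+ 2)^-1)) *
  (2 * x ord0 i).

Lemma ramp_ge0 M x : 0 <= ramp M x.
Proof. by rewrite subr_ge0 step_le1. Qed.

Lemma ramp_le1 M x : ramp M x <= 1.
Proof. by rewrite gerBl step_ge0. Qed.

Lemma ramp_1 M x : 0 < M -> enorm x <= M -> ramp M x = 1.
Proof.
move=> M0 xM; rewrite /ramp step_le0 ?subr0//.
rewrite subr_le0 ler_pdivrMr ?exprn_gt0// mul1r -enorm_sqr.
by rewrite ler_pXn2r// nnegrE ?enorm_ge0// ltW.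
Qed.

Lemma ramp_0 M x : 0 < M -> 2 * M <= enorm x -> ramp M x = 0.
Proof.
move=> M0 xM; rewrite /ramp step_ge1 ?subrr//.
rewrite lerBrDr ler_pdivlMr ?exprn_gt0// -enorm_sqr.
apply: (@le_trans _ _ ((2 * M) ^+ 2)); last first.
  by rewrite ler_pXn2r// nnegrE ?enorm_ge0 ?mulr_ge0 ?ltW.
by rewrite exprMn ler_wpM2r ?sqr_ge0//; lra.
Qed.

Lemma C1s_cutoff k M : C1s (cutoff k M) (dcutoff k M).
Proof.
pose u (s : R) := (1 - step (s * (M ^+ 2)^-1 - 1)) ^+ k.
pose u' (s : R) := k%:R * (1 - step (s * (M ^+ 2)^-1 - 1)) ^+ k.-1 * (- dstep (s * (M ^+ 2)^-1 - 1) * (M ^+ 2)^-1).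
have da (s : R) : is_derive s 1 (fun s => s * (M ^+ 2)^-1 - 1) ((M ^+ 2)^-1).
  by have := is_derive_affine (- 1) ((M ^+ 2)^-1) s; under eq_fun do rewrite addrC mulrC.
have ds (s : R) : is_derive s 1 (fun s => 1 - step (s * (M ^+ 2)^-1 - 1)) (- (dstep (s * (M ^+ 2)^-1 - 1) * (M ^+ 2)^-1)).
  have h := is_derive_comp_dir (da s) (is_derive_step (s * (M ^+ 2)^-1 - 1)).
  rewrite (_ : (fun s => _) = cst 1 - (fun s => step (s * (M ^+ 2)^-1 - 1)))//.
  by apply: is_derive_eq; rewrite sub0r.
have du (s : R) : is_derive s 1 u (u' s).
  have dX (t : R) : is_derive t 1 (fun t : R => t ^+ k) (k%:R * t ^+ k.-1).
    apply: DeriveDef; first exact: exprn_derivable.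
    by rewrite -derive1E exp_derive1.
  have := is_derive_comp_dir (ds s) (dX (1 - step (s * (M ^+ 2)^-1 - 1))).
  by rewrite -mulNr.
have cu' : continuous u'.
  have ca : continuous (fun s : R => s * (M ^+ 2)^-1 - 1).
    by apply: contB; [apply: contM; [move=> s; exact: cvg_id|exact: cont_cst]|exact: cont_cst].
  apply: contM.
    apply: contM; first exact: cont_cst.
    apply: (@cont_comp R R R (fun s : R => 1 - step (s * (M ^+ 2)^-1 - 1)) (fun t : R => t ^+ k.-1)).
      apply: contB; first exact: cont_cst.
      exact: (cont_comp ca (@step_continuous R)).
    by move=> s; exact: exprn_continuous.
  apply: contM; last exact: cont_cst.
  rewrite (_ : (fun z : R => - dstep _) = (fun z : R => 0 - dstep (z * (M ^+ 2)^-1 - 1))).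
    by apply: contB; [exact: cont_cst|exact: (cont_comp ca (@dstep_continuous R))].
  by apply/funext => s; rewrite sub0r.
exact: (C1s_comp C1s_sumsq du cu').
Qed.

Lemma cutoff_ge0 k M x : 0 <= cutoff k M x.
Proof. by rewrite exprn_ge0// ramp_ge0. Qed.

Lemma cutoff_le1 k M x : cutoff k M x <= 1.
Proof. by rewrite exprn_ile1 ?ramp_ge0 ?ramp_le1. Qed.

Lemma cutoff_1 k M x : 0 < M -> enorm x <= M -> cutoff k M x = 1.
Proof. by move=> M0 xM; rewrite /cutoff ramp_1// expr1n. Qed.

Lemma cutoff_0 k M x : (0 < k)%N -> 0 < M -> 2 * M <= enorm x -> cutoff k M x = 0.
Proof. by move=> k0 M0 xM; rewrite /cutoff ramp_0// expr0n gtn_eqF. Qed.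

Lemma cpt_supp_cutoff k M : (0 < k)%N -> 0 < M -> cpt_supp (cutoff k M).
Proof. by move=> k0 M0; exists (2 * M) => x; exact: cutoff_0. Qed.

Lemma dcutoff_0 k M i x : 0 < M -> enorm x <= M \/ 2 * M <= enorm x -> dcutoff k M i x = 0.
Proof.
move=> M0 xM; rewrite /dcutoff dstep_0 ?oppr0 ?mul0r ?mulr0 ?mul0r//.
rewrite -enorm_sqr; case: xM => xM.
  left; rewrite subr_le0 ler_pdivrMr ?exprn_gt0// mul1r.
  by rewrite ler_pXn2r// nnegrE ?enorm_ge0// ltW.
right; rewrite lerBrDr ler_pdivlMr ?exprn_gt0//.
apply: (@le_trans _ _ ((2 * M) ^+ 2)); last first.
  by rewrite ler_pXn2r// nnegrE ?enorm_ge0 ?mulr_ge0 ?ltW.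
by rewrite exprMn ler_wpM2r ?sqr_ge0//; lra.
Qed.

(** Where the gradient is nonzero |x_i| <= 2 M; with [dstep] at most 2 this gives 2 * M^(-2) * 4 M =
    8 / M. *)
Lemma dcutoff_le k M i x : 0 < M ->
  `|dcutoff k M i x| <= 8 * k%:R * ramp M x ^+ k.-1 / M.
Proof.
move=> M0; have r0 : 0 <= 8 * k%:R * ramp M x ^+ k.-1 / M.
  by rewrite divr_ge0 ?(ltW M0)// mulr_ge0 ?exprn_ge0 ?ramp_ge0// mulr_ge0.
have [xM|xM] := leP (2 * M) (enorm x).
  by rewrite dcutoff_0 ?normr0//; right.
rewrite /dcutoff !normrM normrN (ger0_norm (dstep_ge0 _)).
rewrite (ger0_norm (_ : 0 <= k%:R))// (ger0_norm (_ : 0 <= ramp M x ^+ _)) ?exprn_ge0 ?ramp_ge0//.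
rewrite (ger0_norm (_ : 0 <= 2))// (ger0_norm (_ : 0 <= (M ^+ 2)^-1)) ?invr_ge0 ?sqr_ge0//.
have xi : `|x ord0 i| <= 2 * M by rewrite (le_trans (coord_le_enorm _ _))// ltW.
have -> : 8 * k%:R * ramp M x ^+ k.-1 / M = k%:R * ramp M x ^+ k.-1 * (2 * (M ^+ 2)^-1) * (2 * (2 * M)).
  by field; rewrite gt_eqF.
apply: ler_pM => //.
- by rewrite !mulr_ge0 ?exprn_ge0 ?ramp_ge0 ?dstep_ge0 ?invr_ge0 ?sqr_ge0.
- rewrite ler_wpM2l ?mulr_ge0 ?exprn_ge0 ?ramp_ge0//.
  by rewrite ler_wpM2r ?invr_ge0 ?sqr_ge0// dstep_le2.
- by rewrite ler_wpM2l.
Qed.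

End cutoff.

(** * Uniform approximation of C_c functions by C^1 functions of compact support *)

Section density.
Context {R : realType} {d : nat}.
Notation Rd := 'rV[R]_d.

(** Compactness is applied on the ball of radius r + 1. Since delta <= 1, a point beyond it and its
    delta-neighbours all lie outside the support. *)
Lemma Cc_unif_continuous (f : Rd -> R) : Cc f -> forall eps, 0 < eps ->
  exists delta : R, [/\ 0 < delta, delta <= 1 & forall x y, `|x - y| < delta -> `|f x - f y| < eps].
Proof.
move=> [cf [r0 fr0]] eps e0.
pose r := `|r0|.
have fr x : r <= `|x| -> f x = 0.
  by move=> rx; apply: fr0; apply: le_trans (ler_norm r0) _; rewrite (le_trans rx)// norm_le_enorm.
pose K : set Rd := [set x | `|x| <= r + 1].
have cK : compact K.
  apply: bounded_closed_compact.
    by exists (r + 1); split; [exact: num_real|move=> M M1 x /= /le_trans -> //; exact: ltW].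
  rewrite (_ : K = (fun w : Rd => `|w|) @^-1` [set t | t <= r + 1])//.
  by apply: closed_comp; [move=> x _; exact: norm_continuous|exact: closed_le].
have : \forall de \near 0^'+, K `<=` (fun x : Rd => forall y, `|x - y| < de -> `|f x - f y| < eps).
  apply: ((compact_near_coveringP K).1 cK R 0^'+ (fun de (x : Rd) => forall y, `|x - y| < de -> `|f x - f y| < eps)) => x Kx.
  have e2 : 0 < eps / 2 by rewrite divr_gt0.
  have /cvgr_dist_lt/(_ _ e2) := cf x.
  move=> /nbhs_ballP[eta /= eta0 Heta].
  have eta2 : 0 < eta / 2 by rewrite divr_gt0.
  exists ([set v | `|x - v| < eta / 2], [set e | e < eta / 2]).
    split => /=; last by apply: nbhs_right_lt.
    by have /cvgr_dist_lt/(_ _ eta2) := @cvg_id _ (nbhs x).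
  move=> [z de] /= [xz de2] y zy.
  have fz : `|f x - f z| < eps / 2.
    by apply: Heta; rewrite -ball_normE/= (lt_trans xz)// ltr_pdivrMr// ltr_pMr// ltr1n.
  have fy : `|f x - f y| < eps / 2.
    apply: Heta; rewrite -ball_normE/= (splitr eta).
    rewrite -(subrKA z x (- y)) (le_lt_trans (ler_normD _ _))//.
    by rewrite ltrD// (lt_trans zy).
  rewrite -(subrKA (f x)) (le_lt_trans (ler_normD _ _))// (splitr eps) ltrD//.
  by rewrite distrC.
move=> /(filterI (nbhs_right_gt (0 : R))) /(filterI (nbhs_right_le (@ltr01 R))) /filter_ex.
move=> [de /= [de1 [de0 H]]]; exists de; split => // x y xy.
have [Kx|nKx] := leP `|x| (r + 1); first exact: H.
rewrite !fr ?subrr ?normr0//; last first.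
  by rewrite (le_trans _ (ltW nKx))// lerDl.
have : `|x| - `|y| <= 1 by rewrite (le_trans (lerB_dist _ _))// (le_trans (ltW xy)).
lra.
Qed.

(** A difference of consecutive translates of [step], supported in [m - N, m + 2 - N] and centred at
    m + 1 - N; the sum over m telescopes. *)
Let bump (N m : nat) (t : R) : R := step (t + N%:R - m%:R) - step (t + N%:R - m.+1%:R).
Let dbump (N m : nat) (t : R) : R := dstep (t + N%:R - m%:R) - dstep (t + N%:R - m.+1%:R).

Let bump_ge0 N m t : 0 <= bump N m t.
Proof. by rewrite subr_ge0 step_ndecr// lerD2l lerN2 ler_nat. Qed.

Let bump_supp N m t : 1 <= `|t - (m.+1%:R - N%:R)| -> bump N m t = 0.
Proof.
rewrite /bump -natr1 ler_normr => /orP[h|h].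
  by rewrite !step_ge1 ?subrr//; lra.
by rewrite !step_le0 ?subrr//; lra.
Qed.

Let bump_sum N t : `|t| <= N%:R - 1 -> \sum_(m < (2 * N)%N) bump N m t = 1.
Proof.
rewrite ler_norml => /andP[t1 t2].
pose g (m : nat) := - step (t + N%:R - m%:R).
rewrite (eq_bigr (fun m : 'I_(2 * N) => g m.+1 - g m)); last first.
  by move=> m _; rewrite /g opprK addrC.
rewrite -(big_mkord xpredT (fun m => g m.+1 - g m)) telescope_sumr// /g.
rewrite step_le0; last by rewrite mulnC natrM; lra.
by rewrite (@step_ge1 _ (t + N%:R - 0)); lra.
Qed.

Let is_derive_bump N m (a t : R) : is_derive t 1 (fun s => bump N m (a * s)) (dbump N m (a * t) * a).
Proof.
have sh (c : R) : is_derive t 1 (fun s => step (a * s + N%:R - c)) (dstep (a * t + N%:R - c) * a).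
  have := @is_derive_affine_comp _ step (N%:R - c) a t (dstep (a * t + N%:R - c)).
  rewrite addrC addrA => /(_ (is_derive_step _)).
  by under eq_fun do rewrite addrC addrA.
have h1 := sh m%:R; have h2 := sh m.+1%:R.
rewrite (_ : (fun s => _) = (fun s => step (a * s + N%:R - m%:R)) - (fun s => step (a * s + N%:R - m.+1%:R)))//.
by apply: is_derive_eq; rewrite -mulrBl.
Qed.

Let cont_dbump N m (a : R) : continuous (fun t => dbump N m (a * t) * a).
Proof.
apply: contM; last exact: cont_cst.
have sh (c : R) : continuous (fun s : R => dstep (a * s + N%:R - c)).
  apply: (@cont_comp _ _ _ (fun s : R => a * s + N%:R - c) dstep); last exact: dstep_continuous.
  apply: contB; last exact: cont_cst.
  apply: contD; last exact: cont_cst.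
  by apply: contM; [exact: cont_cst|move=> s; exact: cvg_id].
by apply: contB; exact: sh.
Qed.

(** A partition of unity into products of bumps on a grid of mesh 1 / a, with f sampled at the grid
    points: every bump that is nonzero at x is centred within [de] of x. *)
Lemma C1s_dense (f : Rd -> R) (eps : R) : Cc f -> 0 < eps ->
  exists g D, [/\ C1s g D, cpt_supp g & forall x, `|f x - g x| <= eps].
Proof.
move=> Cf e0; have [de [de0 de1 Hde]] := Cc_unif_continuous Cf e0.
have [cf [r0 fr0]] := Cf; pose r := `|r0|.
have fr x : r <= `|x| -> f x = 0.
  by move=> rx; apply: fr0; apply: le_trans (ler_norm r0) _; rewrite (le_trans rx)// norm_le_enorm.
pose n := (Num.truncn de^-1).+1; pose a : R := n%:R.
have a0 : 0 < a by rewrite ltr0n.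
have ade : a^-1 < de.
  by rewrite -[de]invrK ltf_pV2 ?posrE ?invr_gt0// truncnS_gt.
(* Large enough for the bumps to sum to 1 on the cube of half-side r + 1, beyond which both f and g
   vanish. *)
pose N := (Num.truncn (a * (r + 1) + 1)).+1.
have HN : a * (r + 1) + 1 <= N%:R by rewrite ltW// truncnS_gt.
pose F (j : {ffun 'I_d -> 'I_(2 * N)}) (i : 'I_d) (s : R) := bump N (j i) (a * s).
pose F' (j : {ffun 'I_d -> 'I_(2 * N)}) (i : 'I_d) (s : R) := dbump N (j i) (a * s) * a.
pose W j (x : Rd) := \prod_i F j i (x ord0 i).
pose pt (j : {ffun 'I_d -> 'I_(2 * N)}) : Rd := \row_i (((j i).+1%:R - N%:R) / a).
have W0 j x : 0 <= W j x by apply: prodr_ge0 => i _; exact: bump_ge0.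
have Wpt j x : W j x != 0 -> `|x - pt j| < de.
  move=> Wn; apply: le_lt_trans ade; apply: norm_le_coord; first by rewrite invr_ge0 ltW.
  move=> i; rewrite !mxE leNgt; apply/negP => h.
  move/negP: Wn; apply; apply/eqP; rewrite /W (bigD1 i)//= /F bump_supp ?mul0r//.
  have -> : a * x ord0 i - ((j i).+1%:R - N%:R) = a * (x ord0 i - ((j i).+1%:R - N%:R) / a).
    by field; rewrite gt_eqF.
  by rewrite normrM gtr0_norm// -ler_pdivrMl// mulr1 ltW.
pose g x := \sum_j f (pt j) * W j x.
pose D i (x : Rd) := \sum_j f (pt j) * (F' j i (x ord0 i) * \prod_(k | k != i) F j k (x ord0 k)).
have gC : C1s g D.
  apply: C1s_sum => j; apply: C1s_prod => i; last exact: cont_dbump.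
  by move=> t; exact: is_derive_bump.
have g0 x : r + 1 <= `|x| -> g x = 0.
  move=> rx; rewrite /g big1// => j _.
  have [->|/Wpt h] := eqVneq (W j x) 0; first by rewrite mulr0.
  rewrite fr ?mul0r//.
  have : `|x| - `|pt j| <= 1 by rewrite (le_trans (lerB_dist _ _))// (le_trans (ltW h)).
  lra.
exists g, D; split => //.
  exists (d%:R * (r + 1) + 1) => x dx; apply: g0; rewrite leNgt; apply/negP => xr.
  have := le_trans dx (enorm_le_norm x).
  have : d%:R * `|x| <= d%:R * (r + 1) by rewrite ler_wpM2l// ltW.
  lra.
move=> x; have [rx|rx] := leP (r + 1) `|x|.
  by rewrite g0// fr ?subrr ?normr0 ?(ltW e0)// (le_trans _ rx)// lerDl.
have S1 : \sum_j W j x = 1.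
  rewrite /W -(bigA_distr_bigA (fun (i : 'I_d) (m : 'I_(2 * N)) => bump N m (a * x ord0 i))).
  rewrite big1// => i _; apply: bump_sum; rewrite normrM gtr0_norm//.
  rewrite lerBrDr; apply: le_trans HN; rewrite lerD2r ler_wpM2l ?(ltW a0)//.
  by rewrite (le_trans (coord_le_norm _ _))// ltW.
have -> : f x - g x = \sum_j (f x - f (pt j)) * W j x.
  under eq_bigr do rewrite mulrBl.
  by rewrite sumrB -mulr_sumr S1 mulr1.
apply: le_trans (ler_norm_sum _ _ _) _.
apply: (@le_trans _ _ (\sum_j eps * W j x)); last by rewrite -mulr_sumr S1 mulr1.
apply: ler_sum => j _; rewrite normrM (ger0_norm (W0 _ _)).
have [->|/Wpt h] := eqVneq (W j x) 0; first by rewrite !mulr0.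
by rewrite ler_wpM2r// ltW// Hde.
Qed.

End density.

(** * The continuity equation between two times *)

Section space_integrals.
Context {R : realType} {d : nat}.
Notation Rd := 'rV[R]_d.
Notation X := (@BRd R d).
Notation Meas := ({measure set X -> \bar R}).
Notation leb := (@lebesgue_measure R).

Lemma abs_integral_cpt (m : Meas) (u f : X -> R) (r M : R) :
  measurable_fun setT u -> measurable_fun setT f -> 0 <= M -> (forall x, `|f x| <= M) ->
  (forall x, r <= enorm x -> f x = 0) ->
  (\int[m]_x `|(f x * u x)%:E| <= M%:E * \int[m]_(x in B0 r) `|(u x)%:E|)%E.
Proof.
move=> mu mf M0 fM fr; have mB := @measurable_B0 R d r.
rewrite -ge0_integralZl//; last first.
  by apply: measurableT_comp => //; apply/measurable_EFinP; exact: measurable_funTS.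
rewrite [leRHS]integral_mkcond; apply: lint_le => x _; first exact: abse_ge0.
rewrite patchE; case: ifPn => [_|]; first by rewrite !abse_EFin -EFinM lee_fin normrM ler_wpM2r.
by rewrite notin_setE /B0/= => /negP; rewrite -leNgt => rx; rewrite fr// mul0r normr0.
Qed.

Lemma integrable_cpt (m : Meas) (u f : X -> R) (r M : R) :
  measurable_fun setT u -> measurable_fun setT f -> 0 <= M -> (forall x, `|f x| <= M) ->
  (forall x, r <= enorm x -> f x = 0) ->
  (\int[m]_(x in B0 r) `|(u x)%:E| < +oo)%E ->
  m.-integrable setT (fun x => (f x * u x)%:E).
Proof.
move=> mu mf M0 fM fr iu; apply/integrableP; split.
  by apply/measurable_EFinP; exact: measurable_funM.
apply: le_lt_trans (abs_integral_cpt m mu mf M0 fM fr) _.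
by rewrite lte_mul_pinfty ?lee_fin.
Qed.

Lemma radon_int1 (m : Meas) (r : R) : radon m ->
  (\int[m]_(x in B0 r) `|(1%:E : \bar R)| = m (B0 r))%E.
Proof.
move=> rm; rewrite (_ : (fun=> _) = (fun=> 1%:E)); last by apply/funext => x; rewrite abse_EFin normr1.
by rewrite integral_cst ?mul1e//; exact: measurable_B0.
Qed.

Lemma integrable_radon (m : Meas) (f : X -> R) (r M : R) : radon m ->
  measurable_fun setT f -> 0 <= M -> (forall x, `|f x| <= M) ->
  (forall x, r <= enorm x -> f x = 0) ->
  m.-integrable setT (fun x => (f x)%:E).
Proof.
move=> rm mf M0 fM fr.
rewrite (_ : (fun x => (f x)%:E) = (fun x => (f x * 1)%:E)); last first.
  by apply/funext => x; rewrite mulr1.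
by apply: (@integrable_cpt m (fun=> 1) f r M) => //; rewrite radon_int1.
Qed.

Lemma Cc_sup (f : Rd -> R) : Cc f -> exists r M : R, [/\ 0 < r, 0 <= M,
  measurable_fun setT (f : X -> R), (forall x, `|f x| <= M) & forall x, r <= enorm x -> f x = 0].
Proof.
move=> Cf; have [M M0 fM] := Cc_bounded Cf; have [cf [r fr]] := Cf.
exists (`|r| + 1), M; split.
- by rewrite ltr_wpDl.
- exact: ltW.
- exact: continuous_measurable.
- exact: fM.
- by move=> x rx; apply: fr; rewrite (le_trans _ rx)// (le_trans (ler_norm _))// lerDl.
Qed.

Lemma integrable_Cc (m : Meas) (f : Rd -> R) : radon m -> Cc f ->
  m.-integrable setT (fun x => (f x)%:E).
Proof.
by move=> rm /Cc_sup[r [M [r0 M0 mf fM fr]]]; exact: (integrable_radon rm mf M0 fM fr).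
Qed.

Lemma le_coord_vtv (nu : vmeas) i (A : set X) : is_vmeas nu -> measurable A ->
  (\int[vbase nu]_(x in A) `|(vdens nu x ord0 i)%:E| <= vtv nu A)%E.
Proof.
move=> vnu mA; apply: lint_le => x _; first exact: abse_ge0.
by rewrite abse_EFin lee_fin coord_le_enorm.
Qed.

Lemma integrable_vCc (nu : vmeas) (f : Rd -> R) i : is_vmeas nu -> Cc f ->
  (vbase nu).-integrable setT (fun x => (f x * vdens nu x ord0 i)%:E).
Proof.
move=> vnu /Cc_sup[r [M [r0 M0 mf fM fr]]].
have [_ [mv iv]] := vnu.
apply: (@integrable_cpt (vbase nu) (fun x => vdens nu x ord0 i) f r M (mv i) mf M0 fM fr).
by apply: le_lt_trans (le_coord_vtv i vnu (measurable_B0 r)) _; exact: iv.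
Qed.

Lemma compact_ballT (r a b : R) : compact [set pt : Rd * R | enorm pt.1 <= r /\ a <= pt.2 <= b].
Proof.
have := compact_setX (@compact_enorm_le R d r) (@segment_compact R a b).
by rewrite (_ : _ `*` _ = [set pt : Rd * R | enorm pt.1 <= r /\ a <= pt.2 <= b]).
Qed.

Definition Cct (g : Rd -> R -> R) : Prop :=
  continuous (fun pt : Rd * R => g pt.1 pt.2) /\
  exists r : R, forall x t, r <= enorm x -> g x t = 0.

Lemma Cct_bound g (a b : R) : Cct g -> exists2 M : R, 0 < M &
  forall x t, a <= t <= b -> `|g x t| <= M.
Proof.
move=> [cg [r gr]].
have [M M0 H] := compact_bounded_fun (@compact_ballT r a b) (fun z _ => cg z).
exists M => // x t tab; have [xr|rx] := leP (enorm x) r; first exact: (H (x, t)).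
by rewrite gr ?normr0 ?ltW.
Qed.

Lemma Cct_Cc g t : Cct g -> Cc (fun x => g x t).
Proof.
move=> [cg [r gr]]; split; last by exists r => x; exact: gr.
apply: (@cont_comp _ _ _ (fun x : Rd => (x, t)) (fun pt : Rd * R => g pt.1 pt.2)) => //.
by apply: cont_pair; [move=> x; exact: cvg_id|exact: cont_cst].
Qed.

Lemma Cct_cont g x : Cct g -> continuous (g x).
Proof.
move=> [cg _].
apply: (@cont_comp _ _ _ (fun t : R => (x, t)) (fun pt : Rd * R => g pt.1 pt.2)) => //.
by apply: cont_pair; [exact: cont_cst|move=> t; exact: cvg_id].
Qed.

Let trunc (n : nat) (t : R) : R := (Num.truncn (t * n.+1%:R))%:R / n.+1%:R.

Let trunc_cvg t : 0 <= t -> trunc n t @[n --> \oo] --> t.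
Proof.
move=> t0; apply/cvgrPdist_lt => e e0; near=> n.
have n0 : 0 < n.+1%:R :> R by rewrite ltr0n.
have tn0 : 0 <= t * n.+1%:R by rewrite mulr_ge0.
have h : n.+1%:R^-1 < e by near: n; exact: near_infty_natSinv_lt (PosNum e0).
apply: (le_lt_trans _ h).
have -> : t - trunc n t = (t * n.+1%:R - (Num.truncn (t * n.+1%:R))%:R) / n.+1%:R.
  by rewrite /trunc; field; rewrite gt_eqF.
rewrite normrM (ger0_norm (_ : 0 <= n.+1%:R^-1)) ?invr_ge0 ?(ltW n0)//.
rewrite -[leRHS]mul1r ler_wpM2r ?invr_ge0 ?(ltW n0)//.
have /andP[h1 h2] := truncn_itv tn0.
rewrite ger0_norm ?subr_ge0// lerBlDr addrC; rewrite ltW// (lt_le_trans h2)// -natr1 //.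
Unshelve. all: by end_near. Qed.

(* Time measurability is only assumed for time-independent test functions: freeze
   the time argument on a grid and pass to the limit by dominated convergence. *)
Lemma measurable_time (m : R -> Meas) (u : R -> X -> R) (g : Rd -> R -> R) :
  (forall t, 0 < t < 1 -> measurable_fun setT (u t)) ->
  (forall t r, 0 < t < 1 -> (\int[m t]_(x in B0 r) `|(u t x)%:E| < +oo)%E) ->
  (forall f, Cc f -> measurable_fun (oitv 1) (fun t : R => (\int[m t]_x (f x * u t x)%:E)%E)) ->
  Cct g -> measurable_fun (oitv 1) (fun t : R => (\int[m t]_x (g x t * u t x)%:E)%E).
Proof.
move=> mu iu mf Cg.
have [M M0 gM] := Cct_bound 0 1 Cg; have [cg [r gr]] := Cg.
pose J n (t : R) : \bar R := (\int[m t]_x (g x (trunc n t) * u t x)%:E)%E.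
apply: (@emeasurable_fun_cvg _ _ _ _ J) => [n|t]; last first.
  rewrite /oitv/= in_itv/= => t01; have [t0 t1] := andP t01.
  apply: (@dominated_cvg _ _ _ (m t) setT measurableT
    (fun n x => (g x (trunc n t) * u t x)%:E) (fun x => (g x t * u t x)%:E)
    (fun x => (M%:E * ((fun x => `|(u t x)%:E|) \_ (B0 r)) x)%E)).
  - move=> n; apply/measurable_EFinP; apply: measurable_funM; last exact: mu.
    by apply: continuous_measurable; have [] := Cct_Cc (trunc n t) Cg.
  - move=> x _; apply: cvg_EFin; first exact: nearW.
    apply: cvgM; last exact: cvg_cst.
    by apply: (@cvg_comp _ _ _ _ (g x) _ _ _ (trunc_cvg (ltW t0))); exact: Cct_cont.
  - by move=> x _; rewrite patchE; case: ifPn => _; rewrite ?mule0.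
  - apply/integrableP; split.
      apply: emeasurable_funM; first exact: measurable_cst.
      apply/(measurable_restrictT _ _).1; first exact: measurable_B0.
      by apply: measurable_funTS; apply: measurableT_comp => //; apply/measurable_EFinP; exact: mu.
    under eq_integral => x _.
      rewrite gee0_abs; last first.
        by rewrite mule_ge0 ?lee_fin ?(ltW M0)// patchE; case: ifPn => _; rewrite ?abse_ge0.
      over.
    have := lint_scale (m t) (D := setT) (g := (fun x => `|(u t x)%:E|)%E \_ (B0 r)) measurableT (ltW M0).
    move=> H; apply: le_lt_trans (H _) _.
      by move=> x _; rewrite patchE; case: ifPn => _; rewrite ?abse_ge0.
    by rewrite -integral_mkcond lte_mul_pinfty ?lee_fin ?(ltW M0)// iu.
  - move=> n x _; rewrite patchE; case: ifPn => [_|].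
      rewrite !abse_EFin -EFinM lee_fin normrM ler_wpM2r// gM//.
      have n0 : 0 < n.+1%:R :> R by rewrite ltr0n.
      have tn0 : 0 <= t * n.+1%:R by rewrite mulr_ge0// ltW.
      have /andP[h1 _] := truncn_itv tn0.
      rewrite divr_ge0//= ler_pdivrMr// (le_trans h1)// ler_wpM2r// ltW//.
    rewrite notin_setE /B0/= => /negP; rewrite -leNgt => rx.
    by rewrite gr// mul0r normr0 mule0.
(* On each set where the grid index is constant, [J n] is the integral of a test function that does
   not depend on time. *)
pose S k := [set t : R | Num.truncn (t * n.+1%:R) = k].
have mtr k : measurable (S k `&` oitv 1).
  have n0 : 0 < n.+1%:R :> R by rewrite ltr0n.
  rewrite (_ : S k `&` oitv 1 = `[k%:R / n.+1%:R, k.+1%:R / n.+1%:R[%classic `&` oitv 1); first by apply: measurableI; exact: measurable_itv.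
  apply/seteqP; split => t [] /= h; rewrite /oitv/= !in_itv/= => t01; split => //;
    have tn0 : 0 <= t * n.+1%:R by (have [t0 _] := andP t01; rewrite mulr_ge0// ltW).
    have := truncn_itv tn0; rewrite h => /andP[h1 h2].
    by rewrite ler_pdivrMr// ltr_pdivlMr// h1 h2.
  move: h; rewrite ?in_itv/= ler_pdivrMr// ltr_pdivlMr// => h.
  exact/truncn_def.
have mk k : measurable_fun (S k `&` oitv 1) (J n).
  apply: (@eq_measurable_fun _ _ _ _ _ (fun t => (\int[m t]_x (g x (k%:R / n.+1%:R) * u t x)%:E)%E)).
    by move=> t /set_mem [/= hk _]; rewrite /J /trunc hk.
  apply: (measurable_funS _ _ (mf _ (Cct_Cc _ Cg))); first exact: measurable_itv.
  by move=> t [].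
have -> : oitv 1 = \bigcup_k (S k `&` oitv 1) :> set R.
  by apply/seteqP; split => [t t01|t [k _ []]//]; exists (Num.truncn (t * n.+1%:R)).
exact/(measurable_fun_bigcup _ mtr).
Qed.

End space_integrals.

(** * From a weak derivative in time to an increment formula *)

Section du_bois_reymond.
Context {R : realType}.
Notation leb := (@lebesgue_measure R).
Notation D := (oitv (1 : R)).
Implicit Types (a b t : R).

Lemma measurable_oitv (T : R) : measurable (oitv T).
Proof. exact: measurable_itv. Qed.

Lemma oitvE (T t : R) : oitv T t = (0 < t < T) :> Prop.
Proof. by rewrite /oitv/= in_itv. Qed.

Lemma leb_oitv_fin : (leb D < +oo)%E.
Proof. by rewrite /oitv lebesgue_measure_itv/= lte_fin ltr01 -EFinD ltry. Qed.

Lemma integrable_bounded (f : R -> R) (M : R) (A : set R) : A `<=` D -> measurable A ->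
  measurable_fun A f -> (forall t, A t -> `|f t| <= M) -> leb.-integrable A (EFin \o f).
Proof.
move=> AD mA mf fM; apply/integrableP; split; first exact/measurable_EFinP.
have M0 : 0 <= `|M| by [].
apply: (@le_lt_trans _ _ (\int[leb]_(t in A) (`|M|%:E))%E).
  apply: lint_le => t At; first exact: abse_ge0.
  by rewrite abse_EFin lee_fin (le_trans (fM t At))// ler_norm.
rewrite integral_cst// lte_mul_pinfty//.
apply: le_lt_trans leb_oitv_fin; apply: le_measure => //; rewrite inE//; exact: measurable_oitv.
Qed.

Lemma integral_dstep : (\int[leb]_(s in D) (dstep s)%:E = 1)%E.
Proof.
have : (\int[leb]_(s in `[0%R, 1%R]) (dstep s)%:E = (step 1)%:E - (step (0 : R))%:E)%E.
  apply: continuous_FTC2; first exact: ltr01.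
  - by apply: continuous_subspaceT; exact: dstep_continuous.
  - split.
    + by move=> s _; have [] := is_derive_step s.
    + by apply: cvg_at_right_filter; exact: step_continuous.
    + by apply: cvg_at_left_filter; exact: step_continuous.
  - by move=> s _; rewrite derive1E; have [_ ->] := is_derive_step s.
rewrite step_ge1// step_le0// sube0 => <-.
apply/esym; apply: (@integral_itv_bndoo _ 0 1 (fun s => (dstep s)%:E) true false).
apply/measurable_EFinP.
by apply: measurable_funTS; apply: continuous_measurable_fun; exact: dstep_continuous.
Qed.

Lemma dominated_cvg_bounded (f_ : nat -> R -> R) (f g : R -> R) :
  (forall n, measurable_fun D (f_ n)) -> (forall t, D t -> f_ n t @[n --> \oo] --> f t) ->
  leb.-integrable D (EFin \o g) -> (forall n t, D t -> `|f_ n t| <= g t) ->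
  ((\int[leb]_(t in D) (f_ n t)%:E)%E @[n --> \oo] --> (\int[leb]_(t in D) (f t)%:E)%E).
Proof.
move=> mf cf ig fg.
apply: (@dominated_cvg _ _ _ leb D (measurable_oitv 1) (fun n t => (f_ n t)%:E) (fun t => (f t)%:E) (fun t => (g t)%:E)) => //.
- by move=> n; apply/measurable_EFinP; exact: mf.
- by move=> t Dt; apply: cvg_EFin; [exact: nearW|exact: cf].
Qed.

(** Extends functions on [0, 1] to the line by their end values, so that continuity within [0, 1]
    becomes plain continuity. *)
Definition clamp (t : R) : R := Num.max 0 (Num.min t 1).

Lemma clamp_itv t : 0 <= clamp t <= 1.
Proof. by rewrite /clamp le_max lexx/= ge_max ler01 ge_min lexx orbT. Qed.

Lemma clamp_id t : 0 <= t <= 1 -> clamp t = t.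
Proof. by move=> /andP[t0 t1]; rewrite /clamp min_l// max_r. Qed.

Lemma clamp_continuous : continuous clamp.
Proof.
move=> t; apply: (@continuous_max _ _ (cst 0) (fun t => Num.min t 1)); first exact: cvg_cst.
by apply: (@continuous_min _ _ id (cst 1)); [exact: cvg_id|exact: cvg_cst].
Qed.

Lemma within_clamp (U : topologicalType) (f : R -> U) :
  {within `[0, 1], continuous f} <-> continuous (fun t => f (clamp t)).
Proof.
split.
  move=> /subspace_continuousP cf t.
  have ct : `[0%R, 1%R]%classic (clamp t) by rewrite /= in_itv/=; exact: clamp_itv.
  apply: cvg_comp (cf _ ct).
  move=> P HP; change (\forall s \near t, P (clamp s)).
  have HQ : \forall s \near t, `[0%R, 1%R]%classic (clamp s) -> P (clamp s) := @clamp_continuous t _ HP.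
  by apply: filterS HQ => s; apply; rewrite /= in_itv/=; exact: clamp_itv.
move=> cf; apply: (@subspace_eq_continuous _ _ _ (fun t => f (clamp t))).
  by move=> t; rewrite inE/= in_itv/= => t01; rewrite clamp_id.
exact: continuous_subspaceT.
Qed.

Lemma dominated_cvg_R (f_ : nat -> R -> R) (f g : R -> R) :
  (forall n, measurable_fun D (f_ n)) -> (forall t, D t -> f_ n t @[n --> \oo] --> f t) ->
  leb.-integrable D (EFin \o g) -> (forall n t, D t -> `|f_ n t| <= g t) ->
  [/\ forall n, leb.-integrable D (EFin \o f_ n), leb.-integrable D (EFin \o f) &
  (\int[leb]_(t in D) (f_ n t))%R @[n --> \oo] --> (\int[leb]_(t in D) (f t))%R].
Proof.
move=> mf cf ig fg.
have mD := measurable_oitv (1 : R).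
have In n : leb.-integrable D (EFin \o f_ n).
  apply: le_integrable ig => //; first by apply/measurable_EFinP; exact: mf.
  by move=> t Dt; rewrite lee_fin (le_trans (fg n t Dt))// ler_norm.
have mlf : measurable_fun D f by apply: measurable_fun_cvg mf cf.
have If : leb.-integrable D (EFin \o f).
  apply: le_integrable ig => //; first by apply/measurable_EFinP; exact: mlf.
  move=> t Dt; rewrite lee_fin; apply: (le_trans _ (ler_norm (g t))).
  have h : `|f_ n t| @[n --> \oo] --> `|f t| by apply: cvg_norm; exact: cf.
  rewrite -(cvg_lim _ h)//; apply: limr_le.
    exact: cvgP h.
  by apply: nearW => n; exact: fg.
split => //; have := dominated_cvg_bounded mf cf ig fg.
rewrite -[X in _ --> X]fineK; last exact: integrable_fin_num If.
exact: fine_cvg.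
Qed.

Lemma dstep_le2_norm t : `|dstep t| <= 2.
Proof. by rewrite ger0_norm ?dstep_ge0// dstep_le2. Qed.

Lemma measurable_dstep (A : set R) : measurable_fun A (@dstep R).
Proof. by apply: measurable_funTS; apply: continuous_measurable_fun; exact: dstep_continuous. Qed.

Lemma measurable_cont (A : set R) (f : R -> R) : continuous f -> measurable_fun A f.
Proof. by move=> cf; apply: measurable_funTS; exact: continuous_measurable_fun. Qed.

Variables (m h : R -> R).
Hypothesis cm : continuous m.

Lemma cont_bounded01 : exists2 M : R, 0 < M & forall t, 0 <= t <= 1 -> `|m t| <= M.
Proof.
have [M M0 H] := compact_bounded_fun (@segment_compact R 0 1) (fun t _ => @cm t).
by exists M => // t t01; apply: H; rewrite /= in_itv.
Qed.

Let cont_aff (c tau : R) : continuous (fun s : R => c + tau * s).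
Proof.
apply: contD; first exact: cont_cst.
by apply: contM; [exact: cont_cst|move=> t; exact: cvg_id].
Qed.

(** Since [dstep] has integral 1 and lives on [0, 1], this averages [m] over [c, c + eta / (n + 1)].
    Rescaling to the unit interval fixes the domain, and dominated convergence applies. *)
Lemma mollify_cvg (c eta : R) : 0 < c -> 0 < eta -> c + eta < 1 ->
  (\int[leb]_(t in D) (dstep ((t - c) / (eta / n.+1%:R)) / (eta / n.+1%:R) * m t))%R
    @[n --> \oo] --> m c.
Proof.
move=> c0 eta0 ce1; have [M M0 HM] := cont_bounded01; have mD := measurable_oitv (1 : R).
pose tau (n : nat) := eta / n.+1%:R.
have tau0 n : 0 < tau n by rewrite divr_gt0.
have tau_le n : tau n <= eta by rewrite ler_pdivrMr// ler_peMr ?(ltW eta0)// ler1n.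
have aff01 n s : D s -> 0 <= c + tau n * s <= 1.
  rewrite oitvE => /andP[s0 s1]; have a1 : 0 < tau n * s by rewrite mulr_gt0.
  have a2 : tau n * s <= eta by rewrite -[leRHS]mulr1 ler_pM ?(ltW s0) ?(ltW s1)// ltW.
  by lra.
have mf1 n : measurable_fun D (fun s => dstep s * m (c + tau n * s)).
  by apply: measurable_funM; [exact: measurable_dstep|apply: measurable_cont; exact: cont_comp].
have cf1 t : D t -> dstep t * m (c + tau n * t) @[n --> \oo] --> dstep t * m c.
  move=> Dt; apply: cvgM; first exact: cvg_cst.
  apply: (@cvg_comp _ _ _ (fun n => c + tau n * t) m); last exact: cm.
  have : c + tau n * t @[n --> \oo] --> c + eta * 0 * t.
    apply: cvgD; first exact: cvg_cst.
    apply: cvgM; last exact: cvg_cst.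
    by apply: cvgM; [exact: cvg_cst|exact: cvg_harmonic].
  by rewrite mulr0 mul0r addr0.
have ig1 : leb.-integrable D (EFin \o (fun _ : R => 2 * M)).
  by apply: (@integrable_bounded _ `|2 * M|) => // t _; exact: lexx.
have fg1 n t : D t -> `|dstep t * m (c + tau n * t)| <= 2 * M.
  by move=> Dt; rewrite normrM ler_pM// ?dstep_le2_norm// HM//; exact: aff01.
have [_ _ cv] := dominated_cvg_R mf1 cf1 ig1 fg1.
have {cv} := cv; rewrite (_ : (\int[leb]_(t in D) (dstep t * m c))%R = m c); last first.
  rewrite RintegralZr//; first by rewrite /Rintegral integral_dstep mul1r.
  by apply: (@integrable_bounded _ 2) => // [|t _]; [exact: measurable_dstep|exact: dstep_le2_norm].
apply: cvg_trans; apply: near_eq_cvg; apply: nearW => n.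
rewrite /Rintegral; congr fine.
transitivity (\int[leb]_(x in affine c (tau n) @^-1` D) (dstep x * m (affine c (tau n) x))%:E)%E.
  rewrite integral_mkcond [RHS]integral_mkcond; apply: eq_integral => s _.
  rewrite !patchE; case: ifPn => [/set_mem Ds|].
    rewrite ifT// inE/= oitvE; move: (Ds); rewrite oitvE => /andP[s0 s1].
    have a1 : 0 < tau n * s by rewrite mulr_gt0.
    have a2 : tau n * s <= eta by rewrite -[leRHS]mulr1 ler_pM ?(ltW s0) ?(ltW s1)// ltW.
    by rewrite /affine; lra.
  rewrite notin_setE oitvE => /negP; rewrite negb_and -!leNgt => s01.
  by case: ifPn => // _; rewrite dstep_0 ?mul0r//; apply/orP.
pose f t := (dstep ((t - c) / tau n) * m t)%:E.
have ef x : (dstep x * m (affine c (tau n) x))%:E = f (affine c (tau n) x).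
  by rewrite /f /affine; congr (dstep _ * _)%:E; field; rewrite gt_eqF.
transitivity (\int[leb]_(x in affine c (tau n) @^-1` D) f (affine c (tau n) x))%E.
  by apply: eq_integral => x _; exact: ef.
have mf : measurable_fun D f.
  apply/measurable_EFinP; apply: measurable_funM; last exact: measurable_cont.
  apply: measurable_cont; apply: (cont_comp _ (@dstep_continuous R)).
  by apply: contM; [apply: contB; [move=> t; exact: cvg_id|exact: cont_cst]|exact: cont_cst].
rewrite integral_affine// -integralZl//.
  by apply: eq_integral => t _; rewrite /f -EFinM; congr EFin; rewrite mulrA [_^-1 * _]mulrC.
apply: (@integrable_bounded _ (2 * M)) => //; first exact/measurable_EFinP.
move=> t; rewrite oitvE => /andP[t0 t1]; rewrite normrM ler_pM// ?dstep_le2_norm// HM//.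
by rewrite !ltW.
Qed.

Hypothesis ih : leb.-integrable D (EFin \o h).
Hypothesis weak : forall (chi chi' : R -> R) (a b : R),
  (forall t : R, is_derive t 1 chi (chi' t)) -> continuous chi' -> 0 < a -> b < 1 ->
  (forall t, t < a \/ b < t -> chi t = 0) ->
  (\int[leb]_(t in D) (chi' t * m t + chi t * h t)%:E = 0)%E.

Lemma integrable_Mcont (f : R -> R) : continuous f -> leb.-integrable D (fun t => (f t * m t)%:E).
Proof.
move=> cf; have [M M0 HM] := cont_bounded01.
have [M' M'0 HM'] := compact_bounded_fun (@segment_compact R 0 1) (fun t _ => @cf t).
apply: (@integrable_bounded (fun t => f t * m t) (M' * M)) => //; first exact: measurable_oitv.
  by apply: measurable_funM; exact: measurable_cont.
move=> t; rewrite oitvE => /andP[t0 t1]; rewrite normrM ler_pM//.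
  by apply: HM'; rewrite /= in_itv/= !ltW.
by apply: HM; rewrite !ltW.
Qed.

(** The test functions rise just after [a] and fall just after [b]; their derivatives are
    differences of mollifiers at [a] and [b], and they tend to the indicator of (a, b]. The width
    [eta] lets the fall end before time 1. *)
Lemma weak_derivative_oo a b : 0 < a -> a < b -> b < 1 ->
  m b - m a = (\int[leb]_(t in D) (((a < t)%R%:R - (b < t)%R%:R) * h t))%R.
Proof.
move=> a0 ab b1; have mD := measurable_oitv (1 : R).
pose eta := (1 - b) / 2; have eta0 : 0 < eta by rewrite divr_gt0// subr_gt0.
pose tau (n : nat) := eta / n.+1%:R.
have tau0 n : 0 < tau n by rewrite divr_gt0.
have tau_le n : tau n <= eta by rewrite ler_pdivrMr// ler_peMr ?(ltW eta0)// ler1n.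
pose st n c t := step ((t - c) / tau n).
pose dst n c t := dstep ((t - c) / tau n) / tau n.
have caff n c : continuous (fun t : R => (t - c) / tau n).
  by apply: contM; [apply: contB; [move=> t; exact: cvg_id|exact: cont_cst]|exact: cont_cst].
have cst_ n c : continuous (st n c) by apply: (cont_comp (caff n c) (@step_continuous R)).
have cdst n c : continuous (dst n c).
  by apply: contM; [exact: (cont_comp (caff n c) (@dstep_continuous R))|exact: cont_cst].
have dst_st n c t : is_derive t 1 (st n c) (dst n c t).
  have E (s : R) : - (c / tau n) + (tau n)^-1 * s = (s - c) / tau n by ring.
  have H : is_derive (- (c / tau n) + (tau n)^-1 * t) 1 step (dstep ((t - c) / tau n)).
    by rewrite E; exact: is_derive_step.
  have := is_derive_affine_comp H.
  rewrite (_ : (fun s => step _) = st n c)//.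
  by apply/funext => s; rewrite E.
have st01 n c t : 0 <= st n c t <= 1 by rewrite step_ge0 step_le1.
have st_lim c t : st n c t @[n --> \oo] --> ((c < t)%R%:R : R).
  have [tc|tc] := leP t c.
    apply: cvg_near_cst; apply: nearW => n; rewrite /st step_le0//.
    by rewrite ler_pdivrMr// mul0r subr_le0.
  apply: cvg_near_cst; near=> n; rewrite /st step_ge1// ler_pdivlMr// mul1r.
  near: n; exists (Num.truncn (eta / (t - c))) => // n /= hn.
  rewrite ler_pdivrMr// mulrC -ler_pdivrMr ?subr_gt0//; apply: ltW.
  by apply: lt_le_trans (truncnS_gt _) _; rewrite ler_nat ltnS.
pose chi n t := st n a t - st n b t.
pose chi' n t := dst n a t - dst n b t.
have chi_abs n t : `|chi n t| <= 1.
  have := st01 n a t; have := st01 n b t; rewrite /chi ler_norml; lra.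
have mh : measurable_fun D h by apply/measurable_EFinP; exact: measurable_int ih.
have cchi n : continuous (chi n) by apply: contB; exact: cst_.
have mf1 n : measurable_fun D (fun t => chi n t * h t).
  by apply: measurable_funM => //; apply: measurable_cont; exact: cchi.
have cf1 t : D t -> chi n t * h t @[n --> \oo] --> ((a < t)%R%:R - (b < t)%R%:R) * h t.
  by move=> Dt; apply: cvgM; [apply: cvgB; exact: st_lim|exact: cvg_cst].
have ig1 : leb.-integrable D (EFin \o (fun t => `|h t|)).
  by apply: integrable_norm => //; exact: measurable_oitv.
have fg1 n t : D t -> `|chi n t * h t| <= `|h t|.
  by move=> Dt; rewrite normrM -[leRHS]mul1r ler_wpM2r.
have [I1 _ L1] := dominated_cvg_R mf1 cf1 ig1 fg1.
have ca : a + eta < 1 by rewrite /eta; lra.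
have cb : b + eta < 1 by rewrite /eta; lra.
have L2 := mollify_cvg a0 eta0 ca.
have L3 := mollify_cvg (lt_trans a0 ab) eta0 cb.
have W n : (\int[leb]_(t in D) (dst n a t * m t))%R - (\int[leb]_(t in D) (dst n b t * m t))%R + (\int[leb]_(t in D) (chi n t * h t))%R = 0.
  have Ia c := integrable_Mcont (cdst n c).
  rewrite -RintegralB//; [|exact: Ia|exact: Ia].
  rewrite (_ : (\int[leb]_(x in D) (dst n a x * m x - dst n b x * m x))%R = (\int[leb]_(x in D) (chi' n x * m x))%R); last first.
    by apply: eq_Rintegral => x _; rewrite mulrBl.
  rewrite -RintegralD//; last exact: (integrable_Mcont (contB (cdst n a) (cdst n b))).
  have := @weak (chi n) (chi' n) a (b + eta).
  have dchi t : is_derive t 1 (chi n) (chi' n t).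
    have d1 := dst_st n a t; have d2 := dst_st n b t.
    by rewrite (_ : chi n = st n a - st n b)//; exact: is_deriveB.
  move=> /(_ dchi (contB (cdst n a) (cdst n b)) a0 cb) H.
  rewrite /Rintegral -[RHS]/(fine 0%E) -H.
    by [].
  move=> t [ta|bt]; rewrite /chi /st.
    by rewrite !step_le0 ?subrr// ler_pdivrMr// mul0r subr_le0; lra.
  rewrite !step_ge1 ?subrr// ler_pdivlMr// mul1r; have := tau_le n; lra.

have L : (0 : R) @[_ --> \oo] --> m a - m b + (\int[leb]_(t in D) (((a < t)%R%:R - (b < t)%R%:R) * h t))%R.
  apply: cvg_trans (cvgD (cvgB L2 L3) L1); apply: near_eq_cvg.
  by apply: nearW => n; rewrite -(W n).
have := cvg_lim (@Rhausdorff R) L; rewrite lim_cst; last exact: Rhausdorff.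
move=> /(_ eventually_filter); lra.
Unshelve. all: by end_near. Qed.

(** The end times 0 and 1 are reached by shrinking the interval from inside: [m] is continuous, and
    the integrals of [h] converge by domination. *)
Lemma weak_derivative a b : 0 <= a -> a <= b -> b <= 1 ->
  m b - m a = (\int[leb]_(t in `]a, b[) h t)%R.
Proof.
move=> a0; rewrite le_eqVlt => /predU1P[<- _|ab b1].
  by rewrite subrr set_itvoo0// Rintegral_set0.
have mD := measurable_oitv (1 : R).
have mh : measurable_fun D h by apply/measurable_EFinP; exact: measurable_int ih.
pose e (n : nat) := (b - a) / 3 / n.+1%:R.
have ba3 : 0 < (b - a) / 3 by rewrite divr_gt0// subr_gt0.
have e0 n : 0 < e n by rewrite divr_gt0.
have e3 n : e n <= (b - a) / 3 by rewrite ler_pdivrMr// ler_peMr ?(ltW ba3)// ler1n.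
have ecv : e n @[n --> \oo] --> (0 : R).
  have : e n @[n --> \oo] --> (b - a) / 3 * 0.
    by apply: cvgM; [exact: cvg_cst|exact: cvg_harmonic].
  by rewrite mulr0.
have W n : m (b - e n) - m (a + e n) =
    (\int[leb]_(t in D) (((a + e n < t)%R%:R - (b - e n < t)%R%:R) * h t))%R.
  have := e0 n; have := e3 n => h1 h2; apply: weak_derivative_oo; lra.
have mI (c : R) : measurable_fun D (fun t => (c < t)%R%:R : R).
  rewrite (_ : (fun t => _) = \1_(`]c, +oo[%classic)); last first.
    by apply/funext => t; rewrite indicE; congr ((nat_of_bool _)%:R); apply/idP/idP; rewrite inE/= in_itv/= andbT.
  by apply: measurable_indic; exact: measurable_itv.
have mf1 n : measurable_fun D (fun t => ((a + e n < t)%R%:R - (b - e n < t)%R%:R) * h t).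
  by apply: measurable_funM => //; apply: measurable_funB.
pose ind t : R := ((a < t)%R && (t < b)%R)%:R.
have cf1 t : D t -> ((a + e n < t)%R%:R - (b - e n < t)%R%:R) * h t @[n --> \oo] --> ind t * h t.
  move=> Dt; apply: cvgM; last exact: cvg_cst.
  have enear c : 0 < c -> \forall n \near \oo, e n < c.
    by move=> c0; have /cvgr_lt := ecv; apply.
  apply: cvg_near_cst; rewrite /ind.
  have [ta|ta] := leP t a.
    apply: nearW => n; have := e0 n; have := e3 n => h1 h2.
    rewrite (_ : (a + e n < t) = false) 1?(_ : (b - e n < t) = false) ?subrr//;
      apply/negbTE; rewrite -leNgt; lra.
  have [bt|bt] := leP b t.
    apply: nearW => n; have := e0 n; have := e3 n => h1 h2.
    by rewrite (_ : (a + e n < t) = true) 1?(_ : (b - e n < t) = true) ?subrr//; lra.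
  have ta' : 0 < t - a by rewrite subr_gt0.
  have bt' : 0 < b - t by rewrite subr_gt0.
  apply: filterS2 (enear _ ta') (enear _ bt') => n h1 h2.
  rewrite (_ : (a + e n < t) = true) 1?(_ : (b - e n < t) = false) ?subr0//; last lra.
  by apply/negbTE; rewrite -leNgt; lra.
have ig1 : leb.-integrable D (EFin \o (fun t => `|h t|)).
  by apply: integrable_norm => //; exact: measurable_oitv.
have fg1 n t : D t -> `|((a + e n < t)%R%:R - (b - e n < t)%R%:R) * h t| <= `|h t|.
  move=> Dt; rewrite normrM -[leRHS]mul1r ler_wpM2r//.
  by case: (_ < t)%R; case: (_ < t)%R; rewrite ?subrr ?subr0 ?sub0r ?normrN ?normr0 ?normr1 ?ler01.
have [_ _ L1] := dominated_cvg_R mf1 cf1 ig1 fg1.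
have L2 : m (b - e n) - m (a + e n) @[n --> \oo] --> m b - m a.
  apply: cvgB.
    apply: (@cvg_comp _ _ _ (fun n => b - e n) m); last exact: cm.
    have : b - e n @[n --> \oo] --> b - 0 by apply: cvgB => //; exact: cvg_cst.
    by rewrite subr0.
  apply: (@cvg_comp _ _ _ (fun n => a + e n) m); last exact: cm.
  have : a + e n @[n --> \oo] --> a + 0 by apply: cvgD => //; exact: cvg_cst.
  by rewrite addr0.
have L3 : m (b - e n) - m (a + e n) @[n --> \oo] --> (\int[leb]_(t in D) (ind t * h t))%R.
  by apply: cvg_trans L1; apply: near_eq_cvg; apply: nearW => n; rewrite W.
rewrite -(cvg_lim (@Rhausdorff R) L2) (cvg_lim (@Rhausdorff R) L3).
rewrite Rintegral_mkcond [RHS]Rintegral_mkcond; apply: eq_Rintegral => t _.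
rewrite !patchE /ind; case: ifPn => tD.
  case: ifPn => tab; first by move/set_mem: tab; rewrite /= in_itv/= => ->; rewrite mul1r.
  have -> : (a < t < b) = false.
    by apply/negP => h1; case/negP: tab; apply/mem_set; rewrite /= in_itv.
  by rewrite mul0r.
case: ifPn => // /set_mem; rewrite /= in_itv/= => /andP[h1 h2]; exfalso.
by move/negP: tD; apply; apply/mem_set; rewrite oitvE; apply/andP; split; lra.
Qed.

End du_bois_reymond.

(** * Integrability along curves and the continuity equation in integrated form *)

Section curves.
Context {R : realType} {d : nat}.
Notation Rd := 'rV[R]_d.
Notation X := (@BRd R d).
Notation Meas := ({measure set X -> \bar R}).
Notation leb := (@lebesgue_measure R).

(** The requirements of [CE] other than the equation itself. They are separated because for a glued
    pair they come first and supply the integrability with which the equation is proved. *)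
Definition curve (mu : R -> Meas) (nu : R -> @vmeas R d) : Prop :=
  (forall t, 0 <= t <= 1 -> radon (mu t)) /\
  (forall f, Cc f ->
     {within `[0, 1], continuous (fun t => \int[mu t]_x (f x)%:E)%E}) /\
  (forall t, 0 < t < 1 -> is_vmeas (nu t)) /\
  (forall f i, Cc f -> measurable_fun (oitv 1)
     (fun t : R => (\int[vbase (nu t)]_x (f x * vdens (nu t) x ord0 i)%:E)%E : \bar R)) /\
  (forall r : R, (\int[leb]_(t in oitv 1) vtv (nu t) (B0 r) < +oo)%E).

Lemma CE_curve mu nu : CE 1 mu nu -> curve mu nu.
Proof. by move=> [? [? [? [? [? _]]]]]. Qed.

Lemma Rint_EFin (m : Meas) (f : X -> R) : m.-integrable setT (EFin \o f) ->
  (\int[m]_x (f x)%:E)%E = ((\int[m]_x f x)%R)%:E.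
Proof. by move=> i; rewrite /Rintegral fineK//; exact: integrable_fin_num. Qed.

Lemma Cc_C1s (f : Rd -> R) D : C1s f D -> cpt_supp f -> Cc f.
Proof. by move=> [cf _] [r fr]; split => //; exists r. Qed.

Lemma abs_Rint_le (m : Meas) (u f : X -> R) (r M K : R) :
  measurable_fun setT u -> measurable_fun setT f -> 0 <= M -> (forall x, `|f x| <= M) ->
  (forall x, r <= enorm x -> f x = 0) ->
  (\int[m]_(x in B0 r) `|(u x)%:E| <= K%:E)%E ->
  `|(\int[m]_x (f x * u x))%R| <= M * K.
Proof.
move=> mu mf M0 fM fr mK.
have i := @integrable_cpt R d m u f r M mu mf M0 fM fr (le_lt_trans mK (ltry K)).
rewrite -lee_fin -[leLHS]/(`|(\int[m]_x (f x * u x))%R|%:E) EFin_normr_Rintegral//.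
apply: (le_trans (le_abse_integral _ _ (measurable_int _ i))) => //.
apply: (le_trans (abs_integral_cpt m mu mf M0 fM fr)).
by rewrite EFinM lee_wpmul2l// lee_fin.
Qed.

Lemma C1t_Cct (zeta Dt : Rd -> R -> R) D : C1t zeta Dt D ->
  [/\ Cct zeta, Cct Dt & forall i, Cct (D i)].
Proof.
move=> Hz; have [_ [_ [c0 [ct [cx _]]]]] := Hz; have [r r0 Hr] := C1t_supp Hz.
split; [| |move=> i].
- by split => //; exists r => x t rx; have [] := Hr x t rx.
- by split => //; exists r => x t rx; have [] := Hr x t rx.
- by split; [exact: cx|exists r => x t rx; have [_ _ h] := Hr x t rx; exact: h].
Qed.

Lemma Cct_measurable g t : Cct g -> measurable_fun setT (fun x : X => g x t).
Proof. by move=> /(@Cct_Cc R d g t)[cg _]; exact: continuous_measurable. Qed.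

Lemma integrable_contM (f g : R -> R) : continuous f -> leb.-integrable (oitv 1) (EFin \o g) ->
  leb.-integrable (oitv 1) (fun t => (f t * g t)%:E).
Proof.
move=> cf ig; have [M M0 fM] := compact_bounded_fun (@segment_compact R 0 1) (fun t _ => cf t).
have mD := @measurable_oitv R 1.
apply: (@le_integrable _ _ _ leb (oitv 1) mD _ (fun t => (M * `|g t|)%:E)).
- apply/measurable_EFinP; apply: measurable_funM; first exact: measurable_cont.
  by apply/measurable_EFinP; exact: measurable_int ig.
- move=> t; rewrite oitvE => t01; rewrite !abse_EFin lee_fin normrM [leRHS]ger0_norm.
    by rewrite ler_wpM2r// fM//= in_itv/=; lra.
  by rewrite mulr_ge0// ltW.
- apply: (@integrableZl _ _ _ leb (oitv 1) mD M (EFin \o (fun t => `|g t|))).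
  exact: integrable_norm.
Qed.

Section precurve.
Variables (mu : R -> Meas) (nu : R -> @vmeas R d).
Hypothesis H : curve mu nu.

Lemma curve_radon t : 0 <= t <= 1 -> radon (mu t).
Proof. by have [h _] := H; exact: h. Qed.

Lemma curve_cont_Cc f : Cc f -> continuous (fun t => (\int[mu (clamp t)]_x f x)%R).
Proof.
move=> Cf; have [rm [cm _]] := H; have /within_clamp c := cm f Cf.
move=> t; apply: fine_cvg; rewrite -Rint_EFin; first exact: c.
by apply: integrable_Cc => //; apply: rm; exact: clamp_itv.
Qed.

(** The ball lies under a cutoff in C_c, whose integral is continuous in time and therefore bounded
    on [0, 1]. *)
Lemma curve_mass_bound (r : R) : exists2 K : R, 0 <= K &
  forall t, 0 <= t <= 1 -> (mu t (B0 r) <= K%:E)%E.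
Proof.
pose M := `|r| + 1; have M0 : 0 < M by rewrite ltr_wpDl.
have Cf : Cc (cutoff 1 M : Rd -> R).
  by apply: Cc_C1s; [exact: C1s_cutoff|exact: cpt_supp_cutoff].
have [K K0 HK] := compact_bounded_fun (@segment_compact R 0 1) (fun t _ => curve_cont_Cc Cf (x0 := t)).
exists K; first exact: ltW.
move=> t t01; have rm := curve_radon t01.
apply: (@le_trans _ _ (\int[mu t]_x (cutoff 1 M x)%:E)%E).
  rewrite -[X in mu t X](setIT (B0 r)) -integral_indic//; last exact: measurable_B0.
  apply: lint_le => x _; first by rewrite lee_fin indicE.
  rewrite lee_fin indicE; case: (boolP (x \in _)) => [/set_mem xr|_]; last exact: cutoff_ge0.
  rewrite cutoff_1//; apply: ltW; apply: (lt_le_trans xr).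
  by rewrite (le_trans (ler_norm r))// lerDl.
rewrite (Rint_EFin (integrable_Cc rm Cf)) lee_fin (le_trans (ler_norm _))//.
by have := HK t; rewrite /= in_itv/= => /(_ t01); rewrite clamp_id.
Qed.

Lemma abs_Rint_mu (f : X -> R) (r M K t : R) : radon (mu t) ->
  measurable_fun setT f -> 0 <= M -> (forall x, `|f x| <= M) ->
  (forall x, r <= enorm x -> f x = 0) -> (mu t (B0 r) <= K%:E)%E ->
  `|(\int[mu t]_x f x)%R| <= M * K.
Proof.
move=> rm mf M0 fM fr mK.
have := @abs_Rint_le (mu t) (fun=> 1) f r M K (measurable_cst _) mf M0 fM fr.
rewrite radon_int1// => /(_ mK); rewrite (_ : (fun x => f x * 1) = f)//.
by apply/funext => x; rewrite mulr1.
Qed.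

Section test.
Variables (zeta Dt : Rd -> R -> R) (D : 'I_d -> Rd -> R -> R).
Hypothesis Hz : C1t zeta Dt D.

Lemma curve_Rint_bound g : Cct g -> exists2 K : R, 0 <= K &
  forall t, 0 <= t <= 1 -> `|(\int[mu t]_x g x t)%R| <= K.
Proof.
move=> Cg; have [_ [r gr]] := Cg; have [M M0 gM] := Cct_bound 0 1 Cg.
have [K K0 HK] := curve_mass_bound r.
exists (M * K); first by rewrite mulr_ge0// ltW.
move=> t t01; apply: (@abs_Rint_mu _ r) => //.
- exact: curve_radon.
- exact: Cct_measurable.
- exact: ltW.
- by move=> x; exact: gM.
- by move=> x; exact: gr.
- exact: HK.
Qed.

(** With the time in [zeta] frozen this is weak continuity. Unfreezing costs a Lipschitz constant in
    time, from the mean value theorem, times a bound on the mass. *)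
Lemma curve_cont : continuous (fun t => (\int[mu (clamp t)]_x zeta x (clamp t))%R).
Proof.
have [Cz CDt _] := C1t_Cct Hz; have [r r0 Hr] := C1t_supp Hz.
have [dt _] := Hz.
have [G G0 HG] := Cct_bound 0 1 CDt; have [K K0 HK] := curve_mass_bound r.
have lip x s t : 0 <= s <= 1 -> 0 <= t <= 1 -> `|zeta x s - zeta x t| <= G * `|s - t|.
  wlog st : s t / t <= s => [hw|] s01 t01.
    by have [ts|st] := leP t s; [exact: hw|rewrite distrC (distrC s); apply: hw => //; exact: ltW].
  have [|c cst ->] := @MVT_segment R (zeta x) (Dt x) t s st (fun u _ => dt x u).
    apply: continuous_subspaceT => u; apply: differentiable_continuous.
    by apply/derivable1_diffP; have [] := dt x u.
  rewrite normrM ler_wpM2r// HG//; move: cst; rewrite in_itv/=; lra.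
move=> t0; pose s0 := clamp t0; have s00 := clamp_itv t0.
have c1 := curve_cont_Cc (Cct_Cc s0 Cz) (x0 := t0).
apply/cvgrPdist_lt => e e0.
have e2 : 0 < e / 2 by rewrite divr_gt0.
have /cvgrPdist_lt/(_ _ e2) n1 := c1.
have e3 : 0 < e / (2 * (G * K + 1)) by rewrite divr_gt0// mulr_gt0// ltr_wpDl// mulr_ge0// ltW.
have /cvgrPdist_lt/(_ _ e3) n2 := @clamp_continuous R t0.
apply: filterS2 n1 n2 => t; rewrite -/s0 => h1 h2.
have st := clamp_itv t.
have iz u v : 0 <= u <= 1 -> (mu u).-integrable setT (EFin \o zeta^~ v).
  by move=> u01; apply: integrable_Cc; [exact: curve_radon|exact: Cct_Cc].
have -> : (\int[mu s0]_x zeta x s0)%R - (\int[mu (clamp t)]_x zeta x (clamp t))%R =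
  ((\int[mu s0]_x zeta x s0)%R - (\int[mu (clamp t)]_x zeta x s0)%R) +
  (\int[mu (clamp t)]_x (zeta x s0 - zeta x (clamp t)))%R.
  by rewrite RintegralB//; [ring|exact: iz|exact: iz].
apply: (le_lt_trans (ler_normD _ _)).
have : `|(\int[mu (clamp t)]_x (zeta x s0 - zeta x (clamp t)))%R| <= (G * `|s0 - clamp t|) * K.
  apply: (@abs_Rint_mu _ r).
  - exact: curve_radon.
  - by apply: measurable_funB; exact: Cct_measurable.
  - by rewrite mulr_ge0// ltW.
  - by move=> x; exact: lip.
  - by move=> x rx; have [-> _ _] := Hr x s0 rx; have [-> _ _] := Hr x (clamp t) rx; rewrite subrr.
  - exact: HK.
have : (G * `|s0 - clamp t|) * K <= e / 2.
  move: h2; rewrite ltr_pdivlMr; last by rewrite mulr_gt0// ltr_wpDl// mulr_ge0// ltW.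
  have := normr_ge0 (s0 - clamp t); have : 0 <= G * K by rewrite mulr_ge0// ltW.
  set u := `| _ |; nra.
lra.
Qed.

Lemma curve_measurable_mu g : Cct g -> measurable_fun (oitv 1) (fun t => (\int[mu t]_x g x t)%R).
Proof.
move=> Cg; have [rm _] := H.
have m1 := @measurable_time R d mu (fun _ _ => 1) g.
have : measurable_fun (oitv 1) (fun t => \int[mu t]_x (g x t * 1)%:E)%E.
  apply: m1 => //.
  - move=> t r t01; rewrite radon_int1; last by apply: rm; lra.
    by apply: rm; lra.
  - move=> f Cf; apply: (@eq_measurable_fun _ _ _ _ _ (fun t => ((\int[mu (clamp t)]_x f x)%R)%:E)).
      move=> t /set_mem; rewrite oitvE => t01; rewrite clamp_id; last lra.
      rewrite -Rint_EFin; last by apply: integrable_Cc => //; apply: rm; lra.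
      by apply: eq_integral => x _; rewrite mulr1.
    by apply/measurable_EFinP; apply: measurable_cont; exact: curve_cont_Cc.
move=> h; apply: (@measurableT_comp _ _ _ _ _ _ (@fine R)) => //.
by move: h; under eq_fun do under eq_integral do rewrite mulr1.
Qed.

Lemma curve_measurable_nu g i : Cct g ->
  measurable_fun (oitv 1) (fun t => (\int[vbase (nu t)]_x (g x t * vdens (nu t) x ord0 i))%R).
Proof.
move=> Cg; have [_ [_ [vn [mn _]]]] := H.
apply: (@measurableT_comp _ _ _ _ _ _ (@fine R)) => //.
apply: (@measurable_time R d (fun t => vbase (nu t)) (fun t x => vdens (nu t) x ord0 i) g) => //.
- by move=> t t01; have [_ [h _]] := vn _ t01; exact: h.
- move=> t r t01; have vt := vn _ t01; apply: (le_lt_trans (le_coord_vtv i vt (measurable_B0 r))).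
  by have [_ [_ h]] := vt; exact: h.
- by move=> f Cf; exact: mn.
Qed.

Definition flux t : R := \sum_i (\int[vbase (nu t)]_x (D i x t * vdens (nu t) x ord0 i))%R.

Lemma curve_integrable_nu g i : Cct g -> leb.-integrable (oitv 1)
  (fun t => ((\int[vbase (nu t)]_x (g x t * vdens (nu t) x ord0 i))%R)%:E).
Proof.
move=> Cg; have [_ [_ [vn [mn fin]]]] := H.
have [_ [r gr]] := Cg; have [M M0 gM] := Cct_bound 0 1 Cg.
apply/integrableP; split; first by apply/measurable_EFinP; exact: curve_measurable_nu.
apply: (@le_lt_trans _ _ (M%:E * \int[leb]_(t in oitv 1) vtv (nu t) (B0 r))%E); last first.
  by rewrite lte_mul_pinfty// ?lee_fin ?(ltW M0)//; exact: fin.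
have v0 t : (0 <= vtv (nu t) (B0 r))%E by apply: integral_ge0 => x _; rewrite lee_fin enorm_ge0.
apply: le_trans (@lint_scale _ _ R leb (oitv 1) (fun t => vtv (nu t) (B0 r)) M (measurable_oitv 1) (ltW M0) (fun t _ => v0 t)).
apply: lint_le => t; first by move=> _; exact: abse_ge0.
rewrite oitvE => t01; have vt := vn _ t01; have [_ [mv fv]] := vt.
have vtvfin : vtv (nu t) (B0 r) \is a fin_num.
  rewrite ge0_fin_numE; first exact: fv.
  by apply: integral_ge0 => x _; rewrite lee_fin enorm_ge0.
rewrite -(fineK vtvfin) -EFinM lee_fin.
apply: (@abs_Rint_le _ _ _ r) => //.
- exact: Cct_measurable.
- exact: ltW.
- by move=> x; apply: gM; lra.
- by move=> x; exact: gr.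
- by rewrite (fineK vtvfin); exact: le_coord_vtv (measurable_B0 r).
Qed.

Lemma curve_integrable_mu g : Cct g -> leb.-integrable (oitv 1)
  (fun t => ((\int[mu t]_x g x t)%R)%:E).
Proof.
move=> Cg; have [K K0 HK] := curve_Rint_bound Cg.
apply: (@integrable_bounded _ (fun t => (\int[mu t]_x g x t)%R) K) => //.
- exact: measurable_oitv.
- exact: curve_measurable_mu.
- by move=> t; rewrite oitvE => t01; apply: HK; lra.
Qed.

Lemma integrable_flux : leb.-integrable (oitv 1) (EFin \o flux).
Proof.
have [_ _ CD] := C1t_Cct Hz.
rewrite (_ : EFin \o flux = (fun t => \sum_i ((\int[vbase (nu t)]_x (D i x t * vdens (nu t) x ord0 i))%R)%:E)%E).
  by apply: integrable_sum => [|i _]; [exact: measurable_oitv|exact: curve_integrable_nu].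
by apply/funext => t; rewrite /flux sumEFin.
Qed.

Lemma integrable_vsum t : 0 < t < 1 ->
  (vbase (nu t)).-integrable setT (fun x => (\sum_i D i x t * vdens (nu t) x ord0 i)%:E).
Proof.
move=> t01; have [_ [_ [vn _]]] := H; have [_ _ CD] := C1t_Cct Hz.
rewrite (_ : (fun x => _) = (fun x : X => \sum_i (D i x t * vdens (nu t) x ord0 i)%:E)%E).
  by apply: integrable_sum => // i _; exact: integrable_vCc (vn _ t01) (Cct_Cc t (CD i)).
by apply/funext => x; rewrite sumEFin.
Qed.

Lemma flux_EFin t : 0 < t < 1 ->
  (\int[vbase (nu t)]_x (\sum_i D i x t * vdens (nu t) x ord0 i)%:E)%E = (flux t)%:E.
Proof.
move=> t01; have [_ [_ [vn _]]] := H; have [_ _ CD] := C1t_Cct Hz.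
under eq_integral do rewrite -sumEFin.
rewrite integral_sum//; last by move=> i; exact: integrable_vCc (vn _ t01) (Cct_Cc t (CD i)).
rewrite /flux -sumEFin; apply: eq_bigr => i _; rewrite Rint_EFin//.
exact: integrable_vCc (vn _ t01) (Cct_Cc t (CD i)).
Qed.

End test.

End precurve.

(** Testing with zeta(x, t) chi(t) makes the equation a weak derivative in time, to which
    [weak_derivative] applies. So the end times are reached although admissible test functions
    vanish near them. *)
Lemma continuity_equation_int mu nu zeta Dt D (a b : R) : CE 1 mu nu -> C1t zeta Dt D ->
  0 <= a -> a <= b -> b <= 1 ->
  (\int[mu b]_x zeta x b)%R - (\int[mu a]_x zeta x a)%R =
  (\int[leb]_(t in `]a, b[) ((\int[mu t]_x Dt x t)%R + flux nu D t))%R.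
Proof.
move=> ce Hz a0 ab b1; have cu := CE_curve ce.
have [Cz CDt CD] := C1t_Cct Hz.
pose m (t : R) := (\int[mu (clamp t)]_x zeta x (clamp t))%R.
pose h (t : R) := (\int[mu t]_x Dt x t)%R + flux nu D t.
have ih : leb.-integrable (oitv 1) (EFin \o h).
  rewrite (_ : EFin \o h = (fun t => ((\int[mu t]_x Dt x t)%R)%:E + (flux nu D t)%:E)%E)//.
  by apply: integrableD; [exact: measurable_oitv|exact: (curve_integrable_mu cu CDt)|exact: (integrable_flux cu Hz)].
have := @weak_derivative R m h (curve_cont cu Hz) ih.
rewrite -/(h _) => W; rewrite -W//; last first.
  move=> chi chi' a' b' dchi cchi' a'0 b'1 chi0.
  have [C1 pt px] := C1t_mul Hz dchi cchi' a'0 b'1 chi0.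
  have [_ [_ [vn [_ [_ ceq]]]]] := ce.
  have cchi : continuous chi.
    by move=> t; apply: differentiable_continuous; apply/derivable1_diffP; have [] := dchi t.
  have := ceq _ C1; rewrite pt px.
  have e1 t : oitv 1 t -> (\int[mu t]_x (Dt x t * chi t + zeta x t * chi' t)%:E =
      (chi t * (\int[mu t]_x Dt x t)%R + chi' t * m t)%:E)%E.
    rewrite oitvE => t01; have t01' : 0 <= t <= 1 by lra.
    have i1 : (mu t).-integrable setT (EFin \o Dt^~ t).
      by apply: integrable_Cc; [exact: (curve_radon cu)|exact: Cct_Cc].
    have i2 : (mu t).-integrable setT (EFin \o zeta^~ t).
      by apply: integrable_Cc; [exact: (curve_radon cu)|exact: Cct_Cc].
    transitivity (\int[mu t]_x ((chi t)%:E * (Dt x t)%:E + (chi' t)%:E * (zeta x t)%:E))%E.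
      by apply: eq_integral => x _; rewrite -!EFinM -EFinD mulrC (mulrC (zeta _ _)).
    rewrite integralD//; [|exact: (integrableZl _ _ i1)|exact: (integrableZl _ _ i2)].
    rewrite integralZl// integralZl// /m clamp_id// EFinD !EFinM.
    by congr (_ * _ + _ * _)%E; exact: Rint_EFin.
  have e2 t : oitv 1 t -> (\int[vbase (nu t)]_x (\sum_i D i x t * chi t * vdens (nu t) x ord0 i)%:E =
      (chi t * flux nu D t)%:E)%E.
    rewrite oitvE => t01; rewrite EFinM -(flux_EFin cu Hz t01) -integralZl//; last exact: (integrable_vsum cu Hz t01).
    by apply: eq_integral => x _; rewrite -EFinM mulr_sumr; congr EFin; apply: eq_bigr => i _; ring.
  move=> E; have {E} : (\int[leb]_(t in oitv 1) (chi t * (\int[mu t]_x Dt x t)%R + chi' t * m t)%:E +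
      \int[leb]_(t in oitv 1) (chi t * flux nu D t)%:E = 0)%E.
    rewrite -E; congr (_ + _)%E; apply: eq_integral => t /set_mem tD.
      by rewrite e1.
    by rewrite e2.
  have i1 := integrable_contM cchi (curve_integrable_mu cu CDt).
  have i2 := integrable_contM cchi (integrable_flux cu Hz).
  have i3 := integrable_Mcont (curve_cont cu Hz) cchi'.
  have i4 : leb.-integrable (oitv 1) (fun t => (chi t * (\int[mu t]_x Dt x t)%R + chi' t * m t)%:E).
    rewrite (_ : (fun t => _) = (fun t => (chi t * (\int[mu t]_x Dt x t)%R)%:E + (chi' t * m t)%:E)%E)//.
    by apply: (integrableD _ i1 i3); exact: measurable_oitv.
  have E : (\int[leb]_(t in oitv 1) ((chi t * (\int[mu t]_x Dt x t)%R + chi' t * m t)%:E + (chi t * flux nu D t)%:E) =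
      \int[leb]_(t in oitv 1) (chi t * (\int[mu t]_x Dt x t)%R + chi' t * m t)%:E +
      \int[leb]_(t in oitv 1) (chi t * flux nu D t)%:E)%E.
    by apply: (integralD _ i4 i2); exact: measurable_oitv.
  rewrite -E => <-; apply: eq_integral => t _; rewrite -EFinD /h; congr EFin; ring.
by rewrite /m !clamp_id//; lra.
Qed.

End curves.

(** * Mass conservation and moduli of continuity *)

Section variation.
Context {R : realType} {d : nat}.
Notation Rd := 'rV[R]_d.
Notation X := (@BRd R d).
Notation Meas := ({measure set X -> \bar R}).
Notation leb := (@lebesgue_measure R).
Variables (p : R) (phi : R -> Rd -> R) (gamma : Meas).
Hypotheses (p1 : 1 < p) (adm : admissible p phi) (rgamma : radon gamma).

Definition action (mu : R -> Meas) (nu : R -> @vmeas R d) : \bar R :=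
  (\int[leb]_(t in oitv 1) Phi phi gamma (mu t) (nu t))%E.

Lemma sume_const (x : \bar R) n : (0 <= x)%E -> (\sum_(i < n) x = n%:R%:E * x)%E.
Proof.
move=> x0; elim: n => [|n IH]; first by rewrite big_ord0 mul0e.
by rewrite big_ord_recr/= IH -natr1 EFinD ge0_muleDl ?mul1e// lee_fin.
Qed.

Lemma flux_bound mu nu (f : Rd -> R) D (a c e : X -> R) (b Kc Ke t : R) :
  curve mu nu -> C1s f D -> cpt_supp f -> 0 < t < 1 ->
  (forall i x, `|D i x| <= a x) -> 0 < b ->
  (forall x, 0 <= a x) -> measurable_fun setT a ->
  (forall x, 0 <= c x) -> measurable_fun setT c ->
  (forall x, 0 <= e x) -> measurable_fun setT e ->
  (forall x r w, 0 < r -> a x * enorm w <= b * phi r w + c x * r + e x) ->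
  (\int[mu t]_x (c x)%:E <= Kc%:E)%E -> (\int[gamma]_x (e x)%:E <= Ke%:E)%E ->
  (`|flux nu (fun i x _ => D i x) t|%:E <=
    d%:R%:E * (b%:E * Phi phi gamma (mu t) (nu t) + (Kc + Ke)%:E))%E.
Proof.
move=> cu C1 cs t01 Da b0 a0 ma c0 mc e0 me ptw HKc HKe.
have [_ [_ [vn _]]] := cu; have vt := vn _ t01.
have [cf [cD dD]] := C1; have [r r0 Hr] := C1s_supp C1 cs.
have CD i : Cc (D i) by split => //; exists r => x /Hr[_ ->].
rewrite -sume_const; last first.
  apply: adde_ge0; first by rewrite mule_ge0 ?(Phi_ge0 p1 adm)// lee_fin ltW.
  rewrite lee_fin addr_ge0// -lee_fin; [apply: le_trans HKc|apply: le_trans HKe];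
    by apply: integral_ge0 => x _; rewrite lee_fin.
apply: (@le_trans _ _ (\sum_(i < d) `|(\int[vbase (nu t)]_x (D i x * vdens (nu t) x ord0 i))%R|%:E)%E).
  by rewrite sumEFin lee_fin; exact: ler_norm_sum.
apply: lee_sum => i _.
have ii := integrable_vCc i vt (CD i).
rewrite EFin_normr_Rintegral//.
apply: (le_trans (le_abse_integral _ _ (measurable_int _ ii))) => //.
apply: (@le_trans _ _ (\int[vbase (nu t)]_x ((a x)%:E * `|(vdens (nu t) x ord0 i)%:E|))%E).
  apply: lint_le => x _; first exact: abse_ge0.
  by rewrite !abse_EFin -EFinM lee_fin normrM ler_wpM2r.
apply: (le_trans (Phi_bound p1 adm gamma (mu t) i vt b0 a0 ma c0 mc e0 me ptw)).
by rewrite leeD2l// EFinD leeD.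
Qed.

Lemma action_ge0 mu nu : (0 <= action mu nu)%E.
Proof. by apply: integral_ge0 => t _; exact: (Phi_ge0 p1 adm). Qed.

(** Common source of the cutoff estimate and of the modulus of continuity. The increment is at most
    the time integral of the absolute flux, which [Phi_bound] controls for each coordinate, whence
    the factor d. *)
Lemma CE_variation mu nu (f : Rd -> R) D (a c e : X -> R) (b A Kc Ke : R) :
  CE 1 mu nu -> C1s f D -> cpt_supp f ->
  (forall i x, `|D i x| <= a x) -> 0 < b ->
  (forall x, 0 <= a x) -> measurable_fun setT a ->
  (forall x, 0 <= c x) -> measurable_fun setT c ->
  (forall x, 0 <= e x) -> measurable_fun setT e ->
  (forall x r w, 0 < r -> a x * enorm w <= b * phi r w + c x * r + e x) ->
  (forall t, 0 < t < 1 -> (\int[mu t]_x (c x)%:E <= Kc%:E)%E) ->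
  (\int[gamma]_x (e x)%:E <= Ke%:E)%E ->
  (action mu nu <= A%:E)%E ->
  forall s t, 0 <= s <= 1 -> 0 <= t <= 1 ->
  `|(\int[mu t]_x f x)%R - (\int[mu s]_x f x)%R| <= d%:R * (b * A + (Kc + Ke)).
Proof.
move=> ce C1 cs Da b0 a0 ma c0 mc e0 me ptw HKc HKe HA s t.
have cu := CE_curve ce; have Hz := C1t_of_C1s C1 cs.
have K0 : 0 <= Kc + Ke.
  rewrite addr_ge0// -lee_fin; [apply: le_trans (HKc (1/2) _); last lra|apply: le_trans HKe];
    by apply: integral_ge0 => x _; rewrite lee_fin.
wlog st : s t / s <= t => [hw|] s01 t01.
  by have [ts|st] := leP s t; [exact: hw|rewrite distrC; apply: hw => //; exact: ltW].
rewrite (continuity_equation_int ce Hz) //; [|lra|lra].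
set F := flux nu _.
have ih : leb.-integrable (oitv 1) (EFin \o F) by exact: (integrable_flux cu Hz).
have sub : `]s, t[%classic `<=` (oitv 1 : set R).
  by move=> x; rewrite /= in_itv/= oitvE; lra.
rewrite (_ : (\int[leb]_(u in `]s, t[) _)%R = (\int[leb]_(u in `]s, t[) F u)%R); last first.
  apply: eq_Rintegral => u _; rewrite -[RHS]add0r; congr (_ + _).
  by rewrite /Rintegral integral0.
have ih' : leb.-integrable `]s, t[ (EFin \o F).
  by apply: integrableS ih => //; exact: measurable_oitv.
rewrite -lee_fin EFin_normr_Rintegral//.
apply: (le_trans (le_abse_integral _ _ (measurable_int _ ih'))) => //.
apply: (@le_trans _ _ (\int[leb]_(u in oitv 1) `|(F u)%:E|)%E).
  apply: ge0_subset_integral => //; first exact: measurable_oitv.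
  by apply: measurableT_comp => //; exact: measurable_int ih.
apply: (@le_trans _ _ (\int[leb]_(u in oitv 1)
    (d%:R%:E * (b%:E * Phi phi gamma (mu u) (nu u) + (Kc + Ke)%:E)))%E).
  apply: lint_le => u; first by move=> _; exact: abse_ge0.
  rewrite oitvE => u01; rewrite abse_EFin.
  by apply: (flux_bound cu C1 cs u01 Da b0 a0 ma c0 mc e0 me ptw) => //; exact: HKc.
have mD := @measurable_oitv R 1.
have P0 u : (0 <= Phi phi gamma (mu u) (nu u))%E by exact: (Phi_ge0 p1 adm).
have Pb0 u : (0 <= b%:E * Phi phi gamma (mu u) (nu u))%E.
  by rewrite mule_ge0// lee_fin ltW.
apply: le_trans (@lint_scale _ _ R leb (oitv 1) (fun u => b%:E * Phi phi gamma (mu u) (nu u) + (Kc + Ke)%:E)%E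
  d%:R mD (ler0n _ _) _) _.
  by move=> u _; rewrite adde_ge0// lee_fin.
rewrite EFinM lee_wpmul2l ?lee_fin//.
apply: le_trans (@lint_add _ _ R leb (oitv 1) (fun u => b%:E * Phi phi gamma (mu u) (nu u))%E
  (fun=> (Kc + Ke)%:E) mD (fun u _ => Pb0 u) _ (measurable_cst _)) _.
  by move=> u _; rewrite lee_fin.
rewrite [leRHS]EFinD; apply: leeD.
  apply: le_trans (@lint_scale _ _ R leb (oitv 1) (fun u => Phi phi gamma (mu u) (nu u)) b mD (ltW b0) (fun u _ => P0 u)) _.
  by rewrite EFinM lee_wpmul2l// lee_fin ltW.
rewrite integral_cst//= /oitv lebesgue_measure_itv/= lte_fin ltr01 -EFinD subr0.
by rewrite -EFinM mulr1.
Qed.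

Definition tail (kappa M : R) : \bar R :=
  (\int[gamma]_(x in [set x : X | (M < enorm x)%R]) (Num.max 1 (enorm x) `^ (- kappa))%:E)%E.

Lemma measurable_maxpow (r : R) : measurable_fun setT (fun x : X => Num.max 1 (enorm x) `^ r).
Proof.
have m : measurable_fun setT (fun x : X => Num.max 1 (enorm x)).
  by apply: measurable_maxr => //; exact: measurable_enorm.
exact: (measurableT_comp (@measurable_powR R r) m).
Qed.

Lemma tail_cvg (kappa eta : R) : (mtilde (- kappa) gamma < +oo)%E -> 0 < eta ->
  exists2 M : R, 0 < M & forall M', M <= M' -> (tail kappa M' <= eta%:E)%E.
Proof.
move=> fin eta0.
pose g (x : X) := (Num.max 1 (enorm x) `^ (- kappa))%:E.
have mg : measurable_fun setT g by apply/measurable_EFinP; exact: measurable_maxpow.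
have g0 x : (0 <= g x)%E by rewrite lee_fin powR_ge0.
pose S (M : R) := [set x : X | M < enorm x].
have mS M : measurable (S M).
  rewrite (_ : S M = (@enorm R d : X -> R) @^-1` `]M, +oo[%classic).
    by rewrite -[X in measurable X]setTI; apply: measurable_enorm.
  by apply/seteqP; split => x; rewrite /S/= in_itv/= andbT.
pose fn (n : nat) x := (g x * (\1_(S n%:R) x)%:E)%E.
have mfn n : measurable_fun setT (fn n).
  by apply: emeasurable_funM => //; apply/measurable_EFinP; exact: measurable_indic.
have ig : gamma.-integrable setT g.
  by apply/integrableP; split => //; under eq_integral do rewrite gee0_abs//.
have c0 x : fn n x @[n --> \oo] --> (0 : \bar R).
  apply: cvg_near_cst; near=> n; rewrite /fn indicE (_ : (x \in S n%:R) = false) ?mule0//.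
  apply/negbTE/negP => /set_mem; rewrite /S/=; apply/negP; rewrite -leNgt.
  near: n; exists (Num.truncn (enorm x)).+1 => // n /= hn.
  by apply/ltW; apply: lt_le_trans (truncnS_gt _) _; rewrite ler_nat.
have dom : \forall x \ae gamma, forall n, setT x -> (`|fn n x| <= g x)%E.
  apply: aeW => x n _; rewrite /fn abseM !gee0_abs ?lee_fin ?indicE ?powR_ge0//.
  by case: (_ \in _); rewrite ?mulr1// mulr0 powR_ge0.
have [_ _ L] := dominated_convergence measurableT mfn (measurable_cst (0 : \bar R))
   (aeW _ (fun x _ => c0 x)) ig dom.
rewrite integral0 in L.
have tE n : tail kappa n%:R = (\int[gamma]_x fn n x)%E.
  rewrite /tail integral_mkcond epatch_indic; apply: eq_integral => x _.
  by rewrite /fn.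
have /fine_cvgP[L1 /cvgrPdist_lt/(_ _ eta0) L2] := L.
have [N _ HN] := filterI L1 L2.
exists N.+1%:R => // M' NM; have [h1] := HN N (leqnn N).
rewrite /= sub0r normrN => h2.
apply: (@le_trans _ _ (tail kappa N%:R)).
  apply: ge0_subset_integral => //; [exact: mS|exact: mS| | |].
  - by apply: measurable_funTS.
  - by move=> x _; rewrite lee_fin powR_ge0.
  move=> x; rewrite /=; apply: le_lt_trans; apply: le_trans NM.
  by rewrite ler_nat.
rewrite /= in h1; rewrite tE -(fineK h1) lee_fin; apply: le_trans (ler_norm _) _; exact: ltW.
Unshelve. all: by end_near.
Qed.

End variation.

(** * Variation of the cutoff mass and conservation of total mass *)

Section mass.
Context {R : realType} {d : nat}.
Notation Rd := 'rV[R]_d.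
Notation X := (@BRd R d).
Notation Meas := ({measure set X -> \bar R}).
Notation leb := (@lebesgue_measure R).
Variables (p : R) (phi : R -> Rd -> R) (gamma : Meas).
Hypotheses (p1 : 1 < p) (adm : admissible p phi) (rgamma : radon gamma).

(** An integer at least p, so that the cutoff is a natural power of a C^1 function. *)
Definition cexp : nat := (Num.truncn p).+1.

Lemma p_le_cexp : p <= cexp%:R. Proof. by apply: ltW; exact: truncnS_gt. Qed.

Lemma cexp_gt1 : (1 < cexp)%N.
Proof. by rewrite -(@ltr_nat R); exact: lt_le_trans p1 p_le_cexp. Qed.

(* cutoff = y^p for y := ramp^(k/p), and k >= p makes the gradient at most C y^(p-1) / M *)
Lemma ramp_powR M (x : Rd) :
  let y := ramp M x `^ (cexp%:R / p) in
  [/\ 0 <= y <= 1, y `^ p = cutoff cexp M x & ramp M x ^+ cexp.-1 <= y `^ (p - 1)].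
Proof.
move=> y; have k1 := cexp_gt1; have pk := p_le_cexp.
have p0 : 0 < p := lt_trans ltr01 p1.
have r0 := ramp_ge0 M x; have r1 := ramp_le1 M x.
have kp0 : 0 <= cexp%:R / p by rewrite divr_ge0// ltW.
split.
- rewrite powR_ge0/=; move: r0; rewrite le_eqVlt => /predU1P[r0|r0].
    by rewrite /y -r0 powR0 ?ler01// gt_eqF// divr_gt0.
  by rewrite -(powRr0 (ramp M x)); apply: ger_powR => //; rewrite r0.
- by rewrite -powRrM divfK ?gt_eqF// powR_mulrn.
- move: r0; rewrite le_eqVlt => /predU1P[r0|r0].
    rewrite /y -r0 expr0n; case: eqP => [k0|_]; last exact: powR_ge0.
    by move: k1; rewrite -ltnS -[cexp]prednK// k0.
  rewrite /y -powRrM -powR_mulrn ?(ltW r0)//; apply: ger_powR; first by rewrite r0.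
  rewrite -subn1 natrB; last exact: ltnW.
  rewrite mulrBr divfK ?gt_eqF// mulr1 lerD2l lerN2.
  by rewrite ler_pdivlMr// mul1r.
Qed.

Lemma is_kappa_gt0 kappa : is_kappa p phi kappa -> 0 < kappa.
Proof.
move=> [[th [/andP[t1 _] [_ ->]]]|[_ ->]]; apply: divr_gt0; rewrite ?subr_gt0//; exact: lt_trans ltr01 p1.
Qed.

(** The gradient of the cutoff lives in M < |x| < 2 M, where [phi_tail] applies with y^p equal to
    the cutoff. The mass term is at most [K], and there M^(-kappa) is comparable to |x|^(-kappa), so
    that the remainder is a [gamma]-tail. *)
Lemma cutoff_variation kappa delta : is_kappa p phi kappa -> (mtilde (- kappa) gamma < +oo)%E ->
  0 < delta -> exists2 M0 : R, 0 < M0 & forall M, M0 <= M -> forall mu nu A K,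
  CE 1 mu nu -> (action phi gamma mu nu <= A%:E)%E ->
  (forall t, 0 <= t <= 1 -> (\int[mu t]_x cutoff cexp M x)%R <= K) ->
  forall s t, 0 <= s <= 1 -> 0 <= t <= 1 ->
  `|(\int[mu t]_x cutoff cexp M x)%R - (\int[mu s]_x cutoff cexp M x)%R| <= delta * (A + K + 1).
Proof.
move=> Hk fin d0; have k0 := is_kappa_gt0 Hk.
(* The bound obtained is d (8 k) dl (A + K + 1), and this [dl] brings it below delta (A + K + 1).
   The added 1 keeps the denominator positive when d = 0. *)
pose k := cexp; pose dl := delta / (d%:R * (8 * k%:R) + 1).
have den0 : 0 < d%:R * (8 * k%:R) + 1 :> R by rewrite ltr_wpDl.
have dl0 : 0 < dl by rewrite divr_gt0.
have [C [R0 [C0 R00 HT]]] := phi_tail p1 adm Hk dl0.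
have B0 : 0 < C * 2 `^ kappa + 1 by rewrite ltr_wpDl// mulr_ge0// powR_ge0.
have eta0 : 0 < dl / (C * 2 `^ kappa + 1) by rewrite divr_gt0.
have [M1 M10 HM1] := tail_cvg fin eta0.
exists (Num.max (Num.max R0 M1) 1); first by rewrite lt_max ltr01 orbT.
move=> M; rewrite !ge_max => /andP[/andP[R0M M1M] M1'] mu nu A K ce HA HK s t s01 t01.
have M0 : 0 < M by lra.
have cu := CE_curve ce.
have ck1 := cexp_gt1; have ck0 : (0 < cexp)%N by exact: ltnW.
pose S := [set x : X | M < enorm x].
have mS : measurable S.
  rewrite (_ : S = (@enorm R d : X -> R) @^-1` `]M, +oo[%classic).
    by rewrite -[X in measurable X]setTI; apply: measurable_enorm.
  by apply/seteqP; split => x; rewrite /S/= in_itv/= andbT.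
(* [a] dominates the gradient: the indicator removes |x| <= M, and the power of the ramp vanishes
   for |x| >= 2 M. The factor 2^kappa in [e] pays for replacing M by |x| <= 2 M. *)
pose a (x : X) := 8 * k%:R * cutoff cexp.-1 M x / M * \1_S x.
pose c (x : X) := 8 * k%:R * dl * cutoff cexp M x.
pose e (x : X) := 8 * k%:R * (C * 2 `^ kappa) * (Num.max 1 (enorm x) `^ (- kappa) * \1_S x).
have mcut j : measurable_fun setT (cutoff j M : X -> R).
  by apply: continuous_measurable; have [] := @C1s_cutoff R d j M.
have k8 : 0 <= 8 * k%:R :> R by rewrite mulr_ge0.
have i01 x : 0 <= \1_S x :> R by rewrite indicE.
have Kc t' : 0 <= t' <= 1 -> (\int[mu t']_x (c x)%:E <= (8 * k%:R * dl * K)%:E)%E.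
  move=> t'01; rewrite /c; under eq_integral do rewrite EFinM.
  have ic : (mu t').-integrable setT (EFin \o (cutoff cexp M : X -> R)).
    apply: integrable_Cc; first exact: (curve_radon cu).
    by apply: Cc_C1s; [exact: C1s_cutoff|exact: cpt_supp_cutoff].
  rewrite integralZl//; rewrite Rint_EFin// -EFinM lee_fin ler_wpM2l ?HK//.
  by rewrite mulr_ge0// ltW.
have Ke : (\int[gamma]_x (e x)%:E <= (8 * k%:R * dl)%:E)%E.
  rewrite /e; under eq_integral do rewrite EFinM.
  rewrite ge0_integralZl//; first last.
  - by rewrite lee_fin !mulr_ge0// powR_ge0.
  - by move=> x _; rewrite lee_fin mulr_ge0// powR_ge0.
  - apply/measurable_EFinP; apply: measurable_funM; first exact: measurable_maxpow.
    exact: measurable_indic.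
  apply: (@le_trans _ _ ((8 * k%:R * (C * 2 `^ kappa))%:E * tail gamma kappa M)%E).
    rewrite lee_wpmul2l//; first by rewrite lee_fin !mulr_ge0// powR_ge0.
    rewrite /tail [leRHS]integral_mkcond epatch_indic.
    by under [leRHS]eq_integral do rewrite -EFinM.
  apply: (@le_trans _ _ ((8 * k%:R * (C * 2 `^ kappa))%:E * (dl / (C * 2 `^ kappa + 1))%:E)%E).
    by rewrite lee_wpmul2l ?HM1// lee_fin !mulr_ge0// powR_ge0.
  rewrite -EFinM lee_fin -[leLHS]mulrA ler_wpM2l// mulrA ler_pdivrMr//; have : 0 <= C * 2 `^ kappa by rewrite mulr_ge0// powR_ge0.
  nra.
have b0 : 0 < 8 * k%:R * dl by rewrite !mulr_gt0// ltr0n.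
have c0 x : 0 <= c x by rewrite mulr_ge0 ?(ltW b0)// cutoff_ge0.
have e0 x : 0 <= e x by rewrite !mulr_ge0// powR_ge0.
have := @CE_variation R d p phi gamma p1 adm mu nu (cutoff cexp M) (dcutoff cexp M) a c e
  (8 * k%:R * dl) A (8 * k%:R * dl * K) (8 * k%:R * dl) ce (@C1s_cutoff R d cexp M)
  (cpt_supp_cutoff ck0 M0).
have Da i x : `|dcutoff cexp M i x| <= a x.
  rewrite /a indicE; case: (boolP (x \in S)) => [_|/negP xS]; last first.
    rewrite mulr0 dcutoff_0 ?normr0//; left; rewrite leNgt; apply/negP => h.
    by apply: xS; apply/mem_set.
  by rewrite mulr1; exact: dcutoff_le.
have a0 x : 0 <= a x by rewrite !mulr_ge0 ?cutoff_ge0// invr_ge0 ltW.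
have ma : measurable_fun setT a.
  by apply: measurable_funM; [do 2 apply: measurable_funM => //|exact: measurable_indic].
have mc : measurable_fun setT c by apply: measurable_funM => //; exact: mcut.
have me : measurable_fun setT e.
  apply: measurable_funM => //; apply: measurable_funM; [exact: measurable_maxpow|exact: measurable_indic].
have ptw x r w : 0 < r -> a x * enorm w <= 8 * k%:R * dl * phi r w + c x * r + e x.
  move=> r0; have ph := phi_ge0 adm w r0.
  have rhs0 : 0 <= 8 * k%:R * dl * phi r w + c x * r.
    by apply: addr_ge0; apply: mulr_ge0 => //; exact: ltW.
  case: (boolP (x \in S)) => [xS|xS]; last first.
    rewrite /a indicE (negbTE xS) mulr0 mul0r; exact: addr_ge0.
  have [x2|x2] := leP (2 * M) (enorm x).
    have -> : a x = 0 by rewrite /a cutoff_0 ?mulr0 ?mul0r// -ltnS prednK.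
    by rewrite mul0r; exact: addr_ge0.
  have [y01 yp yp1] := ramp_powR M x.
  rewrite /a /e indicE xS !mulr1.
  apply: (@le_trans _ _ (8 * k%:R * (dl * phi r w + dl * cutoff cexp M x * r + C * M `^ (- kappa)))).
    have -> : 8 * k%:R * cutoff cexp.-1 M x / M * enorm w = 8 * k%:R * (cutoff cexp.-1 M x / M * enorm w) by ring.
    rewrite ler_wpM2l// -yp; apply: le_trans (HT M _ r w R0M y01 r0).
    by rewrite mulrAC ler_wpM2r ?invr_ge0 ?(ltW M0)// ler_wpM2r ?enorm_ge0.
  have -> : 8 * k%:R * dl * phi r w + c x * r + 8 * k%:R * (C * 2 `^ kappa) * Num.max 1 (enorm x) `^ (- kappa)
     = 8 * k%:R * (dl * phi r w + dl * cutoff cexp M x * r + C * (2 `^ kappa * Num.max 1 (enorm x) `^ (- kappa))).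
    by rewrite /c; ring.
  rewrite ler_wpM2l// lerD2l ler_wpM2l//.
  have -> : M `^ (- kappa) = 2 `^ kappa * (2 * M) `^ (- kappa).
    by rewrite powRM ?(ltW M0)// mulrA -powRD ?subrr ?powRr0 ?mul1r//; apply/implyP => /eqP; rewrite pnatr_eq0.
  rewrite ler_wpM2l ?powR_ge0// !powRN lef_pV2 ?posrE ?powR_gt0 ?mulr_gt0// ?lt_max ?ltr01//.
  apply: ge0_ler_powR; rewrite ?nnegrE ?le_max ?ler01//; [exact: ltW|rewrite mulr_ge0//; exact: ltW|].
  by rewrite ge_max (ltW x2) andbT; lra.
have Kc' t' : 0 < t' < 1 -> (\int[mu t']_x (c x)%:E <= (8 * k%:R * dl * K)%:E)%E.
  by move=> h; apply: Kc; lra.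
move=> /(_ Da b0 a0 ma c0 mc e0 me ptw Kc' Ke HA s t s01 t01) H.
apply: le_trans H _.
have KA : 0 <= A + K + 1.
  have : 0 <= A by rewrite -lee_fin; apply: le_trans HA; exact: (action_ge0 gamma p1 adm).
  have : 0 <= K by apply: le_trans (HK t t01); apply: Rintegral_ge0 => x _; exact: cutoff_ge0.
  lra.
have -> : 8 * k%:R * dl * A + (8 * k%:R * dl * K + 8 * k%:R * dl) = 8 * k%:R * dl * (A + K + 1) by ring.
rewrite mulrA ler_wpM2r//.
have -> : d%:R * (8 * k%:R * dl) = d%:R * (8 * k%:R) * delta / (d%:R * (8 * k%:R) + 1) by rewrite /dl; ring.
rewrite ler_pdivrMr//.
have : 0 <= d%:R * (8 * k%:R) :> R by rewrite mulr_ge0.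
nra.
Qed.

Lemma probm_cutoff_le (m : Meas) M : probm m -> (\int[m]_x cutoff cexp M x)%R <= 1.
Proof.
move=> pm; have mc : measurable_fun setT (cutoff cexp M : X -> R).
  by apply: continuous_measurable; have [] := @C1s_cutoff R d cexp M.
have i1 : m.-integrable setT (EFin \o (cutoff cexp M : X -> R)).
  apply: (@le_integrable _ _ _ m setT measurableT _ (fun=> 1%:E)).
  - exact/measurable_EFinP.
  - by move=> x _; rewrite !abse_EFin lee_fin normr1 ger0_norm ?cutoff_ge0 ?cutoff_le1.
  - apply/integrableP; split => //; rewrite abse1 integral_cst// mul1e.
    by rewrite pm ltry.
rewrite -lee_fin -Rint_EFin//; apply: (@le_trans _ _ (\int[m]_x 1%:E)%E).
  by apply: lint_le => x _; rewrite lee_fin ?cutoff_ge0 ?cutoff_le1.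
by rewrite integral_cst// mul1e pm.
Qed.

Lemma measure_le_cutoff (m : Meas) M : radon m -> 0 < M ->
  (m (B0 M) <= ((\int[m]_x cutoff cexp M x)%R)%:E)%E.
Proof.
move=> rm M0; rewrite -Rint_EFin; last first.
  apply: integrable_Cc => //; apply: Cc_C1s; first exact: C1s_cutoff.
  by apply: cpt_supp_cutoff => //; exact: ltnW cexp_gt1.
rewrite -[X in m X](setIT (B0 M)) -integral_indic//; last exact: measurable_B0.
apply: lint_le => x _; first by rewrite lee_fin indicE.
rewrite lee_fin indicE; case: (boolP (x \in _)) => [/set_mem xr|_]; last exact: cutoff_ge0.
by rewrite cutoff_1//; exact: ltW.
Qed.

Lemma cutoff_le_measure (m : Meas) M :
  radon m -> 0 < M -> (((\int[m]_x cutoff cexp M x)%R)%:E <= m setT)%E.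
Proof.
move=> rm M0; rewrite -Rint_EFin; last first.
  apply: integrable_Cc => //; apply: Cc_C1s; first exact: C1s_cutoff.
  by apply: cpt_supp_cutoff => //; exact: ltnW cexp_gt1.
rewrite -[leRHS]mul1e -(integral_cst m measurableT 1).
by apply: lint_le => x _; rewrite lee_fin ?cutoff_ge0 ?cutoff_le1.
Qed.

(** Removes the a priori bound [K] of [cutoff_variation]. The maximal cutoff mass is attained at a
    time [u] by continuity. From [s] to [u] with delta = 1/2, it is at most 1 + (A + max + 1) / 2,
    hence at most the explicit [K] below; the second use has delta = eps / (A + K + 1). *)
Lemma cutoff_variation_prob kappa A eps : is_kappa p phi kappa ->
  (mtilde (- kappa) gamma < +oo)%E -> 0 <= A -> 0 < eps ->
  exists2 M0 : R, 0 < M0 & forall M, M0 <= M -> forall mu nu,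
  CE 1 mu nu -> (action phi gamma mu nu <= A%:E)%E ->
  forall s t, 0 <= s <= 1 -> 0 <= t <= 1 -> probm (mu s) ->
  `|(\int[mu t]_x cutoff cexp M x)%R - (\int[mu s]_x cutoff cexp M x)%R| <= eps.
Proof.
move=> Hk fin A0 e0.
have h0 : (0 : R) < 1 / 2 by [].
have [M1 M10 HM1] := cutoff_variation Hk fin h0.
pose K := 2 * (1 + (A + 1)).
have K0 : 0 < A + K + 1 by rewrite /K; lra.
have e1 : 0 < eps / (A + K + 1) by rewrite divr_gt0.
have [M2 M20 HM2] := cutoff_variation Hk fin e1.
exists (Num.max M1 M2); first by rewrite lt_max M10.
move=> M; rewrite ge_max => /andP[M1M M2M] mu nu ce HA s t s01 t01 ps.
have cu := CE_curve ce.
have M0 : 0 < M by exact: lt_le_trans M10 M1M.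
have Cf : Cc (cutoff cexp M : Rd -> R).
  by apply: Cc_C1s; [exact: C1s_cutoff|apply: cpt_supp_cutoff => //; exact: ltnW cexp_gt1].
have [u u01 Hu] := EVT_max ler01 (continuous_subspaceT (curve_cont_Cc cu Cf)).
rewrite in_itv/= in u01.
have {}Hu v : 0 <= v <= 1 -> (\int[mu v]_x cutoff cexp M x)%R <= (\int[mu u]_x cutoff cexp M x)%R.
  by move=> v01; have := Hu v; rewrite in_itv/= !clamp_id//; apply.
have HK v : 0 <= v <= 1 -> (\int[mu v]_x cutoff cexp M x)%R <= K.
  move=> v01; apply: le_trans (Hu v v01) _.
  have := HM1 M M1M mu nu A _ ce HA Hu s u s01 u01.
  have := probm_cutoff_le M ps; rewrite ler_norml /K => h1 /andP[_]; lra.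
have := HM2 M M2M mu nu A K ce HA HK s t s01 t01.
by rewrite divfK// gt_eqF.
Qed.

(** At every large radius the cutoff masses at the two times differ by at most e. Balls lie under
    cutoffs and exhaust the space, so the total masses agree. *)
Lemma probm_curve kappa mu nu s t : is_kappa p phi kappa ->
  (mtilde (- kappa) gamma < +oo)%E -> CE 1 mu nu -> (action phi gamma mu nu < +oo)%E ->
  0 <= s <= 1 -> 0 <= t <= 1 -> probm (mu s) -> probm (mu t).
Proof.
move=> Hk fin ce act s01 t01 ps; have cu := CE_curve ce.
have afin : action phi gamma mu nu \is a fin_num by rewrite ge0_fin_numE//; exact: (action_ge0 gamma p1 adm).
have A0 : 0 <= fine (action phi gamma mu nu) by rewrite fine_ge0//; exact: (action_ge0 gamma p1 adm).
have HA : (action phi gamma mu nu <= (fine (action phi gamma mu nu))%:E)%E by rewrite fineK.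
have rs := curve_radon cu s01; have rt := curve_radon cu t01.
have Bl (m : Meas) : (m (B0 n%:R) @[n --> \oo] --> m setT)%E.
  rewrite -bigcup_B0; apply: nondecreasing_cvg_mu.
  - by move=> i; exact: measurable_B0.
  - by rewrite bigcup_B0.
  - move=> i j ij; apply/subsetPset => x; rewrite /B0/= => /lt_le_trans; apply.
    by rewrite ler_nat.
have near_large (M0 : R) : \forall n \near \oo, M0 <= n%:R.
  exists (Num.truncn M0).+1 => // n /= hn.
  by apply/ltW; apply: lt_le_trans (truncnS_gt _) _; rewrite ler_nat.
rewrite /probm; apply/eqP; rewrite eq_le; apply/andP; split.
- apply/lee_addgt0Pr => e e0; have [M0 M00 HM] := cutoff_variation_prob Hk fin A0 e0.
  rewrite -(cvg_lim (@ereal_hausdorff R) (Bl (mu t))); apply: lime_le.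
    by apply/cvg_ex; eexists; exact: Bl.
  apply: filterS2 (near_large M0) (near_large 1) => n hn n1.
  have n0 : (0 : R) < n%:R by lra.
  apply: (le_trans (measure_le_cutoff rt n0)); rewrite -EFinD lee_fin.
  have := HM _ hn _ _ ce HA s t s01 t01 ps; rewrite ler_norml => /andP[_].
  have := probm_cutoff_le n%:R ps; lra.
- apply/lee_subgt0Pr => e e0; have [M0 M00 HM] := cutoff_variation_prob Hk fin A0 e0.
  rewrite leeBlDr// -ps -(cvg_lim (@ereal_hausdorff R) (Bl (mu s))); apply: lime_le.
    by apply/cvg_ex; eexists; exact: Bl.
  apply: filterS2 (near_large M0) (near_large 1) => n hn n1.
  have n0 : (0 : R) < n%:R by lra.
  apply: (le_trans (measure_le_cutoff rs n0)).
  apply: (@le_trans _ _ (((\int[mu t]_x cutoff cexp n%:R x)%R)%:E + e%:E)%E).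
    rewrite -EFinD lee_fin.
    have := HM _ hn _ _ ce HA s t s01 t01 ps; rewrite ler_norml => /andP[+ _]; lra.
  by rewrite leeD2r//; exact: cutoff_le_measure.
Qed.

End mass.

(** * Consequences for the distance: unit mass, moduli of continuity, narrow convergence *)

Section wasserstein.
Context {R : realType} {d : nat}.
Notation Rd := 'rV[R]_d.
Notation X := (@BRd R d).
Notation Meas := ({measure set X -> \bar R}).
Notation leb := (@lebesgue_measure R).
Variables (p : R) (phi : R -> Rd -> R) (gamma : Meas).
Hypotheses (p1 : 1 < p) (adm : admissible p phi) (rgamma : radon gamma).

Lemma Wdist_curve mu0 mu1 (e : R) : 0 < e -> (Wdist p phi gamma mu0 mu1 < e%:E)%E ->
  exists mu nu, CE_from_to 1 mu0 mu1 mu nu /\ (action phi gamma mu nu < (e `^ p)%:E)%E.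
Proof.
move=> e0; rewrite /Wdist; set S := [set a | _] => H.
have p0 : 0 < p := lt_trans ltr01 p1.
have S0 : (0 <= ereal_inf S)%E.
  by apply: le_ereal_inf_tmp => _ [mu [nu [_ ->]]]; exact: (action_ge0 gamma p1 adm).
have : (ereal_inf S < (e `^ p)%:E)%E.
  rewrite ltNge; apply/negP => h; move: H; apply/negP; rewrite -leNgt.
  have -> : e%:E = ((e `^ p)%:E `^ p^-1)%E.
    by rewrite poweR_EFin -powRrM divff ?gt_eqF// powRr1// ltW.
  apply: gt0_ler_poweR => //; first by rewrite invr_ge0 ltW.
  - by rewrite in_itv/= leey andbT lee_fin powR_ge0.
  - by rewrite in_itv/= leey andbT.
move=> /ereal_inf_lt[_ [mu [nu [ce ->]]]] h.
by exists mu, nu.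
Qed.

Lemma Wdist_le mu0 mu1 mu nu (e : R) : 0 <= e -> CE_from_to 1 mu0 mu1 mu nu ->
  (action phi gamma mu nu <= (e `^ p)%:E)%E -> (Wdist p phi gamma mu0 mu1 <= e%:E)%E.
Proof.
move=> e0 ce act; have p0 : 0 < p := lt_trans ltr01 p1.
rewrite /Wdist; set S := [set a | _].
have -> : e%:E = ((e `^ p)%:E `^ p^-1)%E.
  by rewrite poweR_EFin -powRrM divff ?gt_eqF// powRr1.
have h : (ereal_inf S <= (e `^ p)%:E)%E.
  by apply: ereal_inf_le; exists (action phi gamma mu nu) => //; exists mu, nu.
have S0 : (0 <= ereal_inf S)%E.
  by apply: le_ereal_inf_tmp => _ [mu' [nu' [_ ->]]]; exact: (action_ge0 gamma p1 adm).
apply: gt0_ler_poweR => //; first by rewrite invr_ge0 ltW.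
- by rewrite in_itv/= leey andbT.
- by rewrite in_itv/= leey andbT lee_fin powR_ge0.
Qed.

Lemma Wdist_ge0 mu0 mu1 : (0 <= Wdist p phi gamma mu0 mu1)%E.
Proof. exact: poweR_ge0. Qed.

Lemma CE_endpoints mu0 mu1 mu nu (f : X -> R) : CE_from_to 1 mu0 mu1 mu nu ->
  (\int[mu 0]_x f x = \int[mu0]_x f x)%R /\ (\int[mu 1]_x f x = \int[mu1]_x f x)%R.
Proof.
move=> [_ H]; rewrite /Rintegral.
by split; congr fine; apply: eq_measure_integral => A mA _; have [] := H A mA.
Qed.

Lemma probm_radon (m : Meas) : probm m -> radon m.
Proof.
move=> pm r; apply: (@le_lt_trans _ _ (m setT)); last by rewrite pm ltry.
by apply: le_measure; rewrite ?inE//; exact: measurable_B0.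
Qed.

(** Replacing f by a C^1 function costs eps / 4 at each of the two times. For that function,
    [phi_base] with weight [S] bounds the increment by a part of order 1 / S, made at most eps / 4
    by the choice of [S], and a multiple of the action, made at most eps / 4 by the choice of
    eta. *)
Lemma action_modulus (f : Rd -> R) eps : Cc f -> 0 < eps ->
  exists2 eta : R, 0 < eta & forall mu nu, CE 1 mu nu ->
  (forall t, 0 <= t <= 1 -> probm (mu t)) -> (action phi gamma mu nu <= eta%:E)%E ->
  forall s t, 0 <= s <= 1 -> 0 <= t <= 1 ->
  `|(\int[mu t]_x f x)%R - (\int[mu s]_x f x)%R| <= eps.
Proof.
move=> Cf e0; have e4 : 0 < eps / 4 by rewrite divr_gt0.
have [g [D [C1 cs Hg]]] := C1s_dense Cf e4.
have Cg := Cc_C1s C1 cs.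
have [r r0 Hr] := C1s_supp C1 cs.
have [cg [cD _]] := C1.
have [G G0 HG] : exists2 G : R, 0 < G & forall i x, `|D i x| <= G.
  have CD i : Cc (D i) by split; [exact: cD|exists r => x /Hr[_ ->]].
  have /choice[M HM] : forall i, exists M : R, 0 < M /\ forall x, `|D i x| <= M.
    by move=> i; have [M M0 h] := Cc_bounded (CD i); exists M.
  exists (1 + \sum_i M i).
    by rewrite ltr_wpDr// sumr_ge0// => i _; have [/ltW] := HM i.
  move=> i x; have [_ h] := HM i; apply: le_trans (h x) _.
  rewrite (bigD1 i)//= addrCA lerDl addr_ge0// sumr_ge0// => j _.
  by have [/ltW] := HM j.
have [c c0 Hc] := phi_base p1 adm.
pose B := fine (gamma (B0 r)).
have Bg : gamma (B0 r) = B%:E.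
  by rewrite fineK// ge0_fin_numE.
have B0' : 0 <= B by rewrite fine_ge0.
pose S := (d%:R * (G * c * (1 + B)) + 1) / (eps / 4).
have num0 : 0 <= d%:R * (G * c * (1 + B)) by rewrite !mulr_ge0 ?(ltW G0) ?(ltW c0)// addr_ge0.
have S0 : 0 < S by rewrite divr_gt0// ltr_wpDl.
pose b := G * c * S `^ (p - 1).
have b0 : 0 < b by rewrite !mulr_gt0// powR_gt0.
have db0 : 0 < d%:R * b + 1 by rewrite ltr_wpDl// mulr_ge0// ltW.
exists (eps / 4 / (d%:R * b + 1)); first by rewrite divr_gt0.
move=> mu nu ce pm act s t s01 t01.
have mB := @measurable_B0 R d r.
have i01 x : 0 <= \1_(B0 r) x :> R by rewrite indicE.
pose a (x : X) := G * \1_(B0 r) x.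
pose cc (x : X) := G * c / S * \1_(B0 r) x.
have k0 : 0 <= G * c / S by rewrite !mulr_ge0 ?(ltW G0) ?(ltW c0)// invr_ge0 ltW.
have icc (m : Meas) : (\int[m]_x (cc x)%:E = (G * c / S)%:E * m (B0 r))%E.
  rewrite /cc; under eq_integral do rewrite EFinM.
  rewrite ge0_integralZl ?lee_fin//; last first.
    by apply/measurable_EFinP; exact: measurable_indic.
  by rewrite integral_indic// setIT.
have H1 u : 0 < u < 1 -> (\int[mu u]_x (cc x)%:E <= (G * c / S)%:E)%E.
  move=> u01; rewrite icc -[leRHS]mule1 lee_wpmul2l ?lee_fin//.
  rewrite -(pm u); last lra.
  by apply: le_measure; rewrite ?inE.
have H2 : (\int[gamma]_x (cc x)%:E <= (G * c / S * B)%:E)%E by rewrite icc Bg -EFinM.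
have Da i x : `|D i x| <= a x.
  rewrite /a indicE; case: (boolP (x \in _)) => [_|/negP xS]; first by rewrite mulr1.
  rewrite mulr0; have [|_ ->] := Hr x; last by rewrite normr0.
  by rewrite leNgt; apply/negP => h; apply: xS; apply/mem_set.
have a0 x : 0 <= a x by rewrite mulr_ge0// ltW.
have cc0 x : 0 <= cc x by rewrite mulr_ge0.
have mi : measurable_fun setT (\1_(B0 r) : X -> R) by exact: measurable_indic.
have ma : measurable_fun setT a by exact: measurable_funM.
have mc : measurable_fun setT cc by exact: measurable_funM.
have ptw x u w : 0 < u -> a x * enorm w <= b * phi u w + cc x * u + cc x.
  move=> u0; have ph := phi_ge0 adm w u0.
  rewrite /a /cc indicE; case: (_ \in _); last first.
    by rewrite !mulr0 !mul0r !addr0 mulr_ge0// ltW.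
  rewrite !mulr1; apply: le_trans (ler_wpM2l (ltW G0) (Hc S u w S0 u0)) _.
  by rewrite le_eqVlt; apply/predU1P; left; rewrite /b; ring.
have V := @CE_variation R d p phi gamma p1 adm mu nu g D a cc cc b _ (G * c / S) (G * c / S * B)
  ce C1 cs Da b0 a0 ma cc0 mc cc0 mc ptw H1 H2 act s t s01 t01.
have V' : `|(\int[mu t]_x g x)%R - (\int[mu s]_x g x)%R| <= eps / 2.
  apply: le_trans V _; rewrite mulrDr.
  have : d%:R * (b * (eps / 4 / (d%:R * b + 1))) <= eps / 4.
    rewrite [leLHS](_ : _ = d%:R * b * (eps / 4) / (d%:R * b + 1)); last by ring.
    rewrite ler_pdivrMr//; have : 0 <= d%:R * b by rewrite mulr_ge0// ltW.
    nra.
  have : d%:R * (G * c / S + G * c / S * B) <= eps / 4.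
    rewrite [leLHS](_ : _ = d%:R * (G * c * (1 + B)) / S); last by ring.
    have -> : eps / 4 = (d%:R * (G * c * (1 + B)) + 1) / S.
      by apply: (mulIf (lt0r_neq0 S0)); rewrite divfK ?gt_eqF// /S mulrC divfK ?gt_eqF.
    by rewrite ler_wpM2r ?invr_ge0 ?(ltW S0)// lerDl.
  lra.
have W u : 0 <= u <= 1 -> `|(\int[mu u]_x f x)%R - (\int[mu u]_x g x)%R| <= eps / 4.
  move=> u01; have ru := probm_radon (pm u u01).
  have i1 := integrable_Cc ru Cf; have i2 := integrable_Cc ru Cg.
  rewrite -RintegralB//; have i3 := integrableB measurableT i1 i2.
  rewrite -lee_fin EFin_normr_Rintegral//.
  apply: (le_trans (le_abse_integral _ _ (measurable_int _ i3))) => //.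
  apply: (@le_trans _ _ (\int[mu u]_x (eps / 4)%:E)%E).
    by apply: lint_le => x _; [exact: abse_ge0|rewrite abse_EFin lee_fin].
  by rewrite integral_cst// (pm u u01) mule1.
have := W s s01; have := W t t01; move: V'; rewrite !ler_norml; lra.
Qed.

Lemma Wdist_probm kappa sigma mu : is_kappa p phi kappa -> (mtilde (- kappa) gamma < +oo)%E ->
  probm sigma -> (Wdist p phi gamma mu sigma < +oo)%E -> probm mu.
Proof.
move=> Hk fin ps W; set w := Wdist p phi gamma mu sigma in W.
have w0 : (0 <= w)%E by exact: Wdist_ge0.
have wf : w \is a fin_num by rewrite ge0_fin_numE.
have e0 : 0 < fine w + 1 by rewrite ltr_wpDl// fine_ge0.
have We : (w < (fine w + 1)%:E)%E by rewrite -[X in (X < _)%E](fineK wf) lte_fin ltrDl.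
have [mu_ [nu [[ce H] act]]] := Wdist_curve e0 We.
have [H0 H1] := H _ measurableT; rewrite /probm -H0.
apply: (probm_curve p1 adm Hk fin ce (lt_trans act (ltry _)) (s := 1)); rewrite ?lexx ?ler01//.
by rewrite /probm H1.
Qed.

Lemma Wdist_modulus kappa (f : Rd -> R) eps : is_kappa p phi kappa ->
  (mtilde (- kappa) gamma < +oo)%E -> Cc f -> 0 < eps ->
  exists2 eta : R, 0 < eta & forall mu0 mu1, probm mu0 -> (Wdist p phi gamma mu0 mu1 < eta%:E)%E ->
  `|(\int[mu1]_x f x)%R - (\int[mu0]_x f x)%R| <= eps.
Proof.
move=> Hk fin Cf e0; have [eta eta0 H] := action_modulus Cf e0.
exists (eta `^ p^-1); first by rewrite powR_gt0.
move=> mu0 mu1 pm W; have [mu [nu [ce act]]] := Wdist_curve (powR_gt0 _ eta0) W.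
have [<- <-] := CE_endpoints f ce; have [ce' EP] := ce.
have act' : (action phi gamma mu nu <= eta%:E)%E.
  by move: act; rewrite -powRrM mulVf ?powRr1 ?(ltW eta0) ?gt_eqF ?(lt_trans ltr01 p1)//; exact: ltW.
have z01 : 0 <= (0 : R) <= 1 by rewrite lexx ler01.
apply: (H mu nu) => //; last by rewrite lexx ler01.
move=> t t01; apply: (probm_curve p1 adm Hk fin ce' (le_lt_trans act' (ltry _)) z01 t01).
by rewrite /probm (EP _ measurableT).1.
Qed.

Lemma probm_integrable (m : Meas) (f : X -> R) M : probm m -> measurable_fun setT f ->
  (forall x, `|f x| <= M) -> m.-integrable setT (EFin \o f).
Proof.
move=> pm mf fM; apply: (@le_integrable _ _ _ m setT measurableT _ (fun=> M%:E)).
- exact/measurable_EFinP.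
- by move=> x _; rewrite !abse_EFin lee_fin; apply: le_trans (fM x) (ler_norm _).
- apply/integrableP; split => //; rewrite abse_EFin integral_cst// pm mule1.
  by rewrite ltry.
Qed.

Lemma probm_Rint_le (m : Meas) (f g : X -> R) M : probm m -> measurable_fun setT f ->
  measurable_fun setT g -> (forall x, `|f x| <= M) -> (forall x, `|f x| <= g x) -> (forall x, g x <= M) ->
  `|(\int[m]_x f x)%R| <= (\int[m]_x g x)%R.
Proof.
move=> pm mf mg fM fg gM; have i1 := probm_integrable pm mf fM.
have i2 : m.-integrable setT (EFin \o g).
  by apply: (@probm_integrable m g M pm mg) => x; rewrite ger0_norm//; exact: le_trans (fg x).
rewrite -lee_fin EFin_normr_Rintegral// -Rint_EFin//.
apply: (le_trans (le_abse_integral _ _ (measurable_int _ i1))) => //.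
by apply: lint_le => x _; [exact: abse_ge0|rewrite abse_EFin lee_fin].
Qed.

Lemma cutoff_tight (m : Meas) delta : probm m -> 0 < delta -> exists M0 : R, 0 < M0 /\
  forall M, M0 <= M -> 1 - delta <= (\int[m]_x cutoff (cexp p) M x)%R.
Proof.
move=> pm d0; have rm := probm_radon pm.
have Bl : (m (B0 n%:R) @[n --> \oo] --> m setT)%E.
  rewrite -bigcup_B0; apply: nondecreasing_cvg_mu.
  - by move=> i; exact: measurable_B0.
  - by rewrite bigcup_B0.
  - move=> i j ij; apply/subsetPset => x; rewrite /B0/= => /lt_le_trans; apply.
    by rewrite ler_nat.
rewrite pm in Bl; have /fine_cvgP[_ /cvgrPdist_le/(_ _ d0)[N _ HN]] := Bl.
exists N.+1%:R; split => // M NM.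
have M0 : 0 < M by apply: lt_le_trans NM.
have h := HN N (leqnn N); rewrite /= ler_norml in h.
have bf : m (B0 N%:R) \is a fin_num by rewrite ge0_fin_numE.
apply: (@le_trans _ _ (fine (m (B0 N%:R)))); first by lra.
rewrite -lee_fin (fineK bf); apply: (le_trans _ (measure_le_cutoff p rm M0)).
apply: le_measure; rewrite ?inE; [exact: measurable_B0|exact: measurable_B0|].
move=> x; rewrite /B0/= => /lt_le_trans; apply; apply: le_trans NM.
by rewrite ler_nat.
Qed.

(** One cutoff carries all but [dl] of the limit mass and, being in C_c, all but 3/2 dl of the mass
    of [mun n] for large n. Times the cutoff, f is in C_c; the rest of f is bounded by M on the
    remaining mass. *)
Lemma vague_narrow (mun : nat -> Meas) (mu : Meas) : (forall n, probm (mun n)) -> probm mu ->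
  (forall f, Cc f -> (\int[mun n]_x f x)%R @[n --> \oo] --> (\int[mu]_x f x)%R) ->
  narrow_cvg mun mu.
Proof.
move=> pmn pm V f [cf [M0 fM0]].
pose M := `|M0| + 1; have Mp : 0 < M by rewrite ltr_wpDl.
have fM x : `|f x| <= M.
  by apply: le_trans (fM0 x) _; rewrite (le_trans (ler_norm M0))// lerDl.
have mf : measurable_fun setT (f : X -> R) by exact: continuous_measurable.
rewrite (_ : (fun n => _) = (fun n => ((\int[mun n]_x f x)%R)%:E)); last first.
  by apply/funext => n; rewrite Rint_EFin//; exact: probm_integrable fM.
rewrite Rint_EFin; last exact: probm_integrable fM.
apply: cvg_EFin; first exact: nearW.
apply/cvgrPdist_le => eps e0.
pose dl := eps / (4 * M); have dl0 : 0 < dl by rewrite divr_gt0// mulr_gt0.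
have [Rr [Rr0 HR]] := cutoff_tight pm dl0.
pose k := cexp p; have k0 : (0 < k)%N by [].
pose chi : X -> R := cutoff k Rr.
have cchi : continuous (cutoff k Rr : Rd -> R) by have [] := @C1s_cutoff R d k Rr.
have mchi : measurable_fun setT chi by exact: continuous_measurable.
have Cchi : Cc (cutoff k Rr : Rd -> R) by split => //; exact: cpt_supp_cutoff.
have Cfc : Cc (fun x : Rd => f x * cutoff k Rr x).
  split; first exact: contM.
  by have [r h] := @cpt_supp_cutoff R d k Rr k0 Rr0; exists r => x rx; rewrite h// mulr0.
have chi1 x : `|chi x| <= 1 by rewrite ger0_norm ?cutoff_ge0 ?cutoff_le1.
have rest (m : Meas) : probm m ->
    `|(\int[m]_x f x)%R - (\int[m]_x (f x * chi x))%R| <= M * (1 - (\int[m]_x chi x)%R).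
  move=> pmm; have i1 := probm_integrable pmm mf fM.
  have i2 : m.-integrable setT (EFin \o (fun x => f x * chi x)).
    apply: (@probm_integrable m _ M) => //; first exact: measurable_funM.
    by move=> x; rewrite normrM -[leRHS]mulr1 ler_pM.
  have i3 := probm_integrable pmm mchi chi1.
  rewrite -RintegralB//.
  have -> : M * (1 - (\int[m]_x chi x)%R) = (\int[m]_x (M * (1 - chi x)))%R.
    rewrite RintegralZl//; last first.
      apply: (@probm_integrable m (fun x => 1 - chi x) 1) => //; first exact: measurable_funB.
      move=> x; rewrite ger0_norm ?subr_ge0 ?cutoff_le1// gerBl cutoff_ge0//.
    rewrite RintegralB//; last by apply: (@probm_integrable m (fun=> 1) 1) => // x; rewrite normr1.
    have one : (\int[m]_x (1 : R))%R = 1.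
      by have /= E := integral_cst m measurableT (1 : R)%:E; rewrite /Rintegral E mul1e pmm.
    by rewrite one.
  apply: (@probm_Rint_le m _ _ M) => //.
  - by apply: measurable_funB => //; exact: measurable_funM.
  - by apply: measurable_funM => //; exact: measurable_funB.
  - move=> x; rewrite -{1}(mulr1 (f x)) -mulrBr normrM -[leRHS]mulr1 ler_pM//.
    rewrite ger0_norm ?subr_ge0 ?cutoff_le1// gerBl cutoff_ge0//.
  - move=> x; rewrite -{1}(mulr1 (f x)) -mulrBr normrM ler_pM//.
    by rewrite ger0_norm ?subr_ge0 ?cutoff_le1.
  - by move=> x; rewrite -[leRHS]mulr1 ler_wpM2l ?(ltW Mp)// gerBl cutoff_ge0.
have e8 : 0 < eps / 8 by rewrite divr_gt0.
have dl8 : 0 < dl / 2 by rewrite divr_gt0.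
have /cvgrPdist_le/(_ _ e8) n1 := V _ Cfc.
have /cvgrPdist_le/(_ _ dl8) n2 := V _ Cchi.
apply: filterS2 n1 n2 => n h1 h2.
have r1 := rest _ pm; have r2 := rest _ (pmn n).
have h3 := HR Rr (lexx _).
have Mdl : M * dl = eps / 4 by rewrite /dl; field; rewrite gt_eqF.
move: h1 h2 r1 r2 h3; rewrite /= -/k -/chi.
set I1 := (\int[mu]_x f x)%R; set I2 := (\int[mun n]_x f x)%R.
set I3 := (\int[mu]_x (f x * _))%R; set I4 := (\int[mun n]_x (f x * _))%R.
rewrite !ler_norml.
set I5 := (\int[mu]_x _)%R; set I6 := (\int[mun n]_x _)%R.
move=> q1 q2 q3 q4 q5.
have : M * (1 - I5) <= M * dl by rewrite ler_wpM2l ?(ltW Mp)//; lra.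
have : M * (1 - I6) <= M * (3 / 2 * dl) by rewrite ler_wpM2l ?(ltW Mp)//; lra.
lra.
Qed.

Lemma Wdist_narrow kappa (mun : nat -> Meas) mu : is_kappa p phi kappa ->
  (mtilde (- kappa) gamma < +oo)%E -> (forall n, probm (mun n)) -> probm mu ->
  (fun n => Wdist p phi gamma (mun n) mu) @ \oo --> 0%E -> narrow_cvg mun mu.
Proof.
move=> Hk fin pmn pm W; apply: vague_narrow => // f Cf.
apply/cvgrPdist_le => eps e0; have [eta eta0 H] := Wdist_modulus Hk fin Cf e0.
have /fine_cvgP[F /cvgrPdist_lt/(_ _ eta0) W2] := W.
apply: filterS2 F W2 => n h1 h2; apply: H => //.
rewrite -(fineK h1) lte_fin; apply: le_lt_trans h2; rewrite sub0r normrN.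
exact: ler_norm.
Qed.

End wasserstein.

(** * The Daniell integral *)

(** One enumeration serves every array: in [upper_sum] the same rearrangement is applied to
    functions and to their values under [L]. *)
Lemma nneseries_pair {R : realType} : exists e : nat -> nat * nat,
  forall a : nat -> nat -> \bar R, (forall i j, 0 <= a i j)%E ->
  (\sum_(n <oo) a (e n).1 (e n).2 = \sum_(i <oo) \sum_(j <oo) a i j)%E.
Proof.
have /card_esym/ppcard_eqP[f] := card_nat2.
exists f => a a0; rewrite nneseries_esumT; last by move=> n; exact: a0.
rewrite -(@reindex_esum _ _ _ setT setT f (fun k => a k.1 k.2)); last exact: bij.
rewrite nneseries_esumT; last by move=> n; exact: nneseries_ge0.
rewrite (eq_esum (b := fun i => (\esum_(j in setT) a i j)%E)); last first.
  by move=> i _; rewrite nneseries_esumT.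
rewrite (esum_esum (J := fun=> setT))//; congr esum.
by apply/seteqP; split.
Qed.

Section open_sets.
Context {R : realType} {d : nat}.
Notation Rd := 'rV[R]_d.

(** The functions are min(1, n dist(x, complement of U)). A point of U gets the value 1 at a finite
    stage, so that telescoping sums of increments reach the indicator exactly. *)
Lemma open_approx (U : set Rd) : open U -> exists h : nat -> Rd -> R,
  [/\ forall n, continuous (h n), (forall x, h 0%N x = 0), (forall n x, 0 <= h n x <= 1),
      (forall n x, h n x <= h n.+1 x) & (forall n x, ~ U x -> h n x = 0) /\
      (forall x, U x -> exists n, h n x = 1)].
Proof.
move=> oU.
have [g [cg g0 gU gN]] : exists g : Rd -> R, [/\ continuous g, (forall x, 0 <= g x),
    (forall x, U x -> 0 < g x) & (forall x, ~ U x -> g x = 0)].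
  have [[a0 a0U]|US] := pselect (exists a, (~` U) a); last first.
    exists (fun=> 1); split => // [|x nU]; first exact: cont_cst.
    by exfalso; apply: US; exists x.
  have fin x : @edist_inf R Rd (~` U) x \is a fin_num.
    rewrite ge0_fin_numE ?edist_inf_ge0 //; apply: le_lt_trans.
      by apply: ereal_inf_lbound; exists a0.
    rewrite -ge0_fin_numE ?edist_ge0 //; apply/edist_finP => /=; exists (`|x - a0| + 1) => //.
    by rewrite -ball_normE /ball_/= ltrDl.
  exists (fun x => fine (@edist_inf R Rd (~` U) x)); split.
  - move=> x; have : @edist_inf R Rd (~` U) y @[y --> x] --> (fine (@edist_inf R Rd (~` U) x))%:E.
      by rewrite fineK//; exact: edist_inf_continuous.
    by move/fine_cvg.
  - by move=> x; apply: fine_ge0; exact: edist_inf_ge0.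
  - move=> x Ux; rewrite -lte_fin fineK//.
    have /nbhs_ballP[e /= e0 He] := open_nbhs_nbhs (conj oU Ux).
    apply: (@lt_le_trans _ _ e%:E); first by rewrite lte_fin.
    apply: le_ereal_inf_tmp => _ [a Ua <-]; rewrite leNgt; apply/negP => /edist_lt_ball h.
    by apply: Ua; exact: He.
  - by move=> x nU; rewrite edist_inf0.
exists (fun n x => Num.min 1 (n%:R * g x)); split.
- move=> n x; apply: (@continuous_min _ _ (fun=> 1) (fun x => n%:R * g x)); first exact: cont_cst.
  by apply: contM => //; exact: cont_cst.
- by move=> x; rewrite mul0r min_r.
- move=> n x; rewrite le_min ler01 mulr_ge0//=; by rewrite ge_min lexx.
- move=> n x; rewrite le_min !ge_min lexx/=; apply/orP; right.
  by rewrite ler_wpM2r// ler_nat.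
- split => [n x nU|x Ux]; first by rewrite gN// mulr0 min_r.
  exists (Num.truncn (g x)^-1).+1; rewrite min_l//.
  by rewrite -ler_pdivrMr ?gU// mul1r ltW// truncnS_gt.
Qed.

End open_sets.

Section Cc_algebra.
Context {R : realType} {d : nat}.
Notation Rd := 'rV[R]_d.
Implicit Types f g : Rd -> R.

Lemma CcM f g : Cc f -> continuous g -> Cc (fun x => f x * g x).
Proof.
by move=> [cf [r fr]] cg; split; [exact: contM|exists r => x /fr ->; rewrite mul0r].
Qed.

Lemma Cc_lin (a b : R) f g : Cc f -> Cc g -> Cc (fun x => a * f x + b * g x).
Proof.
move=> [cf [r fr]] [cg [s gs]]; split.
  by apply: contD; apply: contM => //; exact: cont_cst.
by exists (Num.max r s) => x; rewrite ge_max => /andP[/fr -> /gs ->]; rewrite !mulr0 addr0.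
Qed.

Lemma Cc_min f (c : R) : Cc f -> 0 <= c -> Cc (fun x => Num.min (f x) c).
Proof.
move=> [cf [r fr]] c0; split; last by exists r => x /fr ->; rewrite min_l.
by move=> x; apply: (@continuous_min _ _ f (fun=> c)); [exact: cf|exact: cont_cst].
Qed.

Lemma Cc0 : Cc (fun _ : Rd => 0 : R).
Proof. by split; [exact: cont_cst|exists 0]. Qed.

End Cc_algebra.

Section daniell.
Context {R : realType} {d : nat}.
Notation Rd := 'rV[R]_d.
Notation X := (@BRd R d).
Notation Meas := ({measure set X -> \bar R}).
Variable L : (Rd -> R) -> R.
Hypothesis Llin : forall a b f g, Cc f -> Cc g -> L (fun x => a * f x + b * g x) = a * L f + b * L g.
Hypothesis Lpos : forall f, Cc f -> (forall x, 0 <= f x) -> 0 <= L f.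

Definition Ccp (f : Rd -> R) := Cc f /\ forall x, 0 <= f x.

Lemma Cc_functional0 : L (fun _ => 0) = 0.
Proof.
have := Llin 0 0 (@Cc0 R d) (@Cc0 R d).
by rewrite !mul0r !addr0.
Qed.

Lemma Cc_functionalD f g : Cc f -> Cc g -> L (fun x => f x + g x) = L f + L g.
Proof.
move=> Cf Cg; have := Llin 1 1 Cf Cg; rewrite !mul1r => <-; congr L.
by apply/funext => x; rewrite !mul1r.
Qed.

Lemma Cc_functionalB f g : Cc f -> Cc g -> L (fun x => f x - g x) = L f - L g.
Proof.
move=> Cf Cg; have := Llin 1 (-1) Cf Cg; rewrite mul1r mulN1r => <-; congr L.
by apply/funext => x; rewrite mul1r mulN1r.
Qed.

Lemma Cc_functionalZ a f : Cc f -> L (fun x => a * f x) = a * L f.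
Proof.
move=> Cf; have := Llin a 0 Cf Cf; rewrite mul0r addr0 => <-; congr L.
by apply/funext => x; rewrite mul0r addr0.
Qed.

Lemma CcD (f g : Rd -> R) : Cc f -> Cc g -> Cc (fun x => f x + g x).
Proof.
move=> Cf Cg; rewrite (_ : (fun x => _) = (fun x => 1 * f x + 1 * g x)); first exact: Cc_lin.
by apply/funext => x; rewrite !mul1r.
Qed.

Lemma CcB (f g : Rd -> R) : Cc f -> Cc g -> Cc (fun x => f x - g x).
Proof.
move=> Cf Cg; rewrite (_ : (fun x => _) = (fun x => 1 * f x + -1 * g x)); first exact: Cc_lin.
by apply/funext => x; rewrite mul1r mulN1r.
Qed.

Lemma CcZ (a : R) (f : Rd -> R) : Cc f -> Cc (fun x => a * f x).
Proof.
move=> Cf; rewrite (_ : (fun x => _) = (fun x => a * f x + 0 * f x)); first exact: Cc_lin.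
by apply/funext => x; rewrite mul0r addr0.
Qed.

Lemma le_Cc_functional f g : Cc f -> Cc g -> (forall x, f x <= g x) -> L f <= L g.
Proof.
move=> Cf Cg fg; rewrite -subr_ge0 -Cc_functionalB//; apply: Lpos; first exact: CcB.
by move=> x; rewrite subr_ge0.
Qed.

Lemma Cc_functional_sum (F : nat -> Rd -> R) n : (forall k, Cc (F k)) ->
  Cc (fun x => \sum_(0 <= k < n) F k x) /\ L (fun x => \sum_(0 <= k < n) F k x) = \sum_(0 <= k < n) L (F k).
Proof.
move=> CF; elim: n => [|n [IH1 IH2]].
  rewrite big_geq//; have -> : (fun x => \sum_(0 <= k < 0) F k x) = (fun=> 0).
    by apply/funext => x; rewrite big_geq.
  by split; [exact: Cc0|exact: Cc_functional0].
have -> : (fun x => \sum_(0 <= k < n.+1) F k x) = (fun x => \sum_(0 <= k < n) F k x + F n x).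
  by apply/funext => x; rewrite big_nat_recr.
by split; [exact: CcD|rewrite Cc_functionalD// IH2 big_nat_recr].
Qed.

Definition majorizes (g : Rd -> \bar R) (F : nat -> Rd -> R) :=
  (forall k, Ccp (F k)) /\ forall x, (g x <= \sum_(k <oo) (F k x)%:E)%E.

(** The Daniell upper integral. Majorants are series rather than finite sums, which is what makes it
    countably subadditive. *)
Definition upper (g : Rd -> \bar R) : \bar R :=
  ereal_inf [set v | exists2 F, majorizes g F & v = (\sum_(k <oo) (L (F k))%:E)%E].

Lemma upper_ge0 g : (0 <= upper g)%E.
Proof.
apply: le_ereal_inf_tmp => _ [F [CF _] ->]; apply: nneseries_ge0 => k _ _.
by rewrite lee_fin; apply: Lpos; have [] := CF k.
Qed.

Lemma le_upper g h : (forall x, (g x <= h x)%E) -> (upper g <= upper h)%E.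
Proof.
move=> gh; apply: le_ereal_inf => _ [F [CF HF] ->]; exists F => //; split => // x.
exact: le_trans (gh x) (HF x).
Qed.

(** Near-optimal series for the [G j], with errors e / 2^(j+1), are merged into a single series. *)
Lemma upper_sum (g : Rd -> \bar R) (G : nat -> Rd -> \bar R) :
  (forall x, (g x <= \sum_(j <oo) G j x)%E) -> (forall j x, (0 <= G j x)%E) ->
  (upper g <= \sum_(j <oo) upper (G j))%E.
Proof.
move=> gG G0; have [[i ioo]|] := pselect (exists i, upper (G i) = +oo%E).
  rewrite (eseries_pinfty _ _ ioo) ?leey// => n _.
  by rewrite -ltNye (lt_le_trans _ (upper_ge0 _)).
rewrite -forallNE => Goo.
suff add2e (e : {posnum R}) : (upper g <= \sum_(i <oo) upper (G i) + e%:num%:E)%E.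
  by apply/lee_addgt0Pr => _/posnumP[].
rewrite (le_trans _ (epsilon_trick _ _ _))//; last by move=> n; exact: upper_ge0.
have /choice[F HF] : forall n, exists F, majorizes (G n) F /\
    (\sum_(k <oo) (L (F k))%:E <= upper (G n) + (e%:num / (2 ^ n.+1)%:R)%:E)%E.
  move=> n; have en : 0 < e%:num / (2 ^ n.+1)%:R by [].
  have fn : upper (G n) \is a fin_num.
    by rewrite ge0_fin_numE ?upper_ge0// ltey; apply/eqP/Goo.
  have [x [F mF ->] h] := lb_ereal_inf_adherent en fn.
  by exists F; split => //; exact: ltW.
have [e' He'] := @nneseries_pair R.
apply: (@le_trans _ _ (\sum_(i <oo) \sum_(j <oo) (L (F i j))%:E)%E); last first.
  apply: lee_nneseries => [i _ _|i _]; last by have [] := HF i.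
  apply: nneseries_ge0 => j _ _; rewrite lee_fin.
  by have [[H _] _] := HF i; have [h1 h2] := H j; exact: Lpos.
rewrite -He'; last first.
  by move=> i j; rewrite lee_fin; have [[H _] _] := HF i; have [h1 h2] := H j; exact: Lpos.
apply: ereal_inf_lbound; exists (fun n => F (e' n).1 (e' n).2) => //; split.
  by move=> k; have [[H _] _] := HF (e' k).1; exact: H.
move=> x; apply: le_trans (gG x) _.
rewrite (He' (fun i j => (F i j x)%:E)); last first.
  by move=> i j; rewrite lee_fin; have [[H _] _] := HF i; have [h1 h2] := H j; exact: h2.
by apply: lee_nneseries => [i _ _|i _]; [exact: G0|have [[_ H] _] := HF i].
Qed.

Lemma upper_le_series g F : majorizes g F -> (upper g <= \sum_(k <oo) (L (F k))%:E)%E.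
Proof. by move=> H; apply: ereal_inf_lbound; exists F. Qed.

Lemma upper_le_Cc_functional f g : Ccp f -> (forall x, (g x <= (f x)%:E)%E) -> (upper g <= (L f)%:E)%E.
Proof.
move=> [Cf f0] gf; pose F n : Rd -> R := if n is 0%N then f else fun=> 0.
have F0 (h : (Rd -> R) -> R) : h (fun=> 0) = 0 -> (\sum_(k <oo) (h (F k))%:E = (h f)%:E)%E.
  move=> h0; apply/cvg_lim => //; apply: cvg_near_cst; exists 1%N => // n /= n1.
  rewrite -(prednK n1) big_nat_recl//= big1 ?adde0// => k _; by rewrite h0.
rewrite -(F0 L Cc_functional0); apply: upper_le_series; split.
  by case => [|n] /=; split => //; exact: Cc0.
by move=> x; rewrite (F0 (fun u => u x)).
Qed.

(* Dini: the partial sums of a majorizing series exceed f - eps on the support of f *)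
Lemma le_Cc_functional_upper f : Ccp f -> ((L f)%:E <= upper (fun x => (f x)%:E))%E.
Proof.
move=> [Cf f0]; apply: le_ereal_inf_tmp => _ [F [CF HF] ->].
have CF' k : Cc (F k) by have [] := CF k.
have [r [M [r0 M0 mf fM fr]]] := Cc_sup Cf.
pose chi : Rd -> R := cutoff 1 r.
have Cchi : Cc chi by apply: Cc_C1s; [exact: C1s_cutoff|exact: cpt_supp_cutoff].
apply/lee_addgt0Pr => e e0.
(* An error eps on the support of f is paid by eps * chi, and eps L(chi) <= e. *)
pose eps := e / (L chi + 1).
have Lc0 : 0 <= L chi by apply: Lpos => // x; exact: cutoff_ge0.
have Lc1 : 0 < L chi + 1 by rewrite ltr_wpDl.
have eps0 : 0 < eps by rewrite divr_gt0.
pose S N (x : Rd) := \sum_(0 <= k < N) F k x.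
have SM N N' x : (N <= N')%N -> S N x <= S N' x.
  move=> NN; rewrite /S [leRHS](big_cat_nat (n := N))//= lerDl sumr_ge0// => k _.
  by have [_] := CF k.
have CS N : Cc (S N) by have [] := Cc_functional_sum N CF'.
have [N _ HN] : \forall N \near \oo, [set x : Rd | enorm x <= r] `<=` [set x | 0 < S N x + eps - f x].
  have /compact_near_coveringP := @compact_enorm_le R d r; apply => x xr.
  have [N0 HN0] : exists N0, 0 < S N0 x + eps - f x.
    apply/not_existsP => H; have := HF x; apply/negP; rewrite -ltNge.
    apply: (@le_lt_trans _ _ (f x - eps)%:E); last by rewrite lte_fin gtrBl.
    apply: lime_le; first by apply: is_cvg_nneseries => k _ _; rewrite lee_fin; have [_] := CF k.
    apply: nearW => n; rewrite sumEFin lee_fin -/(S n x).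
    by have /negP := H n; rewrite -leNgt subr_le0; lra.
  have cc : continuous (fun x => S N0 x + eps - f x).
    apply: contB; last by have [] := Cf.
    by apply: contD; [have [] := CS N0|exact: cont_cst].
  have n1 : \forall x' \near x, 0 < S N0 x' + eps - f x'.
    by have /cvgr_gt := cc x; exact.
  exists ([set x' | 0 < S N0 x' + eps - f x'], [set N | (N0 <= N)%N]) => /=.
    by split => //; exists N0.
  move=> [x' N'] [/= h1 h2]; apply: lt_le_trans h1 _.
  by rewrite lerD2r lerD2r SM.
have {}HN x : f x <= 1 * S N x + eps * chi x.
  rewrite mul1r; have [xr|xr] := leP (enorm x) r.
    rewrite /chi cutoff_1// mulr1; have := HN N (leqnn N) x xr; rewrite /=; lra.
  rewrite (fr _ (ltW xr)) addr_ge0//; first by rewrite sumr_ge0// => k _; have [_] := CF k.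
  by rewrite mulr_ge0 ?(ltW eps0)// cutoff_ge0.
have : L f <= L (S N) + eps * L chi.
  by rewrite -[L (S N)]mul1r -Llin//; apply: le_Cc_functional => //; exact: Cc_lin.
have [_ ->] := Cc_functional_sum N CF'.
move=> h; apply: (@le_trans _ _ ((\sum_(0 <= k < N) L (F k))%:E + e%:E)%E).
  rewrite -EFinD lee_fin; apply: le_trans h _; rewrite lerD2l /eps mulrAC ler_pdivrMr//.
  by rewrite ler_wpM2l ?(ltW e0)// lerDl.
rewrite leeD2r// -sumEFin; apply: nneseries_lim_ge => k _ _.
by rewrite lee_fin; apply: Lpos => //; have [_] := CF k.
Qed.

(** With [h n] increasing to the indicator of U, the increments of f h_n form a series that
    majorizes f on U, and f - f h_n majorizes f off U for every n. Their values L(f h_n) and L(f - f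
    h_n) add up to L(f). *)
Lemma upper_open_split (U : set Rd) f : open U -> Ccp f ->
  (upper (fun x => (f x * \1_U x)%:E) + upper (fun x => (f x * \1_(~` U) x)%:E) <= (L f)%:E)%E.
Proof.
move=> oU [Cf f0]; have [h [ch h0 h01 hS [hN hU]]] := open_approx oU.
have Cfh n : Cc (fun x => f x * h n x) by exact: CcM.
pose G n (x : Rd) := f x * h n.+1 x - f x * h n x.
have G0 n x : 0 <= G n x by rewrite /G -mulrBr mulr_ge0// subr_ge0.
have CG n : Cc (G n) by exact: CcB.
have LG n : \sum_(0 <= m < n) L (G m) = L (fun x => f x * h n x).
  elim: n => [|n IH].
    rewrite big_geq// -Cc_functional0; congr L; apply/funext => x; by rewrite h0 mulr0.
  by rewrite big_nat_recr//= IH Cc_functionalB// subrKC.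
have c_le n : (upper (fun x => (f x * \1_(~` U) x)%:E) <= (L f - L (fun x => (f x * h n x)))%:E)%E.
  rewrite -Cc_functionalB//; apply: upper_le_Cc_functional; first split; first exact: CcB.
    by move=> x; rewrite -{1}(mulr1 (f x)) -mulrBr mulr_ge0// subr_ge0; have /andP[] := h01 n x.
  move=> x; rewrite lee_fin indicE; case: (boolP (x \in ~` U)) => [/set_mem xU|_].
    by rewrite mulr1 hN// mulr0 subr0.
  by rewrite mulr0 -{1}(mulr1 (f x)) -mulrBr mulr_ge0// subr_ge0; have /andP[] := h01 n x.
set V := upper (fun x => (f x * \1_(~` U) x)%:E) in c_le *.
have Vf : V \is a fin_num.
  by rewrite ge0_fin_numE ?upper_ge0//; apply: le_lt_trans (c_le 0%N) (ltry _).
rewrite -leeBrDr//; apply: (@le_trans _ _ (\sum_(m <oo) (L (G m))%:E)%E).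
  apply: upper_le_series; split => [k|x]; first by split.
  rewrite indicE; case: (boolP (x \in U)) => [/set_mem xU|_]; last first.
    by rewrite mulr0; apply: nneseries_ge0 => k _ _; rewrite lee_fin.
  have [n hn] := hU x xU.
  apply: (@le_trans _ _ (\sum_(0 <= m < n) (G m x)%:E)%E); last first.
    by apply: nneseries_lim_ge => k _ _; rewrite lee_fin.
  rewrite sumEFin lee_fin mulr1 /G (telescope_sumr (fun m => f x * h m x))//.
  by rewrite hn h0 mulr0 subr0 mulr1.
apply: lime_le; first by apply: is_cvg_nneseries => k _ _; rewrite lee_fin; exact: Lpos.
apply: nearW => n; rewrite sumEFin LG leeBrDr// addeC -leeBrDr//.
exact: c_le.
Qed.

Definition umeas (A : set X) : \bar R := upper (fun x => (\1_A x)%:E).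

Lemma umeas0 : umeas set0 = 0%E.
Proof.
apply/eqP; rewrite eq_le upper_ge0 andbT.
have <- : (L (fun=> 0))%:E = 0%E by rewrite Cc_functional0.
apply: upper_le_Cc_functional; first by split => //; exact: Cc0.
by move=> x; rewrite indicE in_set0.
Qed.

Lemma umeas_ge0 A : (0 <= umeas A)%E. Proof. exact: upper_ge0. Qed.

Lemma le_umeas : {homo umeas : A B / A `<=` B >-> (A <= B)%E}.
Proof.
move=> A B AB; apply: le_upper => x; rewrite lee_fin !indicE ler_nat.
by case: (boolP (x \in A)) => // /set_mem/AB/mem_set ->.
Qed.

Lemma umeas_sigma_subadditive : sigma_subadditive umeas.
Proof.
move=> A; apply: upper_sum => [x|j x]; last by rewrite lee_fin indicE.
have i0 n : (0 <= (\1_(A n) x : R)%:E)%E by rewrite lee_fin indicE.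
rewrite indicE; case: (boolP (x \in \bigcup_n A n)) => [/set_mem[n _ An]|_]; last first.
  exact: nneseries_ge0.
apply: le_trans (nneseries_lim_ge n.+1 (fun k _ _ => i0 k)).
rewrite big_nat_recr//= indicE mem_set// leeDr//.
by apply: sume_ge0 => k _.
Qed.

HB.instance Definition _ := isOuterMeasure.Build R X umeas umeas0 umeas_ge0 le_umeas umeas_sigma_subadditive.

(** Each member of a series majorizing the test set is split by [upper_open_split]; countable
    subadditivity collects the two families of parts. *)
Lemma open_caratheodory (U : set X) : @open Rd U -> umeas.-caratheodory U.
Proof.
move=> oU; apply: le_caratheodory_measurable => A.
apply: le_ereal_inf_tmp => _ [F [CF HF] ->].
have s0 (V : set Rd) j x : (0 <= (F j x * \1_V x)%:E)%E.
  by rewrite lee_fin mulr_ge0 ?indicE//; have [_] := CF j.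
have key (V : set Rd) : (umeas (A `&` V) <= \sum_(j <oo) upper (fun x => (F j x * \1_V x)%:E))%E.
  apply: upper_sum => [x|]; last exact: s0.
  rewrite indicE in_setI; case: (boolP (x \in V)) => [xV|]; last first.
    by rewrite andbF => _; apply: nneseries_ge0.
  rewrite andbT; have := HF x; rewrite indicE => /le_trans; apply.
  apply: lee_nneseries => [j _ _|j _]; first by rewrite lee_fin; have [_] := CF j.
  by rewrite indicE xV mulr1.
apply: le_trans (leeD (key U) (key (~` U))) _.
rewrite -nneseriesD; [|by move=> *; exact: upper_ge0|by move=> *; exact: upper_ge0].
apply: lee_nneseries => [k _ _|k _]; last exact: upper_open_split.
by apply: adde_ge0; exact: upper_ge0.
Qed.

Lemma borel_caratheodory (A : set X) : measurable A -> umeas.-caratheodory A.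
Proof.
move=> mA; suff : (umeas.-cara).-measurable (A : set (caratheodory_type umeas)) by [].
move: A mA; apply: smallest_sub.
  have [h1 h2 h3] := @sigma_algebra_measurable _ (caratheodory_type umeas).
  by split.
by move=> U oU; exact: open_caratheodory.
Qed.

Lemma umeas_sigma_additive : semi_sigma_additive (umeas : set X -> \bar R).
Proof.
move=> F mF tF mUF.
apply: (@caratheodory_measure_sigma_additive R X umeas) => //.
  by move=> i; exact: borel_caratheodory.
exact: borel_caratheodory.
Qed.

HB.instance Definition _ := isMeasure.Build _ X R umeas umeas0 umeas_ge0 umeas_sigma_additive.

Definition daniell_measure : Meas := umeas.

Lemma measurable_level (f : Rd -> R) (c : R) : Cc f -> measurable [set x : X | (c < f x)%R].
Proof.
move=> [cf _]; apply: open_measurable_BRd.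
rewrite (_ : [set x | _] = f @^-1` [set t | (c < t)%R])//.
by apply: open_comp; [move=> x _; exact: cf|exact: open_gt].
Qed.

Lemma daniell_level (f : Rd -> R) (dl : R) : Ccp f -> 0 < dl ->
  ((dl%:E * daniell_measure [set x : X | (dl < f x)%R]) <= (L (fun x => Num.min (f x) dl))%:E)%E.
Proof.
move=> [Cf f0] dl0.
have Cm : Cc (fun x => Num.min (f x) dl) by apply: Cc_min => //; exact: ltW.
have -> : L (fun x => Num.min (f x) dl) = dl * L (fun x => dl^-1 * Num.min (f x) dl).
  by rewrite Cc_functionalZ// mulrA divff ?gt_eqF// mul1r.
rewrite EFinM lee_wpmul2l ?lee_fin ?(ltW dl0)//; apply: upper_le_Cc_functional.
  split; first exact: CcZ.
  by move=> x; rewrite mulr_ge0 ?invr_ge0 ?(ltW dl0)// le_min f0 ltW.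
move=> x; rewrite lee_fin indicE; case: (boolP (x \in _)) => [/set_mem/= xf|_].
  by rewrite min_r ?(ltW xf)// mulVf ?gt_eqF.
by rewrite mulr_ge0 ?invr_ge0 ?(ltW dl0)// le_min f0 ltW.
Qed.

Hypothesis L1 : forall f, Cc f -> (forall x, f x <= 1) -> L f <= 1.

(** Dyadic radii: [chi n] vanishes beyond 2^(n+1), up to where [chi n.+1] equals 1. So the
    increments are nonnegative and form a series majorizing 1, with partial sums in C_c below 1. *)
Lemma daniell_le1 : (daniell_measure setT <= 1)%E.
Proof.
pose chi (n : nat) : Rd -> R := cutoff 1 (2 ^+ n).
have p2 n : (0 : R) < 2 ^+ n by rewrite exprn_gt0.
have Cchi n : Cc (chi n) by apply: Cc_C1s; [exact: C1s_cutoff|exact: cpt_supp_cutoff].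
have chiS n x : chi n x <= chi n.+1 x.
  have [h|h] := leP (enorm x) (2 ^+ n.+1).
    by rewrite {2}/chi cutoff_1// cutoff_le1.
  by rewrite /chi cutoff_0 ?cutoff_ge0// -exprS ltW.
pose G n (x : Rd) := if n is m.+1 then chi n x - chi m x else chi 0%N x.
have CG n : Cc (G n) by case: n => [|n]; [exact: Cchi|exact: CcB].
have G0 n x : 0 <= G n x by case: n => [|n]; [exact: cutoff_ge0|rewrite /G subr_ge0].
have SG n x : \sum_(0 <= k < n.+1) G k x = chi n x.
  by elim: n => [|n IH]; [rewrite big_nat1|rewrite big_nat_recr//= IH subrKC].
have SL n : \sum_(0 <= k < n.+1) L (G k) = L (chi n).
  by elim: n => [|n IH]; [rewrite big_nat1|rewrite big_nat_recr//= IH (Cc_functionalB (Cchi n.+1) (Cchi n)) subrKC].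
apply: (@le_trans _ _ (\sum_(k <oo) (L (G k))%:E)%E).
  apply: upper_le_series; split => [k|x]; first by split.
  rewrite indicE in_setT.
  pose n := (Num.truncn (enorm x)).+1.
  have xn : enorm x <= 2 ^+ n.
    apply: ltW; apply: lt_le_trans (truncnS_gt _) _; rewrite -natrX ler_nat.
    by rewrite ltnW// ltn_expl.
  apply: (@le_trans _ _ (\sum_(0 <= k < n.+1) (G k x)%:E)%E); last first.
    by apply: nneseries_lim_ge => k _ _; rewrite lee_fin.
  by rewrite sumEFin SG lee_fin /chi cutoff_1.
apply: lime_le; first by apply: is_cvg_nneseries => k _ _; rewrite lee_fin; exact: Lpos.
apply: nearW => -[|n]; first by rewrite big_geq// lee_fin.
by rewrite sumEFin SL lee_fin; apply: L1 => // x; exact: cutoff_le1.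
Qed.

(** f is cut into horizontal slices of height dl. The integral of a slice is at most dl times the
    measure above its lower level, and [L] of it at least dl times the measure above its upper
    level. The shift by one slice leaves only dl times the measure of {f > 0}, at most dl. The
    induction is on the number [J] of slices. *)
Lemma daniell_int_le f : Ccp f -> ((\int[daniell_measure]_x (f x)%:E) <= (L f)%:E)%E.
Proof.
move=> [Cf f0]; have [r [M [r0 M0 mf fM fr]]] := Cc_sup Cf.
apply/lee_addgt0Pr => dl dl0; rewrite addeC.
have [J HJ] : exists J : nat, forall x, f x <= J%:R * dl.
  exists (Num.truncn (M / dl)).+1 => x; apply: le_trans (ler_norm _) _; apply: le_trans (fM x) _.
  by rewrite -ler_pdivrMr// ltW// truncnS_gt.
have H1 : (dl%:E * daniell_measure [set x : X | (0 < f x)%R] <= dl%:E)%E.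
  rewrite -[leRHS]mule1 lee_wpmul2l ?lee_fin ?(ltW dl0)//.
  apply: le_trans daniell_le1; apply: le_measure; rewrite ?inE//.
  exact: measurable_level.
apply: (@le_trans _ _ (dl%:E * daniell_measure [set x : X | (0 < f x)%R] + (L f)%:E)%E); last first.
  by rewrite leeD2r.
elim: J f Cf f0 HJ {mf fM fr H1} => [|J IH] f Cf f0 HJ.
  have -> : f = fun=> 0.
    by apply/funext => x; apply/eqP; rewrite eq_le f0 andbT; have := HJ x; rewrite mul0r.
  by rewrite integral0 Cc_functional0 adde0 mule_ge0// lee_fin ltW.
pose m x := Num.min (f x) dl; pose g x := f x - m x.
have Cm : Cc m by apply: Cc_min => //; exact: ltW.
have Cg : Cc g by exact: CcB.
have m0 x : 0 <= m x by rewrite le_min f0 ltW.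
have g0 x : 0 <= g x by rewrite subr_ge0 ge_min lexx.
have fE x : f x = m x + g x by rewrite /g subrKC.
have gJ x : g x <= J%:R * dl.
  rewrite /g /m; have := HJ x; rewrite -natr1 mulrDl mul1r => h.
  have : 0 <= J%:R * dl by rewrite mulr_ge0// ltW.
  by case: (leP (f x) dl) => h' h''; rewrite ?subrr//; lra.
have mE (u : Rd -> R) : Cc u -> measurable_fun setT (fun x : X => (u x)%:E).
  by move=> [cu _]; apply/measurable_EFinP; exact: continuous_measurable.
have -> : (\int[daniell_measure]_x (f x)%:E = \int[daniell_measure]_x (m x)%:E + \int[daniell_measure]_x (g x)%:E)%E.
  rewrite -ge0_integralD//; [|by move=> x _; rewrite lee_fin|exact: mE|by move=> x _; rewrite lee_fin|exact: mE].
  by apply: eq_integral => x _; rewrite -EFinD -fE.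
have -> : L f = L m + L g.
  by rewrite -Cc_functionalD//; congr L; apply/funext => x; exact: fE.
rewrite EFinD; apply: leeD.
  apply: (@le_trans _ _ (\int[daniell_measure]_x (dl%:E * (\1_[set x : X | (0 < f x)%R] x)%:E))%E).
    apply: lint_le => x _; first by rewrite lee_fin.
    rewrite -EFinM lee_fin indicE; case: (boolP (x \in _)) => [_|/negP xf].
      by rewrite mulr1 ge_min lexx orbT.
    rewrite mulr0 ge_min; apply/orP; left; rewrite leNgt; apply/negP => h.
    by apply: xf; apply/mem_set.
  rewrite ge0_integralZl ?lee_fin ?(ltW dl0)//; last first.
    by apply/measurable_EFinP; apply: measurable_indic; exact: measurable_level.
  by rewrite integral_indic ?setIT//; exact: measurable_level.
apply: le_trans (IH g Cg g0 gJ) _; rewrite leeD2r//.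
have -> : [set x : X | (0 < g x)%R] = [set x : X | (dl < f x)%R].
  apply/seteqP; split => x /=; rewrite /g /m subr_gt0; case: (leP (f x) dl) => //; rewrite ?ltxx//.
exact: daniell_level.
Qed.

Hypothesis Ltight : forall e : R, 0 < e -> exists chi, [/\ Ccp chi, (forall x, chi x <= 1) & 1 - e <= L chi].

Lemma daniell_probm : probm daniell_measure.
Proof.
apply/eqP; rewrite eq_le daniell_le1/=; apply/lee_subgt0Pr => e e0.
have [chi [Cchi chi1 h]] := Ltight e0.
apply: (@le_trans _ _ (L chi)%:E); first by rewrite -EFinB lee_fin.
apply: le_trans (le_Cc_functional_upper Cchi) _.
by apply: le_upper => x; rewrite lee_fin indicE in_setT.
Qed.

(** Applied to M chi - g >= 0, the inequality already proved yields the converse for g, because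
    L(chi) <= 1 while the integral of chi is nearly 1. A signed f becomes nonnegative by adding M
    chi. *)
Lemma daniell_int f : Cc f -> (\int[daniell_measure]_x f x)%R = L f.
Proof.
have pm := daniell_probm; have rm : radon daniell_measure by exact: probm_radon.
have main g : Ccp g -> (\int[daniell_measure]_x g x)%R = L g.
  move=> [Cg g0]; have le u : Ccp u -> (\int[daniell_measure]_x u x)%R <= L u.
    move=> Pu; rewrite -lee_fin -Rint_EFin; first exact: daniell_int_le.
    by apply: integrable_Cc => //; have [] := Pu.
  apply/eqP; rewrite eq_le le//=.
  have [r [M [r0 M0 mg gM gr]]] := Cc_sup Cg.
  apply/ler_addgt0Pr => e e0.
  have M1 : 0 < M + 1 by rewrite ltr_wpDl.
  (* The argument 2 only selects an exponent for the cutoff. *)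
  have [r1 [r10 Hr1]] := cutoff_tight 2 pm (divr_gt0 e0 M1).
  pose r2 := Num.max r1 r; have r20 : 0 < r2 by rewrite lt_max r0 orbT.
  pose chi : Rd -> R := cutoff (cexp (2 : R)) r2.
  have Cchi : Cc chi by apply: Cc_C1s; [exact: C1s_cutoff|exact: cpt_supp_cutoff].
  have Ph : Ccp (fun x => M * chi x + -1 * g x).
    split; first exact: Cc_lin.
    move=> x; rewrite mulN1r subr_ge0; have [xr|xr] := leP (enorm x) r.
      rewrite /chi cutoff_1 ?mulr1//; first by apply: le_trans (ler_norm _) (gM x).
      by rewrite le_max xr orbT.
    by rewrite (gr _ (ltW xr)) mulr_ge0// cutoff_ge0.
  have := le _ Ph; rewrite Llin//.
  have i1 := integrable_Cc rm Cchi; have i2 := integrable_Cc rm Cg.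
  have -> : (\int[daniell_measure]_x (M * chi x + -1 * g x))%R =
     M * (\int[daniell_measure]_x chi x)%R - (\int[daniell_measure]_x g x)%R.
    rewrite RintegralD//; [|exact: (integrableZl measurableT M i1)|exact: (integrableZl measurableT (-1) i2)].
    by rewrite !RintegralZl// mulN1r.
  have h1 := Hr1 r2 (ltac:(by rewrite le_max lexx)).
  have h2 : L chi <= 1 by apply: L1 => // x; exact: cutoff_le1.
  have : M * (L chi - (\int[daniell_measure]_x chi x)%R) <= e.
    apply: (@le_trans _ _ (M * (e / (M + 1)))); first by rewrite ler_wpM2l//; lra.
    by rewrite mulrA ler_pdivrMr// mulrC ler_wpM2l ?(ltW e0)// lerDl.
  rewrite mulrBr; lra.
move=> Cf; have [r [M [r0 M0 mf fM fr]]] := Cc_sup Cf.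
pose chi : Rd -> R := cutoff 1 r.
have Cchi : Cc chi by apply: Cc_C1s; [exact: C1s_cutoff|exact: cpt_supp_cutoff].
have Mc0 x : 0 <= M * chi x by rewrite mulr_ge0// cutoff_ge0.
have P1 : Ccp (fun x => M * chi x) by split => //; exact: CcZ.
have P2 : Ccp (fun x => f x + M * chi x).
  split; first by apply: CcD => //; exact: CcZ.
  move=> x; have [xr|xr] := leP (enorm x) r.
    by rewrite /chi cutoff_1// mulr1; have := fM x; rewrite ler_norml; lra.
  by rewrite (fr _ (ltW xr)) add0r.
have [CM _] := P1.
have i1 := integrable_Cc rm CM; have i2 := integrable_Cc rm Cf.
have := main _ P2; rewrite Cc_functionalD// RintegralD// (main _ P1); exact: addIr.
Qed.

End daniell.

(** * Concatenation of curves *)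

Section dyadic.
Context {R : realType}.

Definition mesh (k : nat) : R := 2^-1 ^+ k.+1.
Definition node (k : nat) : R := 1 - 2^-1 ^+ k.

Lemma mesh_gt0 k : 0 < mesh k. Proof. by rewrite exprn_gt0// invr_gt0. Qed.

Lemma node0 : node 0 = 0. Proof. by rewrite /node expr0 subrr. Qed.

Lemma nodeS k : node k.+1 = node k + mesh k.
Proof. by rewrite /node /mesh exprS; field. Qed.

Lemma node_lt1 k : node k < 1.
Proof. by rewrite /node gtrBl exprn_gt0// invr_gt0. Qed.

Lemma node_le j k : (j <= k)%N -> node j <= node k.
Proof.
elim: k => [|k IH]; first by rewrite leqn0 => /eqP ->.
rewrite leq_eqVlt => /predU1P[->//|]; rewrite ltnS => /IH /le_trans; apply.
by rewrite nodeS lerDl ltW// mesh_gt0.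
Qed.

Lemma node_ge0 k : 0 <= node k. Proof. by rewrite -node0 node_le. Qed.

Lemma node_gt (c : R) : c < 1 -> exists k, c < node k.
Proof.
move=> c1; have c0 : 0 < 1 - c by rewrite subr_gt0.
exists (Num.truncn (1 - c)^-1).+1; set n := (_.+1)%N.
rewrite /node ltrBrDl -ltrBrDr exprVn invf_plt ?posrE ?exprn_gt0//.
apply: lt_trans (truncnS_gt _) _; rewrite -/n -natrX ltr_nat ltn_expl//.
Qed.

Lemma sum_mesh n : \sum_(0 <= k < n) mesh k = node n.
Proof.
elim: n => [|n IH]; first by rewrite big_geq// node0.
by rewrite big_nat_recr//= IH nodeS.
Qed.

(** The pieces cover [0, 1) exactly; elsewhere the default 0 is returned. *)
Definition piece (t : R) : nat := xget 0%N [set k | node k <= t < node k.+1].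

Lemma piece_uniq t j k : node j <= t < node j.+1 -> node k <= t < node k.+1 -> j = k.
Proof.
move=> /andP[j1 j2] /andP[k1 k2]; apply/eqP; rewrite eqn_leq; apply/andP; split; rewrite leqNgt.
  by apply/negP => /node_le h; have := lt_le_trans k2 (le_trans h j1); rewrite ltxx.
by apply/negP => /node_le h; have := lt_le_trans j2 (le_trans h k1); rewrite ltxx.
Qed.

Lemma piece_eq t k : node k <= t < node k.+1 -> piece t = k.
Proof.
move=> h; apply: (@piece_uniq t) => //.
by apply: (@xgetPex _ 0%N [set k | node k <= t < node k.+1]); exists k.
Qed.

Lemma pieceP t : 0 <= t < 1 -> node (piece t) <= t < node (piece t).+1.
Proof.
move=> /andP[t0 t1]; apply: (@xgetPex _ 0%N [set k | node k <= t < node k.+1]).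
have ex := node_gt t1; case: (ex_minnP ex) => -[|k] kt kmin.
  by exfalso; move: kt; rewrite node0 ltNge t0.
exists k => /=; rewrite kt andbT leNgt; apply/negP => /kmin; by rewrite ltnn.
Qed.

Definition local (k : nat) (t : R) : R := (t - node k) / mesh k.

Lemma local_itv k t : (node k <= t < node k.+1) = (0 <= local k t < 1).
Proof.
rewrite /local ler_pdivlMr ?mesh_gt0// mul0r subr_ge0.
by rewrite ltr_pdivrMr ?mesh_gt0// mul1r ltrBlDl -nodeS.
Qed.

Lemma local_itvoo k t : (node k < t < node k.+1) = (0 < local k t < 1).
Proof.
rewrite /local ltr_pdivlMr ?mesh_gt0// mul0r subr_gt0.
by rewrite nodeS ltr_pdivrMr ?mesh_gt0// mul1r (ltrBlDl t).
Qed.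

Lemma local_affine k s : local k (node k + mesh k * s) = s.
Proof.
rewrite /local (_ : node k + mesh k * s - node k = s * mesh k); last by ring.
by rewrite mulfK// gt_eqF ?mesh_gt0.
Qed.

Lemma local_continuous k : continuous (local k).
Proof.
by apply: contM; [apply: contB; [move=> t; exact: cvg_id|exact: cont_cst]|exact: cont_cst].
Qed.

Lemma affine_piece k : affine (node k) (mesh k) @^-1` `]node k, node k.+1[%classic = oitv 1.
Proof.
apply/seteqP; split => s; rewrite /affine/= ?oitvE in_itv/= local_itvoo local_affine//.
Qed.

End dyadic.

(** * Local integrability of the flux from finite action *)

Section vtv_bound.
Context {R : realType} {d : nat}.
Notation Rd := 'rV[R]_d.
Notation X := (@BRd R d).
Notation Meas := ({measure set X -> \bar R}).
Variables (p : R) (phi : R -> Rd -> R) (gamma : Meas).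
Hypotheses (p1 : 1 < p) (adm : admissible p phi) (rgamma : radon gamma).

(** [phi_base] with weight 1, once per coordinate; the unit mass and [gamma] of the ball bound the
    other terms. *)
Lemma vtv_le_Phi (r : R) : exists2 C : R, 0 < C & forall (mu : Meas) (nu : vmeas),
  probm mu -> is_vmeas nu -> (vtv nu (B0 r) <= C%:E * (Phi phi gamma mu nu + 1))%E.
Proof.
have [c c0 Hc] := phi_base p1 adm.
have mB := @measurable_B0 R d r.
pose B := fine (gamma (B0 r)).
have Bg : gamma (B0 r) = B%:E by rewrite fineK// ge0_fin_numE.
have B0' : 0 <= B by rewrite fine_ge0.
have C0 : 0 < c * (2 + B) by rewrite mulr_gt0// ltr_wpDr.
exists (d%:R * (c * (2 + B)) + 1); first by rewrite ltr_wpDl// mulr_ge0// ltW.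
move=> mu nu pm vnu; have [_ [mv _]] := vnu.
have P0 := Phi_ge0 p1 adm gamma mu nu.
have i01 (x : X) : 0 <= \1_(B0 r) x :> R by rewrite indicE.
have mi : measurable_fun setT (\1_(B0 r) : X -> R) by exact: measurable_indic.
pose ci (x : X) : R := c * \1_(B0 r) x.
have ci0 x : 0 <= ci x by rewrite mulr_ge0// ltW.
have mci : measurable_fun setT ci by exact: measurable_funM.
have icc (m : Meas) : (\int[m]_x (ci x)%:E = c%:E * m (B0 r))%E.
  rewrite /ci; under eq_integral do rewrite EFinM.
  rewrite ge0_integralZl ?lee_fin ?(ltW c0)//; last by apply/measurable_EFinP.
  by rewrite integral_indic// setIT.
have ptw x u w : 0 < u -> \1_(B0 r) x * enorm w <= c * phi u w + ci x * u + ci x.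
  move=> u0; have ph := phi_ge0 adm w u0.
  rewrite /ci indicE; case: (_ \in _); last by rewrite !mulr0 !mul0r !addr0 mulr_ge0// ltW.
  rewrite mul1r mulr1; apply: le_trans (Hc 1 u w ltr01 u0) _.
  by rewrite powR1 mul1r divr1 le_eqVlt; apply/predU1P; left; ring.
apply: (@le_trans _ _ (\int[vbase nu]_(x in B0 r) \sum_(i < d) `|(vdens nu x ord0 i)%:E|)%E).
  apply: lint_le => x _; first by rewrite lee_fin enorm_ge0.
  by under eq_bigr do rewrite abse_EFin; rewrite sumEFin lee_fin enorm_le_sum.
rewrite ge0_integral_sum//; last first.
  by move=> i; apply: measurable_funTS; apply: measurableT_comp => //; apply/measurable_EFinP; exact: mv.
apply: (@le_trans _ _ (\sum_(i < d) ((c * (2 + B))%:E * (Phi phi gamma mu nu + 1)))%E).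
  apply: lee_sum => i _.
  have := Phi_bound p1 adm gamma mu i vnu c0 i01 mi ci0 mci ci0 mci ptw.
  rewrite !icc Bg.
  rewrite (_ : (\int[vbase nu]_x _)%E = (\int[vbase nu]_(x in B0 r) `|(vdens nu x ord0 i)%:E|)%E); last first.
    rewrite [RHS]integral_mkcond epatch_indic; apply: eq_integral => x _.
    by rewrite muleC.
  move=> /le_trans; apply.
  rewrite gt0_muleDr//.
  apply: leeD; first by rewrite lee_wpmul2r// lee_fin ler_peMr ?(ltW c0)//; lra.
  rewrite mule1 mulrDr EFinD; apply: leeD; last by rewrite -EFinM.
  apply: (@le_trans _ _ (c%:E * 1)%E).
    rewrite lee_wpmul2l ?lee_fin ?(ltW c0)// -pm.
    by apply: le_measure; rewrite ?inE.
  by rewrite mule1 lee_fin; have := c0; lra.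
rewrite sume_const; last by rewrite mule_ge0 ?adde_ge0// lee_fin ltW.
rewrite muleA -EFinM lee_wpmul2r ?adde_ge0//.
by rewrite lee_fin lerDl.
Qed.

Lemma vtv_integrable (mu : R -> Meas) (nu : R -> @vmeas R d) r :
  (forall t, 0 < t < 1 -> probm (mu t)) -> (forall t, 0 < t < 1 -> is_vmeas (nu t)) ->
  (action phi gamma mu nu < +oo)%E ->
  (\int[@lebesgue_measure R]_(t in oitv 1) vtv (nu t) (B0 r) < +oo)%E.
Proof.
move=> pm vn act; have [C C0 HC] := vtv_le_Phi r.
have P0 t : (0 <= Phi phi gamma (mu t) (nu t))%E by exact: (Phi_ge0 p1 adm).
have mD := @measurable_oitv R 1.
apply: (@le_lt_trans _ _ (C%:E * (action phi gamma mu nu + 1))%E); last first.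
  by rewrite lte_mul_pinfty ?lee_fin ?(ltW C0)// lte_add_pinfty// ltry.
apply: (@le_trans _ _ (\int[@lebesgue_measure R]_(t in oitv 1) (C%:E * (Phi phi gamma (mu t) (nu t) + 1)))%E).
  apply: lint_le => t.
    by move=> _; apply: integral_ge0 => x _; rewrite lee_fin enorm_ge0.
  by rewrite oitvE => t01; apply: HC; [exact: pm|exact: vn].
apply: le_trans (@lint_scale _ _ R (@lebesgue_measure R) (oitv 1) (fun t => Phi phi gamma (mu t) (nu t) + 1)%E C mD (ltW C0) _) _.
  by move=> t _; rewrite adde_ge0.
rewrite lee_wpmul2l ?lee_fin ?(ltW C0)//.
apply: le_trans (@lint_add _ _ R (@lebesgue_measure R) (oitv 1) (fun t => Phi phi gamma (mu t) (nu t))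
  (fun=> 1%E) mD (fun t _ => P0 t) _ (measurable_cst _)) _; first by move=> t _.
rewrite leeD2l// integral_cst//= mul1e /oitv lebesgue_measure_itv/= lte_fin ltr01.
by rewrite -EFinD subr0.
Qed.

End vtv_bound.

(** * Infinitely many curves joined in time 1 *)

Section gluing.
Context {R : realType} {d : nat}.
Notation Rd := 'rV[R]_d.
Notation X := (@BRd R d).
Notation Meas := ({measure set X -> \bar R}).
Notation leb := (@lebesgue_measure R).
Variables (p : R) (phi : R -> Rd -> R) (gamma : Meas) (kappa : R).
Hypotheses (p1 : 1 < p) (adm : admissible p phi) (rgamma : radon gamma).
Hypotheses (Hk : is_kappa p phi kappa) (fin : (mtilde (- kappa) gamma < +oo)%E).
Variables (mk : nat -> R -> Meas) (nk : nat -> R -> @vmeas R d) (s : nat -> Meas) (mu : Meas) (e : R).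
Hypotheses (e0 : 0 < e) (CEk : forall k, CE_from_to 1 (s k) (s k.+1) (mk k) (nk k))
  (Ak : forall k, (action phi gamma (mk k) (nk k) <= ((e * mesh k) `^ p)%:E)%E)
  (ps : forall k, probm (s k)) (pmu : probm mu)
  (vag : forall f, Cc f -> (\int[s k]_x f x)%R @[k --> \oo] --> (\int[mu]_x f x)%R).

Definition vzero : @vmeas R d := VMeas mzero (fun=> 0).

Lemma is_vmeas_vzero : is_vmeas vzero.
Proof.
split; first by move=> r; rewrite /= /mzero ltry.
split; first by move=> i; exact: measurable_cst.
by move=> r; rewrite /= integral_measure_zero ltry.
Qed.

Definition glue (t : R) : Meas := if t < 1 then mk (piece t) (local (piece t) t) else mu.

(** The factor is the speed gained by compressing a unit of time to [mesh]. At a node the local time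
    is 0, where nothing is known about [nk], so zero is put there. *)
Definition vglue (t : R) : @vmeas R d :=
  if t == node (piece t) then vzero
  else vscale (mesh (piece t))^-1 (nk (piece t) (local (piece t) t)).

Lemma glueE k t : node k <= t < node k.+1 -> glue t = mk k (local k t).
Proof.
move=> kt; rewrite /glue (piece_eq kt); have /andP[_ h] := kt.
by rewrite (lt_trans h (node_lt1 _)).
Qed.

Lemma vglueE k t : node k < t < node k.+1 -> vglue t = vscale (mesh k)^-1 (nk k (local k t)).
Proof.
move=> /andP[k1 k2]; rewrite /vglue (@piece_eq _ _ k) ?(ltW k1)//.
by rewrite gt_eqF.
Qed.

Lemma probm_piece k t : 0 <= t <= 1 -> probm (mk k t).
Proof.
move=> t01; have [ce ends] := CEk k.
have act : (action phi gamma (mk k) (nk k) < +oo)%E by exact: le_lt_trans (Ak k) (ltry _).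
have z01 : 0 <= (0 : R) <= 1 by rewrite lexx ler01.
apply: (probm_curve p1 adm Hk fin ce act z01 t01).
by rewrite /probm (ends _ measurableT).1; exact: ps.
Qed.

Lemma probm_glue t : 0 <= t <= 1 -> probm (glue t).
Proof.
move=> /andP[t0 t1]; rewrite /glue; case: ifPn => // h; apply: probm_piece.
have : node (piece t) <= t < node (piece t).+1 by apply: pieceP; rewrite t0.
by rewrite local_itv; lra.
Qed.

Let psi f k u := (\int[mk k (clamp u)]_x f x)%R.

Lemma psi_cont f k : Cc f -> continuous (psi f k).
Proof. by move=> Cf; have [ce _] := CEk k; exact: (curve_cont_Cc (CE_curve ce)). Qed.

Lemma psi_ends f k : psi f k 0 = (\int[s k]_x f x)%R /\ psi f k 1 = (\int[s k.+1]_x f x)%R.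
Proof.
rewrite /psi !clamp_id ?lexx ?ler01//; exact: CE_endpoints (CEk k).
Qed.

Lemma clamp_le0 (t : R) : t <= 0 -> clamp t = 0.
Proof. by move=> t0; rewrite /clamp min_l ?max_l//; lra. Qed.

Lemma clamp_ge1 (t : R) : 1 <= t -> clamp t = 1.
Proof. by move=> t1; rewrite /clamp min_r ?max_r. Qed.

(** The integral of f along the glued curve, frozen from [node K] on. Inside [psi], [clamp] makes
    each increment constant outside its own piece, so this is a finite sum of continuous functions
    and continuity across the nodes comes for free. *)
Let Psi f K t := (\int[s 0%N]_x f x)%R + \sum_(0 <= k < K) (psi f k (local k t) - psi f k 0).

Lemma PsiE f K t : 0 <= t <= 1 ->
  Psi f K t = if t < node K then (\int[glue t]_x f x)%R else (\int[s K]_x f x)%R.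
Proof.
move=> /andP[t0 t1]; elim: K => [|K IH]; first by rewrite /Psi big_geq// addr0 node0 ltNge t0.
rewrite /Psi big_nat_recr//= addrA -/(Psi f K t) IH.
have [tK|Kt] := ltP t (node K).
  rewrite (lt_le_trans tK (node_le (leqnSn K))) /psi (@clamp_le0 (local K t)); last first.
    by rewrite /local ler_pdivrMr ?mesh_gt0// mul0r subr_le0 ltW.
  by rewrite clamp_id ?lexx ?ler01// subrr addr0.
rewrite -(psi_ends f K).1 subrKC.
have [tK1|K1t] := ltP t (node K.+1).
  have h : node K <= t < node K.+1 by rewrite Kt.
  by rewrite (glueE h) /psi clamp_id//; move: h; rewrite local_itv; lra.
rewrite -(psi_ends f K).2 /psi clamp_ge1 ?clamp_id ?lexx ?ler01//.
by rewrite /local ler_pdivlMr ?mesh_gt0// mul1r lerBrDl -nodeS.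
Qed.

Lemma Psi_cont f K : Cc f -> continuous (Psi f K).
Proof.
move=> Cf; elim: K => [|K IH].
  rewrite (_ : Psi f 0 = fun=> (\int[s 0%N]_x f x)%R); first exact: cont_cst.
  by apply/funext => t; rewrite /Psi big_geq// addr0.
rewrite (_ : Psi f K.+1 = fun t => Psi f K t + (psi f K (local K t) - psi f K 0)).
  apply: contD => //; apply: contB; last exact: cont_cst.
  by apply: (cont_comp (@local_continuous R K)); exact: psi_cont.
by apply/funext => t; rewrite /Psi big_nat_recr//= addrA.
Qed.

Lemma mesh_cvg0 : (@mesh R) k @[k --> \oo] --> 0.
Proof.
rewrite /mesh; have h : `|2^-1 : R| < 1 by rewrite ger0_norm ?invr_ge0// invf_lt1 ?ltr1n.
have := cvg_geometric 1 h; rewrite -(cvg_shiftS _) => H.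
by apply: cvg_trans H; apply: near_eq_cvg; apply: nearW => n; rewrite /geometric/= mul1r.
Qed.

(** Inside a late piece the oscillation is small by [action_modulus], because the actions tend to 0;
    between nodes it is small because the integrals against [s] converge. This is the continuity at
    time 1. *)
Lemma glue_near_end f eps : Cc f -> 0 < eps -> exists K0, forall K t, (K0 <= K)%N ->
  node K <= t <= 1 -> `|(\int[glue t]_x f x)%R - (\int[s K]_x f x)%R| <= eps.
Proof.
move=> Cf eps0; have e3 : 0 < eps / 3 by rewrite divr_gt0.
have [eta eta0 Heta] := action_modulus p1 adm rgamma Cf e3.
have p0 : 0 < p := lt_trans ltr01 p1.
have [K1 _ HK1] : \forall k \near \oo, (e * mesh k) `^ p <= eta.
  have n1 : \forall k \near \oo, mesh k < eta `^ p^-1 / e.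
    by have /cvgr_lt := mesh_cvg0; apply; rewrite divr_gt0// powR_gt0.
  apply: filterS n1 => k; rewrite ltr_pdivlMr// mulrC => h.
  rewrite -[leRHS]powRr1 ?(ltW eta0)// -(mulVf (lt0r_neq0 p0)) powRrM.
  by apply: ge0_ler_powR; rewrite ?nnegrE ?powR_ge0 ?(ltW p0) ?(ltW h)// mulr_ge0 ?(ltW e0)// ltW ?mesh_gt0.
have /cvgrPdist_le/(_ _ e3)[K2 _ HK2] := vag Cf.
exists (maxn K1 K2) => K t; rewrite geq_max => /andP[hK1 hK2] /andP[Kt t1].
have hs j : (K <= j)%N -> `|(\int[s j]_x f x)%R - (\int[s K]_x f x)%R| <= eps / 3 + eps / 3.
  move=> Kj; have := HK2 j (leq_trans hK2 Kj); have := HK2 K hK2 => /= h1 h2.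
  rewrite -(subrKA (\int[mu]_x f x)%R); apply: le_trans (ler_normD _ _) _.
  by rewrite distrC; exact: lerD.
move: t1; rewrite le_eqVlt => /predU1P[->|t1].
  rewrite /glue ltxx; apply: le_trans (HK2 K hK2) _; lra.
have t0 : 0 <= t by apply: le_trans Kt; exact: node_ge0.
have t01 : 0 <= t < 1 by rewrite t0.
have pt := pieceP t01; set j := piece t in pt *.
have Kj : (K <= j)%N.
  rewrite leqNgt; apply/negP => jK; have h := @node_le R _ _ jK.
  by have /andP[_ h2] := pt; have := lt_le_trans h2 (le_trans h Kt); rewrite ltxx.
rewrite (glueE pt); have lt01 : 0 <= local j t <= 1 by move: pt; rewrite local_itv; lra.
have [ce _] := CEk j.
have z01 : 0 <= (0 : R) <= 1 by rewrite lexx ler01.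
have actj : (action phi gamma (mk j) (nk j) <= eta%:E)%E.
  by apply: le_trans (Ak j) _; rewrite lee_fin; apply: HK1; exact: leq_trans hK1 Kj.
have h1 := Heta _ _ ce (probm_piece j) actj 0 (local j t) z01 lt01.
have [E _] := CE_endpoints f (CEk j); rewrite E in h1.
have h2 := hs j Kj.
rewrite -(subrKA (\int[s j]_x f x)%R); apply: le_trans (ler_normD _ _) _.
lra.
Qed.

(** The continuous functions [Psi f K] approximate the integral uniformly on [0, 1]. *)
Lemma glue_cont f : Cc f -> {within `[0, 1], continuous (fun t => \int[glue t]_x (f x)%:E)%E}.
Proof.
move=> Cf; apply/within_clamp.
have E t : (\int[glue (clamp t)]_x (f x)%:E = ((\int[glue (clamp t)]_x f x)%R)%:E)%E.
  apply: Rint_EFin; apply: integrable_Cc => //; apply: probm_radon.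
  by apply: probm_glue; exact: clamp_itv.
rewrite (_ : (fun t => _) = (fun t => ((\int[glue (clamp t)]_x f x)%R)%:E)); last by apply/funext.
move=> t0; apply: cvg_EFin; first exact: nearW.
apply/cvgrPdist_le => eps eps0.
have e3 : 0 < eps / 3 by rewrite divr_gt0.
have [K HK] := glue_near_end Cf e3.
have D t : `|(\int[glue (clamp t)]_x f x)%R - Psi f K (clamp t)| <= eps / 3.
  have ct := clamp_itv t; rewrite PsiE//; case: ltP => h; first by rewrite subrr normr0 ltW.
  by apply: HK => //; rewrite h; have /andP[] := ct.
have cc := cont_comp (@clamp_continuous R) (@Psi_cont f K Cf).
have /cvgrPdist_le/(_ _ e3) := cc t0.
apply: filterS => t h /=.
have := D t; have := D t0; move: h; rewrite /= !ler_norml; lra.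
Qed.

Lemma trivIset_pieces : trivIset setT (fun k => `]node k, (node k.+1 : R)[%classic).
Proof.
apply/trivIsetP => i j _ _ ij; apply/seteqP; split => // t [/=]; rewrite !in_itv/=.
move=> /andP[i1 i2] /andP[j1 j2]; move/eqP: ij; apply.
by apply: (@piece_uniq R t); rewrite ?i2 ?j2 ltW.
Qed.

Lemma pieces_sub k : `]node k, (node k.+1 : R)[%classic `<=` oitv 1.
Proof.
move=> t /=; rewrite in_itv/= oitvE => /andP[h1 h2].
by rewrite (le_lt_trans (node_ge0 k) h1) (lt_trans h2 (node_lt1 _)).
Qed.

Lemma pieces_null : leb (oitv 1 `\` \bigcup_k `]node k, (node k.+1 : R)[%classic) = 0%E.
Proof.
apply: countable_lebesgue_measure0.
apply: (@sub_countable _ _ _ (range (@node R))); last first.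
  exact: (card_le_trans (card_image_le _ _) (card_lexx _)).
apply: subset_card_le => t [+ nt]; rewrite oitvE => /andP[t0 t1].
have t01 : 0 <= t < 1 by rewrite ltW.
have /andP[] := pieceP t01; rewrite le_eqVlt => /predU1P[<- _|h1 h2]; first by exists (piece t).
by exfalso; apply: nt; exists (piece t) => //=; rewrite in_itv/= h1.
Qed.

(** Piece k contributes at most mesh * mesh^(-p) * (e mesh)^p = mesh * e^p, from the length of its
    interval, the speed-up and the bound on its action; the partial sums of the meshes stay below 1.
    Hence steps of size e * mesh. *)
Lemma glue_action : (action phi gamma glue vglue <= (e `^ p)%:E)%E.
Proof.
have P0 t : (0 <= Phi phi gamma (glue t) (vglue t))%E by exact: (Phi_ge0 p1 adm).
apply: le_trans (@lint_bigcup _ _ R leb (oitv 1) (fun k => `]node k, (node k.+1 : R)[%classic)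
  (fun t => Phi phi gamma (glue t) (vglue t)) (measurable_oitv 1) _ trivIset_pieces
  pieces_sub pieces_null (fun t _ => P0 t)) _; first by move=> k; exact: measurable_itv.
have ep0 : 0 <= e `^ p by exact: powR_ge0.
apply: (@le_trans _ _ (\sum_(k <oo) (mesh k * e `^ p)%:E)%E); last first.
  apply: lime_le; first by apply: is_cvg_nneseries => k _ _; rewrite lee_fin mulr_ge0// ltW ?mesh_gt0.
  apply: nearW => n; rewrite sumEFin -mulr_suml sum_mesh lee_fin.
  by rewrite ler_piMl// ltW// node_lt1.
apply: lee_nneseries => [k _ _|k _]; first by apply: integral_ge0 => t _.
have m0 := @mesh_gt0 R k; have mi : 0 < (@mesh R k)^-1 by rewrite invr_gt0.
have E := @lint_affine R (node k) (mesh k) `]node k, node k.+1[%classic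
  (fun t => Phi phi gamma (glue t) (vglue t)) m0 (measurable_itv _) (fun t _ => P0 t).
rewrite affine_piece in E.
apply: (@le_trans _ _ ((mesh k)%:E * \int[leb]_(x in oitv 1) Phi phi gamma (glue (affine (node k) (mesh k) x)) (vglue (affine (node k) (mesh k) x)))%E).
  by rewrite E muleA -EFinM divff ?gt_eqF// mul1e.
have [ce _] := CEk k; have [_ [_ [vn _]]] := CE_curve ce.
have mip : 0 < (@mesh R k)^-1 `^ p by rewrite powR_gt0.
apply: (@le_trans _ _ ((mesh k)%:E * (((mesh k)^-1 `^ p)%:E * action phi gamma (mk k) (nk k)))%E).
  rewrite lee_wpmul2l ?lee_fin ?(ltW m0)//.
  apply: le_trans (@lint_scale _ _ R leb (oitv 1) (fun t => Phi phi gamma (mk k t) (nk k t)) _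
    (measurable_oitv 1) (ltW mip) (fun t _ => Phi_ge0 p1 adm _ _ _)).
  apply: lint_le => t; first by move=> _; exact: P0.
  rewrite oitvE => t01.
  have ut : node k < affine (node k) (mesh k) t < node k.+1.
    by rewrite local_itvoo /affine local_affine.
  rewrite (vglueE ut) (@glueE k); last by have /andP[/ltW -> ->] := ut.
  by rewrite /affine local_affine; apply: Phi_scale => //; exact: vn.
rewrite [leRHS]EFinM lee_wpmul2l ?lee_fin ?(ltW m0)//.
apply: le_trans (lee_wpmul2l _ (Ak k)) _; first by rewrite lee_fin ltW.
rewrite -EFinM lee_fin powRM ?(ltW e0) ?(ltW m0)// mulrCA -powRM ?(ltW m0) ?(ltW mi)//.
by rewrite mulVf ?gt_eqF// powR1 mulr1.
Qed.

Lemma vglue_vmeas t : 0 < t < 1 -> is_vmeas (vglue t).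
Proof.
move=> /andP[t0 t1]; rewrite /vglue; case: eqP => [_|/eqP tn]; first exact: is_vmeas_vzero.
have t01 : 0 <= t < 1 by rewrite ltW.
have [ce _] := CEk (piece t); have [_ [_ [vn _]]] := CE_curve ce.
apply/is_vmeas_scale/vn; rewrite -local_itvoo.
by have := pieceP t01; rewrite [node _ < _]lt_neqAle eq_sym tn.
Qed.

Lemma vglue_measurable f i : Cc f -> measurable_fun (oitv 1)
  (fun t : R => (\int[vbase (vglue t)]_x (f x * vdens (vglue t) x ord0 i)%:E)%E : \bar R).
Proof.
move=> Cf.
(* Open pieces, each with its right node: node 0 is time 0, which lies outside the open interval,
   and singletons cause no trouble for measurability. *)
pose E k : set R := `]node k, node k.+1[%classic `|` [set node k.+1].
have mE k : measurable (E k) by apply: measurableU; [exact: measurable_itv|exact: measurable_set1].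
rewrite (_ : oitv 1 = \bigcup_k E k); last first.
  apply/seteqP; split => t; rewrite ?oitvE.
    move=> /andP[t0 t1]; have t01 : 0 <= t < 1 by rewrite ltW.
    have /andP[] := pieceP t01; rewrite le_eqVlt => /predU1P[tn _|h1 h2].
      case: (piece t) tn => [|k] tn; first by move: t0; rewrite -tn node0 ltxx.
      by exists k => //; right.
    by exists (piece t) => //; left; rewrite /= in_itv/= h1.
  move=> [k _ [/pieces_sub|->]]; rewrite ?oitvE// node_lt1 andbT.
  by rewrite nodeS ltr_wpDl ?node_ge0// mesh_gt0.
apply/(measurable_fun_bigcup _ mE) => k.
apply/(measurable_funU _ (measurable_itv _) (measurable_set1 _)); split; last exact: measurable_fun_set1.
have [ce _] := CEk k; have [_ [_ [_ [mn _]]]] := CE_curve ce.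
pose h (u : R) : \bar R := ((mesh k)^-1%:E * \int[vbase (nk k u)]_x (f x * vdens (nk k u) x ord0 i)%:E)%E.
apply: (@eq_measurable_fun _ _ _ _ _ (h \o local k)).
  move=> t /set_mem; rewrite /= in_itv/= => kt; rewrite (vglueE kt) /h /=.
  have lt : 0 < local k t < 1 by rewrite -local_itvoo.
  have [_ [_ [vn _]]] := CE_curve ce.
  rewrite -integralZl//; last exact: integrable_vCc (vn _ lt) Cf.
  by apply: eq_integral => x _; rewrite -EFinM mxE; congr EFin; ring.
apply: (@measurable_comp _ _ _ _ _ _ (oitv 1)).
- exact: measurable_oitv.
- by move=> _ [t + <-]; rewrite /= in_itv/= oitvE local_itvoo.
- by apply: emeasurable_funM => //; exact: mn.
- by apply: measurable_cont; exact: local_continuous.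
Qed.

Lemma glue_curve : curve glue vglue.
Proof.
split; first by move=> t t01; apply: probm_radon; exact: probm_glue.
split; first exact: glue_cont.
split; first exact: vglue_vmeas.
split; first by move=> f i Cf; exact: vglue_measurable.
move=> r; apply: (vtv_integrable p1 adm rgamma (mu := glue)).
- by move=> t t01; apply: probm_glue; lra.
- exact: vglue_vmeas.
- exact: le_lt_trans glue_action (ltry _).
Qed.

Section weak.
Variables (zeta Dt : Rd -> R -> R) (D : 'I_d -> Rd -> R -> R).
Hypothesis Hz : C1t zeta Dt D.

Let q t := (\int[glue t]_x Dt x t)%R + flux vglue D t.

Lemma integrable_rate : leb.-integrable (oitv 1) (EFin \o q).
Proof.
have [_ CDt _] := C1t_Cct Hz.
have i1 := curve_integrable_mu glue_curve CDt; have i2 := integrable_flux glue_curve Hz.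
rewrite (_ : EFin \o q = (fun t => ((\int[glue t]_x Dt x t)%R)%:E + (flux vglue D t)%:E)%E)//.
by apply: (integrableD _ i1 i2); exact: measurable_oitv.
Qed.

Lemma integrable_rateS (I : set R) : measurable I -> I `<=` oitv 1 -> leb.-integrable I (EFin \o q).
Proof.
by move=> mI sub; apply: integrableS integrable_rate => //; exact: measurable_oitv.
Qed.

(** The equation of piece k in its own time. Under the affine change of time, [Dt] acquires a factor
    [mesh], which matches the factor 1 / mesh in [vglue]; the remaining 1 / mesh is cancelled by the
    Jacobian. *)
Lemma piece_increment k : (\int[leb]_(t in `]node k, node k.+1[) q t)%R =
  (\int[s k.+1]_x zeta x (node k.+1))%R - (\int[s k]_x zeta x (node k))%R.
Proof.
have m0 := @mesh_gt0 R k; have [ce _] := CEk k.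
have HzA := C1t_affine (node k) (mesh k) Hz.
have [_ CDtA _] := C1t_Cct HzA.
have cu := CE_curve ce; have [_ [_ [vn _]]] := cu.
have i1 := curve_integrable_mu cu CDtA; have i2 := integrable_flux cu HzA.
pose r t := (\int[mk k t]_x (Dt x (node k + mesh k * t) * mesh k))%R +
  flux (nk k) (fun i x u => D i x (node k + mesh k * u)) t.
have ir : leb.-integrable (oitv 1) (EFin \o r).
  rewrite (_ : EFin \o r = (fun t => ((\int[mk k t]_x (Dt x (node k + mesh k * t) * mesh k))%R)%:E
     + (flux (nk k) (fun i x u => D i x (node k + mesh k * u)) t)%:E)%E)//.
  by apply: (integrableD _ i1 i2); exact: measurable_oitv.
have := continuity_equation_int ce HzA (lexx 0) ler01 (lexx 1).
rewrite mulr0 addr0 mulr1 -nodeS.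
have [-> _] := CE_endpoints (fun x => zeta x (node k)) (CEk k).
have [_ ->] := CE_endpoints (fun x => zeta x (node k.+1)) (CEk k).
move=> ->.
have E : (\int[leb]_(x in oitv 1) (q (affine (node k) (mesh k) x))%:E =
    (mesh k)^-1%:E * \int[leb]_(x in `]node k, node k.+1[) (q x)%:E)%E.
  have mq : measurable_fun `]node k, node k.+1[ (fun t : R => (q t)%:E).
    exact: measurable_int (integrable_rateS (measurable_itv _) (@pieces_sub k)).
  have := @integral_affine R (node k) (mesh k) `]node k, node k.+1[%classic (fun t => (q t)%:E) m0
    (measurable_itv _) mq.
  by rewrite affine_piece.
have E2 : (\int[leb]_(x in oitv 1) (q (affine (node k) (mesh k) x))%:E =
    (mesh k)^-1%:E * \int[leb]_(x in oitv 1) (r x)%:E)%E.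
  rewrite -integralZl//; last exact: measurable_oitv.
  apply: eq_integral => t /set_mem; rewrite oitvE => t01.
  have ut : node k < affine (node k) (mesh k) t < node k.+1.
    by rewrite local_itvoo /affine local_affine.
  rewrite -EFinM /q /r (@glueE k); last by have /andP[/ltW -> ->] := ut.
  rewrite /flux (vglueE ut) /affine local_affine mulrDr.
  congr EFin; congr (_ + _).
    rewrite RintegralZr//; last first.
      apply: integrable_Cc; first by apply: probm_radon; apply: probm_piece; lra.
      by apply: Cct_Cc; have [_ CDt _] := C1t_Cct Hz.
    by rewrite mulrCA mulVf ?gt_eqF// mulr1.
  rewrite mulr_sumr; apply: eq_bigr => i _.
  rewrite -RintegralZl//; last first.
    apply: (integrable_vCc i (vn _ t01)); apply: Cct_Cc.
    by have [_ _ CD] := C1t_Cct Hz; exact: CD.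
  by apply: eq_Rintegral => x _ /=; rewrite mxE; ring.
have := congr1 (fun z => (mesh k)%:E * z)%E (etrans (esym E) E2).
rewrite !muleA -EFinM divff ?gt_eqF// !mul1e => E3.
change (fine (\int[leb]_(x in `]node k, node k.+1[) (q x)%:E)%E = fine (\int[leb]_(x in oitv 1) (r x)%:E)%E).
by rewrite E3.
Qed.

Lemma node_increment k : (\int[leb]_(t in `]0%R, node k.+1[) q t)%R =
  (\int[s k.+1]_x zeta x (node k.+1))%R - (\int[s 0%N]_x zeta x 0)%R.
Proof.
elim: k => [|k IH]; first by rewrite -[in `]0, _[](@node0 R) piece_increment node0.
have nk0 : 0 < node k.+1 :> R by rewrite nodeS ltr_wpDl ?node_ge0// mesh_gt0.
have nkk : node k.+1 < node k.+2 :> R by rewrite [ltRHS]nodeS ltrDl mesh_gt0.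
have nk1 := @node_lt1 R k.+2.
rewrite (_ : `]0, node k.+2[%classic = `]0, node k.+1[%classic `|` `[node k.+1, node k.+2[%classic); last first.
  apply/seteqP; split => t /=; rewrite !in_itv/=.
    by move=> /andP[t0 t2]; case: (ltP t (node k.+1)) => h; [left; rewrite t0|right; rewrite ?h].
  by move=> [/andP[t0 t1]|/andP[t0 t1]]; apply/andP; split; lra.
rewrite Rintegral_setU//; last 2 first.
- apply: integrable_rateS; first by apply: measurableU; exact: measurable_itv.
  by move=> t /= []; rewrite in_itv/= oitvE => /andP[? ?]; apply/andP; split; lra.
- apply/disj_setPS => t /= []; rewrite !in_itv/= => /andP[_ h1] /andP[h2 _].
  by have := lt_le_trans h1 h2; rewrite ltxx.
rewrite IH -Rintegral_itv_obnd_cbnd; last by apply: integrable_rateS; [exact: measurable_itv|exact: pieces_sub].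
by rewrite piece_increment; ring.
Qed.

End weak.

(** A test function vanishes after some b < 1, so only finitely many pieces count and the
    accumulation of nodes at time 1 is not seen. The increments telescope to values of zeta at times
    where it is 0. *)
Lemma glue_CE : CE_from_to 1 (s 0%N) mu glue vglue.
Proof.
split; last first.
  move=> A mA; split; last by rewrite /glue ltxx.
  have h : node 0 <= (0 : R) < node 1 by rewrite node0 lexx nodeS node0 add0r mesh_gt0.
  rewrite (glueE h) /local node0 subrr mul0r.
  by have [_ ends] := CEk 0; exact: (ends _ mA).1.
have cu := glue_curve.
case: (cu) => h1 [h2 [h3 [h4 h5]]]; do 5 (split => //).
move=> zeta Cz; have Hz := C1c_C1t Cz.
have [_ [_ [_ [_ [_ [r0 [a [b [a0 [b1 z0]]]]]]]]]] := Cz.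
have [_ CDt _] := C1t_Cct Hz.
have iR := integrable_rate Hz.
have i1 := curve_integrable_mu cu CDt; have i2 := integrable_flux cu Hz.
set q := (fun t => (\int[glue t]_x partial_t zeta x t)%R + flux vglue (partial_x zeta) t) in iR.
transitivity ((\int[leb]_(t in oitv 1) q t)%R)%:E.
  rewrite /Rintegral fineK; last by apply: integrable_fin_num => //; exact: measurable_oitv.
  have -> : (\int[leb]_(t in oitv 1) (q t)%:E = \int[leb]_(t in oitv 1) ((\int[glue t]_x partial_t zeta x t)%R)%:E
     + \int[leb]_(t in oitv 1) (flux vglue (partial_x zeta) t)%:E)%E.
    by rewrite -(integralD _ i1 i2)//; exact: measurable_oitv.
  congr (_ + _)%E; apply: eq_integral => t /set_mem; rewrite oitvE => t01.
    by rewrite Rint_EFin//; apply: integrable_Cc; [apply: (curve_radon cu); lra|exact: Cct_Cc].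
  by rewrite (flux_EFin cu Hz t01).
congr EFin.
have [k0 bk0] := node_gt b1; have [k bk] : exists k, b < node k.+1.
  by exists k0; apply: lt_le_trans bk0 (node_le (leqnSn _)).
have nk1 := @node_lt1 R k.+1.
have nk0 : 0 < node k.+1 :> R by rewrite nodeS ltr_wpDl ?node_ge0// mesh_gt0.
rewrite (_ : oitv 1 = `]0, node k.+1[%classic `|` `[node k.+1, 1[%classic); last first.
  apply/seteqP; split => t /=; rewrite ?oitvE !in_itv/=.
    by move=> /andP[t0 t2]; case: (ltP t (node k.+1)) => h; [left; rewrite t0|right; rewrite ?h].
  by move=> [/andP[t0 t1]|/andP[t0 t1]]; apply/andP; split; lra.
have sub1 : `]0, node k.+1[%classic `<=` oitv (1 : R).
  by move=> t; rewrite oitvE /= in_itv/= => /andP[? ?]; apply/andP; split; lra.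
have sub2 : `[node k.+1, 1[%classic `<=` oitv (1 : R).
  by move=> t; rewrite oitvE /= in_itv/= => /andP[? ?]; apply/andP; split; lra.
rewrite Rintegral_setU//; last 2 first.
- apply: (integrable_rateS Hz); first by apply: measurableU; exact: measurable_itv.
  by move=> t [/sub1|/sub2].
- apply/disj_setPS => t /= []; rewrite !in_itv/= => /andP[_ g1] /andP[g2 _].
  by have := lt_le_trans g1 g2; rewrite ltxx.
rewrite (node_increment Hz).
have z1 x : zeta x (node k.+1) = 0 by apply: z0; right; right.
have z2 x : zeta x 0 = 0 by apply: z0; right; left.
have R0 (m : Meas) (g : X -> R) : (forall x, g x = 0) -> (\int[m]_x g x)%R = 0.
  by move=> g0; rewrite /Rintegral (eq_integral (fun=> 0%E)) ?integral0// => x _; rewrite g0.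
rewrite !R0// subrr add0r.
rewrite /Rintegral (eq_integral (fun=> 0%E)) ?integral0// => t /set_mem; rewrite /= in_itv/= => /andP[t1 t2].
have bt : b < t by exact: lt_le_trans bk t1.
have Dt0 x : partial_t zeta x t = 0.
  have [dt _] := Hz; apply: (is_derive_uniq (dt x t)).
  have c0 := @is_derive_cst R R R (0 : R) t 1.
  apply: near_eq_is_derive c0.
  by near=> u; rewrite z0//; right; right; near: u; exact: lt_nbhsr.
have D0 i x : partial_x zeta i x t = 0.
  have [_ [dx _]] := Hz; apply: (is_derive_uniq (dx i x t)).
  rewrite (_ : zeta^~ t = cst 0); first exact: is_derive_cst.
  by apply/funext => y; rewrite z0//; right; right.
rewrite /q R0// add0r /flux big1// => i _.
by apply: R0 => x; rewrite D0 mul0r.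
Unshelve. all: by end_near.
Qed.

Lemma Wdist_glue : (Wdist p phi gamma (s 0%N) mu <= e%:E)%E.
Proof. exact: (Wdist_le p1 adm (ltW e0) glue_CE glue_action). Qed.

End gluing.

(** * The vague limit of a Cauchy sequence and convergence to it *)

Section completeness.
Context {R : realType} {d : nat}.
Notation Rd := 'rV[R]_d.
Notation X := (@BRd R d).
Notation Meas := ({measure set X -> \bar R}).
Variables (p : R) (phi : R -> Rd -> R) (gamma : Meas) (kappa : R).
Hypotheses (p1 : 1 < p) (adm : admissible p phi) (rgamma : radon gamma).
Hypotheses (Hk : is_kappa p phi kappa) (fin : (mtilde (- kappa) gamma < +oo)%E).
Variable mun : nat -> Meas.
Hypotheses (pmn : forall n, probm (mun n))
  (cauchy : forall e : R, 0 < e -> exists N : nat, forall m n : nat, (N <= m)%N -> (N <= n)%N ->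
     (Wdist p phi gamma (mun m) (mun n) < e%:E)%E).

Lemma cauchy_Cc f : Cc f -> cvgn (fun n => (\int[mun n]_x f x)%R).
Proof.
move=> Cf; apply: cauchy_cvg; apply: cauchy_exP => eps e0.
have e2 : 0 < eps / 2 by rewrite divr_gt0.
have [eta eta0 H] := Wdist_modulus p1 adm rgamma Hk fin Cf e2.
have [N HN] := cauchy eta0.
exists (\int[mun N]_x f x)%R; exists N => // n /= Nn.
rewrite -ball_normE /ball_/= distrC; apply: (@le_lt_trans _ _ (eps / 2)); last by lra.
by apply: H => //; apply: HN.
Qed.

Definition vague_lim (f : Rd -> R) : R := limn (fun n => (\int[mun n]_x f x)%R).

Lemma vague_limP f : Cc f -> (\int[mun n]_x f x)%R @[n --> \oo] --> vague_lim f.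
Proof. exact: cauchy_Cc. Qed.

Lemma vague_lim_lin a b f g : Cc f -> Cc g ->
  vague_lim (fun x => a * f x + b * g x) = a * vague_lim f + b * vague_lim g.
Proof.
move=> Cf Cg; apply/cvg_lim => //.
rewrite (_ : (fun n => _) = (fun n => a * (\int[mun n]_x f x)%R + b * (\int[mun n]_x g x)%R)).
  by apply: cvgD; apply: cvgM; [exact: cvg_cst|exact: vague_limP|exact: cvg_cst|exact: vague_limP].
apply/funext => n; have rn := probm_radon (pmn n).
have i1 := integrable_Cc rn Cf; have i2 := integrable_Cc rn Cg.
rewrite RintegralD//; [|exact: (integrableZl measurableT a i1)|exact: (integrableZl measurableT b i2)].
by rewrite !RintegralZl.
Qed.

Lemma vague_lim_ge0 f : Cc f -> (forall x, 0 <= f x) -> 0 <= vague_lim f.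
Proof.
move=> Cf f0; apply: limr_ge; first exact: cauchy_Cc.
by apply: nearW => n; apply: Rintegral_ge0 => x _.
Qed.

Lemma vague_lim_le1 f : Cc f -> (forall x, f x <= 1) -> vague_lim f <= 1.
Proof.
move=> Cf f1; apply: limr_le; first exact: cauchy_Cc.
apply: nearW => n; have rn := probm_radon (pmn n); have i1 := integrable_Cc rn Cf.
have i2 : (mun n).-integrable setT (EFin \o (fun=> 1)).
  by apply: (@probm_integrable R d _ (fun=> 1) 1) => // x; rewrite normr1.
apply: le_trans (le_Rintegral measurableT i1 i2 _) _; first by move=> x _; exact: f1.
by have /= E := integral_cst (mun n) measurableT (1 : R)%:E; rewrite /Rintegral E mul1e (pmn n).
Qed.

(** From some index [N] on all measures are within distance 1 of [mun N]. A cutoff that carries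
    nearly all of [mun N] works for all of them, since a curve of action at most 1 changes its mass
    by at most e / 2. *)
Lemma vague_lim_tight e : 0 < e ->
  exists chi, [/\ Ccp chi, (forall x, chi x <= 1) & 1 - e <= vague_lim chi].
Proof.
move=> e0; have e2 : 0 < e / 2 by rewrite divr_gt0.
have [M1 M10 HM1] := cutoff_variation_prob p1 adm Hk fin ler01 e2.
have [N HN] := cauchy ltr01.
have [M2 [M20 HM2]] := cutoff_tight p (pmn N) e2.
pose M := Num.max M1 M2; have M0 : 0 < M by rewrite lt_max M10.
have Cchi : Cc (cutoff (cexp p) M : Rd -> R).
  by apply: Cc_C1s; [exact: C1s_cutoff|exact: cpt_supp_cutoff].
exists (cutoff (cexp p) M); split.
- by split => // x; exact: cutoff_ge0.
- by move=> x; exact: cutoff_le1.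
apply: limr_ge; first exact: cauchy_Cc.
exists N => // n /= Nn.
have [mu [nu [ce act]]] := Wdist_curve p1 adm ltr01 (HN N n (leqnn N) Nn).
have act' : (action phi gamma mu nu <= 1%:E)%E by move: act; rewrite powR1 => /ltW.
have [ce' ends] := ce.
have ps : probm (mu 0) by rewrite /probm (ends _ measurableT).1; exact: pmn.
have z01 : 0 <= (0 : R) <= 1 by rewrite lexx ler01.
have o01 : 0 <= (1 : R) <= 1 by rewrite lexx ler01.
have h1 : M1 <= M by rewrite le_max lexx.
have h2 : M2 <= M by rewrite le_max lexx orbT.
have := HM1 M h1 mu nu ce' act' 0 1 z01 o01 ps.
have [-> ->] := CE_endpoints (cutoff (cexp p) M : X -> R) ce.
have := HM2 M h2; rewrite ler_norml; lra.
Qed.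

Lemma Wdist_complete : exists mu : Meas,
  probm mu /\ (fun n => Wdist p phi gamma (mun n) mu) @ \oo --> 0%E.
Proof.
pose mu := daniell_measure vague_lim_lin vague_lim_ge0.
have pm : probm mu := daniell_probm vague_lim_lin vague_lim_ge0 vague_lim_le1 vague_lim_tight.
exists mu; split => //.
have vag f : Cc f -> (\int[mun n]_x f x)%R @[n --> \oo] --> (\int[mu]_x f x)%R.
  move=> Cf; rewrite (daniell_int vague_lim_lin vague_lim_ge0 vague_lim_le1 vague_lim_tight Cf).
  exact: vague_limP.
have key e : 0 < e -> exists N : nat, forall n, (N <= n)%N -> (Wdist p phi gamma (mun n) mu <= e%:E)%E.
  move=> e0.
  have /choice[N HN] k := cauchy (mulr_gt0 e0 (@mesh_gt0 R k)).
  exists (N 0%N) => n Nn.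
  (* The chain starts at n itself, so the glued curve bounds the distance from [mun n] to the limit
     directly; [idx k] is at least [N k], which makes step k shorter than e * mesh k. *)
  pose idx k := (n + \sum_(j < k) (N j.+1).+1)%N.
  have idxS k : idx k.+1 = (idx k + (N k.+1).+1)%N by rewrite /idx big_ord_recr/= addnA.
  have idxN k : (N k <= idx k)%N.
    case: k => [|k]; first by rewrite /idx big_ord0 addn0.
    by rewrite idxS (leq_trans (leqnSn _))// leq_addl.
  have idxk k : (k <= idx k)%N.
    by elim: k => // k IH; rewrite idxS addnS ltnS (leq_trans IH)// leq_addr.
  have /choice[c Hc] : forall k, exists c : (R -> Meas) * (R -> @vmeas R d),
      CE_from_to 1 (mun (idx k)) (mun (idx k.+1)) c.1 c.2 /\
      (action phi gamma c.1 c.2 <= ((e * mesh k) `^ p)%:E)%E.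
    move=> k; have W := HN k (idx k) (idx k.+1) (idxN k).
    have W' : (Wdist p phi gamma (mun (idx k)) (mun (idx k.+1)) < (e * mesh k)%:E)%E.
      by apply: W; rewrite idxS (leq_trans (idxN k))// leq_addr.
    have [mk [nk [ce act]]] := Wdist_curve p1 adm (mulr_gt0 e0 (@mesh_gt0 R k)) W'.
    by exists (mk, nk); split => //; exact: ltW.
  have -> : mun n = mun (idx 0%N) by rewrite /idx big_ord0 addn0.
  apply: (Wdist_glue p1 adm rgamma Hk fin (mk := fun k => (c k).1) (nk := fun k => (c k).2)
    (s := fun k => mun (idx k))) => //.
  - by move=> k; have [] := Hc k.
  - by move=> k; have [] := Hc k.
  - move=> f Cf; apply: (@cvg_comp _ _ _ idx (fun n => (\int[mun n]_x f x)%R)); last exact: vag.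
    move=> A [M _ HM]; exists M => // k /= Mk; apply: HM => /=.
    exact: leq_trans Mk (idxk k).
apply/fine_cvgP; split.
  have [N HN] := key 1 ltr01; exists N => // n /= Nn.
  by rewrite ge0_fin_numE ?Wdist_ge0//; apply: le_lt_trans (HN n Nn) (ltry _).
apply/cvgrPdist_le => e e0; have [N HN] := key e e0; exists N => // n /= Nn.
have W0 := Wdist_ge0 p phi gamma (mun n) mu.
rewrite sub0r normrN ger0_norm ?fine_ge0//.
rewrite -lee_fin fineK; first exact: HN.
by rewrite ge0_fin_numE//; apply: le_lt_trans (HN n Nn) (ltry _).
Qed.

End completeness.

Theorem mainTheorem9 (R : realType) (d : nat) (p : R) (phi : R -> 'rV[R]_d -> R)
    (gamma : {measure set (@BRd R d) -> \bar R}) (kappa : R)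
    (sigma : {measure set (@BRd R d) -> \bar R}) :
  1 < p ->
  admissible p phi ->
  radon gamma ->
  is_kappa p phi kappa ->
  (mtilde (- kappa) gamma < +oo)%E ->
  probm sigma ->
  (* M_{phi,gamma}[sigma] is contained in P(R^d) *)
  (forall mu : {measure set (@BRd R d) -> \bar R},
      radon mu -> (Wdist p phi gamma mu sigma < +oo)%E -> probm mu) /\
  (* W_{phi,gamma}-convergence implies narrow convergence in P(R^d) *)
  (forall (mun : nat -> {measure set (@BRd R d) -> \bar R})
          (mu : {measure set (@BRd R d) -> \bar R}),
      (forall n, probm (mun n)) -> probm mu ->
      (fun n => Wdist p phi gamma (mun n) mu) @ \oo --> 0%E ->
      narrow_cvg mun mu) /\
  (* (P(R^d), W_{phi,gamma}) is complete *)
  (forall mun : nat -> {measure set (@BRd R d) -> \bar R},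
      (forall n, probm (mun n)) ->
      (forall e : R, 0 < e -> exists N : nat, forall m n : nat, (N <= m)%N -> (N <= n)%N ->
          (Wdist p phi gamma (mun m) (mun n) < e%:E)%E) ->
      exists mu : {measure set (@BRd R d) -> \bar R},
        probm mu /\ (fun n => Wdist p phi gamma (mun n) mu) @ \oo --> 0%E).
Proof.
move=> p1 adm rgamma Hk fin ps; split; [|split].
- by move=> mu _; exact: (Wdist_probm p1 adm Hk fin ps).
- by move=> mun mu pmn pm W; exact: (Wdist_narrow p1 adm rgamma Hk fin pmn pm W).
- by move=> mun pmn cauchy; exact: (Wdist_complete p1 adm rgamma Hk fin pmn cauchy).
Qed.
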